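(* For $\lambda,b\in\mathbb{C}$ let $f_{\lambda,b}(z)=\lambda z+bz^2+z^3$. Let $\mathcal{P}$ be the set of polynomials $f_{\lambda,b}$ with $|\lambda|\le1$ such that there exist polynomials $f_{\mu,c}$ arbitrarily close to $f_{\lambda,b}$ (in $(\mu,c)\in\mathbb{C}^2$) with $|\mu|<1$ and $[f_{\mu,c}]\in\mathrm{PHD}_3$, and for $|\lambda|\le 1$ let $\mathcal{P}_\lambda=\{b\in\mathbb{C}: f_{\lambda,b}\in\mathcal{P}\}$. Then for every $\lambda$ with $|\lambda|<1$ we have $0\in\mathrm{Int}(\mathcal{P}_\lambda)$, and for every $\lambda$ with $|\lambda|\le 1$ we have $0\in\mathcal{P}_\lambda$ and $\mathcal{P}_\lambda$ is a continuum.
   Context: $[g]$ denotes the affine conjugacy class of a polynomial $g$. $\mathrm{PHD}_3$ is the set of affine conjugacy classes of cubic polynomials both of whose critical points lie in the immediate basin of attraction of the same (super-)attracting fixed point. *)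

(* Defs.v *)
From HB Require Import structures.
From mathcomp Require Import all_boot all_order all_algebra.
From mathcomp Require Import all_classical all_reals all_analysis.
From mathcomp Require Import complex.
Set Implicit Arguments. Unset Strict Implicit. Unset Printing Implicit Defensive.
Import Order.TTheory GRing.Theory Num.Theory.
Import numFieldTopology.Exports numFieldNormedType.Exports.
Local Open Scope classical_set_scope.
Local Open Scope ring_scope.

Definition Cplx (R : realType) : numClosedFieldType := R[i].

Section Dynamics.
Variable R : realType.
Local Notation C := (Cplx R).

Definition fpoly (lam b : C) : {poly C} := lam *: 'X + b *: 'X^2 + 'X^3.

Definition basin (g : C -> C) (p : C) : set C :=
  [set z | (iter n g z) @[n --> \oo] --> p].

Definition immediate_basin (g : C -> C) (p : C) : set C :=
  connected_component (basin g p) p.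

Definition crit_in_one_immediate_basin (h : {poly C}) : Prop :=
  exists p : C, [/\ h.[p] = p, `|h^`().[p]| < 1 &
    forall z, root h^`() z -> immediate_basin (horner h) p z].

(* Affine conjugate A o g o A^{-1} of g, where A(z) = a z + t. *)
Definition aff_conj (a t : C) (g : {poly C}) : {poly C} :=
  a *: (g \Po (a^-1 *: ('X - t%:P))) + t%:P.

Definition in_PHD3 (g : {poly C}) : Prop :=
  size g = 4%N /\
  exists a t : C, a != 0 /\ crit_in_one_immediate_basin (aff_conj a t g).

Definition Pset (lam : C) : set C :=
  [set b | `|lam| <= 1 /\
     closure [set mc : C * C | `|mc.1| < 1 /\ in_PHD3 (fpoly mc.1 mc.2)]
       (lam, b)].

Definition continuum (A : set C) : Prop :=
  A !=set0 /\ compact A /\ connected A.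

End Dynamics.

(* Main.v *)
(* The immediate basin of 0 of f = f_{mu,c}, |mu| < 1, is the increasing union of the
   components L_n(r) around 0 of {|f^n| < r}, for any small r. So everything reduces to
   counting roots of polynomials in such components, through the Riemann-Hurwitz inequality
   (at most one root more than critical points), and to the maximum principle for rational
   functions of one parameter.

   Let H be the set of (mu, c), |mu| < 1, for which both critical points lie in the immediate
   basin of 0; it is open and contains all (mu, 0), as f_{mu,0} is odd. The main point is that
   its slices H_mu, mu <> 0, are connected. Parametrise a slice by one critical point p, the
   other one being mu/(3p); up to the symmetry c -> -c it is enough that the two critical
   points a, b collide somewhere in each component U of the slice in the p-plane. Suppose that
   they do not. For large N the component of {|f^N| < r} around 0 meets one of them first when
   r grows; call that one early. If both are early somewhere in U, then |f^N(a)| = |f^N(b)|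
   there, and the quotient f^N(a)/f^N(b) can be turned to 1 in U, contradicting the injectivity
   of f^N below the critical level. Otherwise a, say, is early on the closure of U. Let m be
   the least level at which b enters L_m(|f^N(a)|) for some parameter in U. By Rouche's theorem
   some such parameter satisfies f^m(b) = f^{N+1}(a), hence f^{m-N-1}(b) = a, and a
   perturbation of it makes b enter at level m - 1.

   Finally the slices of H near lambda are connected and contain 0, so their limit, which is
   P_lambda, is connected; it is bounded because escape of a critical point is forced for
   large c. *)
Require Import Defs.
From HB Require Import structures.
From mathcomp Require Import all_boot all_order all_algebra.
From mathcomp Require Import all_classical all_reals all_analysis.
From mathcomp Require Import complex.
From mathcomp Require Import ring lra zify.
Set Implicit Arguments. Unset Strict Implicit. Unset Printing Implicit Defensive.
Import Order.TTheory GRing.Theory Num.Theory.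
Import numFieldTopology.Exports numFieldNormedType.Exports.
Local Open Scope classical_set_scope.
Local Open Scope ring_scope.

(** A collision forces [3 p^2 = mu], hence [c^2 = 3 mu]: every component of a slice contains one of
    only two parameters, exchanged by [c -> -c], and the component of 0 is symmetric and holds both.
    This needs [mu <> 0]; as [H] is open, slices with [mu <> 0] suffice for the closure. The level
    [N] is fixed for a whole slice by [|mu|^N * 26 < r0]: then [L_N(r0)] contains a critical point
    for all parameters in question, so one of the two is always early, and being early is a closed
    condition. Along a slice all iterates of critical points are Laurent polynomials in [p], so the
    maximum principle and Rouche's theorem are needed for their quotients only. The orbit of [b] is
    compared with [f^{N+1}(a)] and not with [f^N(a)] for two reasons: its modulus is at most
    [theta |f^N(a)|], below that of [f^m(b)] on the boundary of the entry set; and, while [b] is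
    outside [L_{N+1}], its only preimage there under [f^{N+1}] is [a], so that equal values mean a
    hit of [a]. Finally, 0 is the fixed point meant in [PHD_3] because its immediate basin always
    contains a critical point. *)

Section ComplexPlane.
Variable R : realType.
Local Notation C := (Cplx R).

(** The norm of [C] takes its values in [C]; a modulus with values in [R] makes all estimates
    statements of real arithmetic. *)
Definition cabs (z : C) : R := Normc.normc z.
Arguments cabs _ : simpl never.

Lemma cabsE (z : C) : `|z| = (cabs z)%:C%C.
Proof. by []. Qed.

Lemma cabs0 : cabs 0 = 0.
Proof. exact: Normc.normc0. Qed.

Lemma cabs1 : cabs 1 = 1.
Proof. exact: Normc.normc1. Qed.

Lemma cabsM x y : cabs (x * y) = cabs x * cabs y.
Proof. exact: Normc.normcM. Qed.

Lemma cabsV x : cabs x^-1 = (cabs x)^-1.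
Proof. exact: Normc.normcV. Qed.

Lemma cabsX x n : cabs (x ^+ n) = cabs x ^+ n.
Proof. by elim: n => [|n IH]; rewrite ?expr0 ?cabs1// !exprS cabsM IH. Qed.

Lemma cabsN x : cabs (- x) = cabs x.
Proof. exact: normcN. Qed.

Lemma cabs_sub x y : cabs (x - y) = cabs (y - x).
Proof. by rewrite -cabsN opprB. Qed.

Lemma cabsD x y : cabs (x + y) <= cabs x + cabs y.
Proof. exact: le_normcD. Qed.

Lemma cabs_ge0 x : 0 <= cabs x.
Proof. by case: x => a b; exact: sqrtr_ge0. Qed.

Lemma cabs_eq0 x : (cabs x == 0) = (x == 0).
Proof.
by apply/eqP/eqP => [/Normc.eq0_normc //|->]; exact: cabs0.
Qed.

Lemma cabs_gt0 x : (0 < cabs x) = (x != 0).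
Proof. by rewrite lt_def cabs_ge0 andbT cabs_eq0. Qed.

Lemma cabs_triangle z x y : cabs (x - y) <= cabs (x - z) + cabs (z - y).
Proof. by rewrite (_ : x - y = (x - z) + (z - y)) ?cabsD //; ring. Qed.

Lemma cabsB_ge x y : cabs x - cabs y <= cabs (x - y).
Proof. by have := cabsD (x - y) y; rewrite subrK => h; lra. Qed.

Lemma cabs_real (x : R) : cabs x%:C%C = `|x|.
Proof. by rewrite /cabs /= expr0n/= addr0 sqrtr_sqr. Qed.

Lemma cabs_scale_sub (w : C) (t : R) : cabs ((1 - t)%:C%C * w - w) = `|t| * cabs w.
Proof. by rewrite rmorphB rmorph1 mulrBl mul1r addrAC subrr add0r cabsN cabsM cabs_real. Qed.

Lemma cabs_scale (w : C) (t : R) : 0 <= t <= 1 -> cabs ((1 - t)%:C%C * w) = (1 - t) * cabs w.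
Proof. by move=> /andP[t0 t1]; rewrite cabsM cabs_real ger0_norm//; lra. Qed.

Lemma cabs_nat n : cabs n%:R = n%:R.
Proof. by rewrite -(rmorph_nat (real_complex R)) cabs_real normr_nat. Qed.

Lemma exists_below2 (x y : R) : 0 < x -> 0 < y -> exists t : R, [/\ 0 < t, t <= x & t <= y].
Proof.
by move=> x0 y0; exists (Num.min x y); rewrite lt_min x0 !ge_min !lexx orbT.
Qed.

Lemma cabs_prod (I : Type) (s : seq I) (F : I -> C) :
  cabs (\prod_(i <- s) F i) = \prod_(i <- s) cabs (F i).
Proof.
elim: s => [|a s IH]; first by rewrite !big_nil cabs1.
by rewrite !big_cons cabsM IH.
Qed.

Lemma lt_realC (x y : R) : (x%:C%C < y%:C%C :> C) = (x < y).
Proof. by rewrite ltcR. Qed.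

Lemma gt0C_real (e : C) : 0 < e -> exists2 d : R, 0 < d & e = d%:C%C.
Proof.
move=> e0; exists (complex.Re e).
  by move: e0; rewrite ltcE => /andP[_].
by move: e0; case: e => a b; rewrite ltcE /= => /andP[/eqP b0 _]; rewrite /real_complex_def b0.
Qed.

Lemma nbhs_cabs (x : C) (A : set C) :
  nbhs x A <-> exists2 e : R, 0 < e & forall y, cabs (y - x) < e -> A y.
Proof.
split.
  case/nbhs_ballP => e /= e0 eA; have [d d0 de] := gt0C_real e0.
  exists d => // y yx; apply: eA; rewrite -ball_normE /=.
  by rewrite distrC cabsE de lt_realC.
case=> e e0 eA; apply/nbhs_ballP; exists (e%:C%C) => /=; first by rewrite ltcR.
move=> y; rewrite -ball_normE /= distrC cabsE lt_realC; exact: eA.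
Qed.

Lemma openC_P (A : set C) :
  open A <-> forall x, A x -> exists2 e : R, 0 < e & forall y, cabs (y - x) < e -> A y.
Proof.
rewrite openE; split=> H x Ax.
  by have := H x Ax; rewrite /interior /= => /nbhs_cabs.
by apply/nbhs_cabs; exact: H.
Qed.

Lemma closureC_P (A : set C) x :
  closure A x <-> forall e : R, 0 < e -> exists2 y, A y & cabs (y - x) < e.
Proof.
split=> [H e e0|H B /nbhs_cabs[e e0 eB]].
  have /H[y [Ay yx]] : nbhs x [set y | cabs (y - x) < e].
    by apply/nbhs_cabs; exists e.
  by exists y.
by have [y Ay yx] := H e e0; exists y; split=> //; apply: eB.
Qed.

Definition cdisk (x : C) (e : R) : set C := [set y | cabs (y - x) < e].

Lemma open_cdisk (x : C) (e : R) : open (cdisk x e).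
Proof.
apply/openC_P => y; rewrite /cdisk /= => yx; exists (e - cabs (y - x)); first by lra.
by move=> z zy; rewrite /cdisk /=; have := cabs_triangle y z x; lra.
Qed.

Lemma cvgC_P (T : Type) (F : set_system T) (FF : Filter F) (f : T -> C) (l : C) :
  (f @ F --> l) <-> forall e : R, 0 < e -> F [set t | cabs (f t - l) < e].
Proof.
split=> [H e e0|H A /nbhs_cabs[e e0 eA]].
  apply: (H [set y | cabs (y - l) < e]).
  by apply/nbhs_cabs; exists e.
by apply: filterS (H e e0) => t /=; exact: eA.
Qed.

Lemma complex_pair_continuous : continuous (fun u : R * R => (u.1 +i* u.2)%C : C).
Proof.
move=> [a b]; apply/cvgC_P => e e0 /=.
have e20 : 0 < e / 2 by lra.
exists (ball a (e / 2), ball b (e / 2)) => /=.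
  by split; apply: nbhsx_ballx.
move=> u [/= ua ub]; rewrite /ball /= in ua ub.
rewrite [X in cabs X](_ : _ = ((u.1 - a)%:C%C + (u.2 - b)%:C%C * 'i%C : C)); last first.
  by apply/eqP; rewrite eq_complex /=; apply/andP; split; apply/eqP; ring.
apply: (le_lt_trans (cabsD _ _)); rewrite cabsM !cabs_real.
have -> : cabs 'i%C = 1 by rewrite /cabs /= expr0n/= expr1n add0r sqrtr1.
by rewrite (distrC u.1) (distrC u.2); lra.
Qed.

Lemma absRe_le (z : C) : `|complex.Re z| <= cabs z.
Proof.
case: z => a b; rewrite /cabs /= -sqrtr_sqr ler_sqrt ?addr_ge0 ?sqr_ge0//.
by rewrite lerDl sqr_ge0.
Qed.

Lemma absIm_le (z : C) : `|complex.Im z| <= cabs z.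
Proof.
case: z => a b; rewrite /cabs /= -sqrtr_sqr ler_sqrt ?addr_ge0 ?sqr_ge0//.
by rewrite lerDr sqr_ge0.
Qed.

Lemma cdisk_subset_compact (M : R) :
  exists2 K : set C, compact K & [set z | cabs z <= M] `<=` K.
Proof.
exists ((fun u : R * R => (u.1 +i* u.2)%C : C) @` (`[-M, M] `*` `[-M, M])).
  apply: continuous_compact.
    by apply: continuous_subspaceT; exact: complex_pair_continuous.
  by apply: compact_setX; exact: segment_compact.
move=> z /= zM; exists (complex.Re z, complex.Im z) => /=; last by case: z {zM}.
have h1 := absRe_le z; have h2 := absIm_le z.
by split; rewrite /= in_itv /= -ler_norml; lra.
Qed.

Lemma bounded_closed_compactC (A : set C) (M : R) :
  closed A -> (forall z, A z -> cabs z <= M) -> compact A.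
Proof.
move=> cA AM; have [K cK MK] := cdisk_subset_compact M.
by apply: (subclosed_compact cA cK) => z /AM; exact: MK.
Qed.

(** The near-covering form of compactness. [F] is a filter of parameters, or that of small positive
    reals when one uniform constant is wanted. *)
Lemma compact_tube (I : Type) (F : set_system I) (FF : Filter F) (K : set C)
    (P : I -> C -> Prop) : compact K ->
  (forall y, K y -> exists2 d : R, 0 < d &
     F [set i | forall z, cabs (z - y) < d -> P i z]) ->
  F [set i | forall z, K z -> P i z].
Proof.
move=> /compact_near_coveringP cK H.
have := cK I F P FF; apply => y Ky; have [d d0 Fd] := H y Ky.
exists ([set z | cabs (z - y) < d], [set i | forall z, cabs (z - y) < d -> P i z]) => /=.
  by split=> //; apply/nbhs_cabs; exists d.
by move=> [z i] /= [zy]; apply.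
Qed.

Lemma compact_max (K : set C) (f : C -> R) : compact K -> K !=set0 ->
  (forall y, K y -> forall e : R, 0 < e -> exists2 d : R, 0 < d &
    forall z, K z -> cabs (z - y) < d -> f z < f y + e) ->
  exists2 y, K y & forall z, K z -> f z <= f y.
Proof.
move=> cK [x0 Kx0] fc; apply: contrapT => noM.
have noM' : forall y, K y -> exists2 z, K z & f y < f z.
  move=> y Ky; apply: contrapT => H; apply: noM; exists y => // z Kz.
  by rewrite leNgt; apply/negP => fyz; apply: H; exists z.
(* The rays above the values of [f] generate a filter. Without a maximum, every point of [K] has a
   neighbourhood where [f] stays below one of these values; compactness gives a single [f w] above
   all values, its own included. *)
have FF : Filter (fun A : set R => exists2 w, K w & forall t, f w <= t -> A t).
  split=> [|A B [w Kw wA] [v Kv vB]|A B AB [w Kw wA]].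
  - by exists x0.
  - have [wv|vw] := leP (f w) (f v).
      by exists v => // t vt; split; [apply: wA; lra|apply: vB].
    by exists w => // t vt; split; [apply: wA|apply: vB; lra].
  - by exists w => // t /wA; exact: AB.
have := compact_tube FF (P := fun t z => K z -> f z < t) cK.
case.
  move=> y Ky; have [w Kw yw] := noM' y Ky.
  have [d d0 fd] := fc y Ky (f w - f y) ltac:(by lra).
  exists d => //; exists w => // t wt z zy Kz.
  by have := fd z Kz zy; lra.
by move=> w Kw /(_ (f w) (lexx _) w Kw Kw); rewrite ltxx.
Qed.

Lemma segment_connectedC (y z : C) :
  connected [set u | exists2 t : R, 0 <= t <= 1 & u = y + t%:C%C * (z - y)].
Proof.
have -> : [set u | exists2 t : R, 0 <= t <= 1 & u = y + t%:C%C * (z - y)] =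
  (fun t : R => y + t%:C%C * (z - y)) @` `[0, 1].
  apply/seteqP; split=> u /=.
    by move=> [t tt ->]; exists t => //; rewrite in_itv.
  by move=> [t]; rewrite in_itv => /= tt <-; exists t.
apply: connected_continuous_connected; first exact: segment_connected.
apply: continuous_subspaceT => t; apply/cvgC_P => e1 e10.
have k0 : 0 < e1 / (1 + cabs (z - y)).
  by apply: divr_gt0 => //; have := cabs_ge0 (z - y); lra.
have := @nbhsx_ballx _ R^o t _ k0.
apply: filterS => s; rewrite /ball /= => ts.
have -> : y + s%:C%C * (z - y) - (y + t%:C%C * (z - y)) = (s - t)%:C%C * (z - y).
  by rewrite rmorphB /=; ring.
rewrite cabsM cabs_real distrC.
have n0 := cabs_ge0 (z - y).
have : `|t - s| * (1 + cabs (z - y)) < e1 by rewrite -ltr_pdivlMr//; lra.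
by have := normr_ge0 (t - s); nra.
Qed.

Lemma segment_component (A : set C) y z :
  (forall t : R, 0 <= t <= 1 -> A (y + t%:C%C * (z - y))) ->
  connected_component A y z.
Proof.
move=> yzA.
exists [set u | exists2 t : R, 0 <= t <= 1 & u = y + t%:C%C * (z - y)] => //=; last first.
  by exists 1; rewrite ?lexx ?ler01// /= mul1r addrC subrK.
split; last exact: segment_connectedC.
  by exists 0; rewrite ?lexx ?ler01//= mul0r addr0.
by move=> u [t t01 ->]; exact: yzA.
Qed.

Lemma convex_connected (D : set C) :
  (forall x y (t : R), D x -> D y -> 0 <= t <= 1 -> D (x + t%:C%C * (y - x))) ->
  connected D.
Proof.
move=> cD; have [->|/set0P[x Dx]] := eqVneq D set0; first exact: connected0.
have -> : D = connected_component D x.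
  apply/seteqP; split; last exact: connected_component_sub.
  by move=> y Dy; apply: segment_component => t; exact: cD.
exact: component_connected.
Qed.

Lemma cdisk_convex (c x y : C) (r t : R) : cabs (x - c) < r -> cabs (y - c) < r ->
  0 <= t <= 1 -> cabs (x + t%:C%C * (y - x) - c) < r.
Proof.
move=> xr yr /andP[t0 t1].
have -> : x + t%:C%C * (y - x) - c = (1 - t)%:C%C * (x - c) + t%:C%C * (y - c).
  by rewrite rmorphB rmorph1; ring.
apply: (le_lt_trans (cabsD _ _)); rewrite !cabsM !cabs_real !ger0_norm; [|lra|lra].
have [t1'|t1'] := eqVneq t 1; first by rewrite t1'; lra.
have : t < 1 by rewrite lt_neqAle t1'.
by nra.
Qed.

Lemma open_connected_component (A : set C) x :
  open A -> open (connected_component A x).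
Proof.
move=> /openC_P oA; apply/openC_P => y Cy.
have Ay := connected_component_sub Cy.
have [e e0 eA] := oA y Ay; exists e => // z zy.
apply: connected_component_trans Cy _; apply: segment_component => t tt.
by apply: eA; apply: cdisk_convex; rewrite ?subrr ?cabs0.
Qed.

Lemma connected_component_clopen (A : set C) z x :
  open A -> A x -> closure (connected_component A z) x -> connected_component A z x.
Proof.
move=> /openC_P oA Ax /closureC_P Cx; have [e e0 eA] := oA x Ax.
have [y Cy yx] := Cx e e0.
apply: connected_component_trans Cy _; apply: segment_component => t tt.
by apply: eA; apply: cdisk_convex; rewrite ?subrr ?cabs0.
Qed.

(** The sets where [P] holds and where it fails are both relatively open in [A]. *)
Lemma connected_locally_constant (A : set C) (P : C -> Prop) : connected A ->
  (forall x, A x -> exists2 e : R, 0 < e & forall y, A y -> cabs (y - x) < e -> (P x <-> P y)) ->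
  forall x y, A x -> A y -> P x -> P y.
Proof.
move=> cA lcP x y Ax Ay Px.
have oQ : forall Q : C -> Prop, (forall x, A x -> exists2 e : R, 0 < e &
    forall y, A y -> cabs (y - x) < e -> (Q x -> Q y)) ->
    exists2 U : set C, open U & A `&` [set z | Q z] = A `&` U.
  move=> Q lQ; exists [set z | exists u, [/\ A u, Q u & exists e : R,
     [/\ 0 < e, cabs (z - u) < e & forall y, A y -> cabs (y - u) < e -> Q y]]].
    apply/openC_P => z /= [u [Au Qu [e [e0 zu eQ]]]].
    exists (e - cabs (z - u)); first lra.
    move=> v vz; exists u; split=> //; exists e; split=> //.
    by have := cabs_triangle z v u; lra.
  apply/seteqP; split=> z /= [Az].
    move=> Qz; split=> //; exists z; split=> //.
    have [e e0 eQ] := lQ z Az; exists e; split=> //; first by rewrite subrr cabs0.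
    by move=> v Av vz; apply: eQ Qz.
  by move=> [u [Au Qu [e [e0 zu eQ]]]]; split=> //; apply: eQ.
have [U oU AU] := oQ P (fun x Ax => let: ex_intro2 e e0 h := lcP x Ax in
   ex_intro2 _ _ e e0 (fun y Ay yx => proj1 (h y Ay yx))).
have [V oV AV] : exists2 U : set C, open U & A `&` [set z | ~ P z] = A `&` U.
  apply: oQ => u Au; have [e e0 h] := lcP u Au; exists e => // v Av vu nPu Pv.
  by apply: nPu; apply/(h v Av vu).
have AE : A `&` [set z | P z] = A.
  apply: cA; first by exists x.
    by exists U.
  exists (~` V); first exact: open_closedC.
  apply/seteqP; split=> z /= [Az h]; split=> //.
    move=> Vz; have : (A `&` [set z | ~ P z]) z by rewrite AV.
    by move=> [_ nPz]; exact: nPz.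
  by apply: contrapT => nP; apply: h; have [] : (A `&` V) z by rewrite -AV; split.
by have [] : (A `&` [set z | P z]) y by rewrite AE.
Qed.

(** Membership in [V] is locally constant on [A], since the last hypothesis keeps [A] off the
    boundary of [V]. *)
Lemma connected_sub_open (A V : set C) : connected A -> open V ->
  A `&` V !=set0 -> (forall x, A x -> closure V x -> V x) -> A `<=` V.
Proof.
move=> cA /openC_P oV [x [Ax Vx]] clV y Ay.
apply: (connected_locally_constant (P := V) cA) Ax Ay Vx => u Au.
have [Vu|nVu] := pselect (V u).
  by have [e e0 eV] := oV u Vu; exists e => // v _ /eV.
have : ~ closure V u by move=> clu; apply: nVu; exact: clV.
move=> /closureC_P /existsNP[e /not_implyP[e0 he]]; exists e => // v _ vu.
by split=> // Vv; exfalso; apply: he; exists v.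
Qed.

End ComplexPlane.

(** * Roots of complex polynomials and elementary estimates *)

Section Polynomials.
Variable R : realType.
Local Notation C := (Cplx R).
Implicit Types (p q g : {poly C}) (z w : C) (A V : set C).

Definition rts p : seq C := sval (closed_field_poly_normal p).

Lemma rtsE p : p = lead_coef p *: \prod_(z <- rts p) ('X - z%:P).
Proof. exact: svalP (closed_field_poly_normal p). Qed.

Lemma horner_rts p z : p.[z] = lead_coef p * \prod_(x <- rts p) (z - x).
Proof.
rewrite {1}[p]rtsE hornerZ horner_prod; congr (_ * _).
by apply: eq_bigr => x _; rewrite hornerXsubC.
Qed.

Lemma size_rts p : p != 0 -> size (rts p) = (size p).-1.
Proof.
move=> p0; rewrite [in RHS](rtsE p) size_scale ?lead_coef_eq0//.
by rewrite size_prod_XsubC.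
Qed.

Lemma mem_rts p z : p != 0 -> (z \in rts p) = root p z.
Proof.
move=> p0; rewrite [in RHS](rtsE p) rootZ ?lead_coef_eq0//.
by rewrite root_prod_XsubC.
Qed.

Lemma cabs_horner_rts p z :
  cabs p.[z] = cabs (lead_coef p) * \prod_(x <- rts p) cabs (z - x).
Proof. by rewrite horner_rts cabsM cabs_prod. Qed.

(** Each factor satisfies [|z - x| <= |z0 - x| (1 + |z - z0| / e)]. Mostly used in the
    contrapositive: a polynomial that is small at [z0] and not small at [z] has a root within [e] of
    [z0]. *)
Lemma poly_harnack p z0 (e : R) z : 0 < e ->
  (forall x, root p x -> e <= cabs (x - z0)) ->
  cabs p.[z] <= cabs p.[z0] * (1 + cabs (z - z0) / e) ^+ (size p).-1.
Proof.
move=> e0 pe; have [->|p0] := eqVneq p 0; first by rewrite !horner0 cabs0 mul0r.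
rewrite !cabs_horner_rts -mulrA ler_wpM2l ?cabs_ge0//.
rewrite -(size_rts p0).
have : all (fun x => e <= cabs (x - z0)) (rts p).
  by apply/allP => x; rewrite mem_rts//; exact: pe.
have d0 : 0 <= cabs (z - z0) by exact: cabs_ge0.
elim: (rts p) => [|x s IH] /=; first by rewrite !big_nil expr0 mulr1.
move=> /andP[xe /IH {}IH]; rewrite !big_cons exprS mulrACA.
apply: ler_pM => //; [exact: cabs_ge0|by apply: prodr_ge0 => i _; exact: cabs_ge0|].
have h := cabs_triangle z0 z x.
rewrite (cabs_sub x) in xe.
have : cabs (z - z0) <= cabs (z0 - x) * (cabs (z - z0) / e).
  rewrite mulrA ler_pdivlMr// mulrC ler_wpM2r//; lra.
by nra.
Qed.

Lemma poly_cont p z0 (e : R) : 0 < e ->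
  exists2 d : R, 0 < d & forall z, cabs (z - z0) < d -> cabs (p.[z] - p.[z0]) < e.
Proof.
elim/poly_ind: p e => [|p c IH] e e0.
  by exists 1 => // z _; rewrite !horner0 subrr cabs0.
have k0 : 0 < e / (cabs z0 + cabs p.[z0] + 2).
  by apply: divr_gt0 => //; have := cabs_ge0 z0; have := cabs_ge0 p.[z0]; lra.
set k := e / _ in k0.
pose k1 := Num.min k 1.
have k10 : 0 < k1 by rewrite lt_min k0 ltr01.
have [d d0 dp] := IH k1 k10.
exists (Num.min d k1); first by rewrite lt_min d0.
move=> z; rewrite lt_min => /andP[/dp h1 h2].
rewrite !hornerMXaddC.
have -> : p.[z] * z + c - (p.[z0] * z0 + c) =
  (p.[z] - p.[z0]) * (z - z0) + ((p.[z] - p.[z0]) * z0 + p.[z0] * (z - z0)) by ring.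
apply: (le_lt_trans (cabsD _ _)).
apply: (@le_lt_trans _ _ (cabs ((p.[z] - p.[z0]) * (z - z0)) +
   (cabs ((p.[z] - p.[z0]) * z0) + cabs (p.[z0] * (z - z0))))).
  by rewrite lerD2l cabsD.
rewrite !cabsM.
have k1k : k1 <= k by rewrite ge_min lexx.
have k11 : k1 <= 1 by rewrite ge_min lexx orbT.
have ke : k * (cabs z0 + cabs p.[z0] + 2) = e.
  by rewrite /k mulfVK// gt_eqF//; have := cabs_ge0 z0; have := cabs_ge0 p.[z0]; lra.
have a0 := cabs_ge0 (p.[z] - p.[z0]); have b0 := cabs_ge0 (z - z0).
have c0 := cabs_ge0 z0; have d0' := cabs_ge0 p.[z0].
have : cabs (p.[z] - p.[z0]) * cabs (z - z0) <= k1 * 1.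
  by apply: ler_pM => //; lra.
have : cabs (p.[z] - p.[z0]) * cabs z0 <= k1 * cabs z0 by rewrite ler_wpM2r// ltW.
have : cabs p.[z0] * cabs (z - z0) <= cabs p.[z0] * k1 by rewrite ler_wpM2l// ltW.
nra.
Qed.

Lemma size_subC p w : (1 < size p)%N -> size (p - w%:P) = size p.
Proof.
move=> p1; rewrite size_polyDl// size_polyN size_polyC.
by apply: leq_ltn_trans p1; case: (w == 0).
Qed.

Lemma subC_neq0 p w : (1 < size p)%N -> p - w%:P != 0.
Proof. by move=> p1; rewrite -size_poly_gt0 size_subC//; lia. Qed.

Lemma rootBC p w z : root (p - w%:P) z = (p.[z] == w).
Proof. by rewrite rootE !hornerE subr_eq0. Qed.

Lemma poly_has_root p w : (1 < size p)%N -> exists z, p.[z] = w.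
Proof.
move=> p1; have : size (p - w%:P) != 1%N by rewrite size_subC//; lia.
by move=> /closed_rootP[z]; rewrite rootBC => /eqP; exists z.
Qed.

(** Apply [poly_harnack] to [p - w] between [z0] and a point [z1] with [p(z1) = p(z0) + 1]: without
    a root in the disk, [1 - |w - p(z0)|] would be at most [K |w - p(z0)|], which fails below
    [1 / (K + 1)]. *)
Lemma poly_open p z0 (e : R) : (1 < size p)%N -> 0 < e ->
  exists2 d : R, 0 < d & forall w, cabs (w - p.[z0]) < d ->
    exists2 z, cabs (z - z0) < e & p.[z] = w.
Proof.
move=> p1 e0; have [z1 pz1] := poly_has_root (p.[z0] + 1) p1.
pose K := (1 + cabs (z1 - z0) / e) ^+ (size p).-1.
have K0 : 0 < K.
  apply: exprn_gt0; have := divr_ge0 (cabs_ge0 (z1 - z0)) (ltW e0); lra.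
have iK : 0 < (K + 1)^-1 by rewrite invr_gt0; lra.
exists (K + 1)^-1 => // w wd; apply: contrapT => H.
have := @poly_harnack (p - w%:P) z0 e z1 e0.
rewrite size_subC// !hornerE pz1 => /(_ _)/wrap[].
  move=> x; rewrite rootBC => /eqP px; rewrite leNgt; apply/negP => xz.
  by apply: H; exists x.
rewrite -/K (cabs_sub p.[z0]) => h.
have : 1 - cabs (w - p.[z0]) <= cabs (p.[z0] + 1 - w).
  rewrite -cabs1 (_ : p.[z0] + 1 - w = 1 - (w - p.[z0])); last by ring.
  exact: cabsB_ge.
have : (K + 1) * (K + 1)^-1 = 1 by rewrite divff// gt_eqF//; lra.
by nra.
Qed.

Lemma poly_unbounded p (M : R) : (1 < size p)%N ->
  exists B : R, forall z, cabs p.[z] <= M -> cabs z <= B.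
Proof.
move=> p1.
have p0 : p != 0 by rewrite -size_poly_gt0; lia.
have l0 : 0 < cabs (lead_coef p) by rewrite cabs_gt0 lead_coef_eq0.
pose K := 1 + `|M| / cabs (lead_coef p).
have K1 : 1 <= K by rewrite lerDl divr_ge0// ltW.
(* Beyond this radius every factor [|z - x|] is at least [K >= 1], so the product is at least [K],
   and [K] times the leading coefficient exceeds [M] in modulus. *)
exists (K + \sum_(x <- rts p) cabs x) => z pM; rewrite leNgt; apply/negP => zB.
move: pM; rewrite cabs_horner_rts leNgt => /negP; apply.
have lK : M < cabs (lead_coef p) * K.
  rewrite /K mulrDr mulr1 mulrCA divff ?gt_eqF// mulr1.
  by have := ler_norm M; lra.
apply: (lt_le_trans lK); apply: ler_wpM2l; first exact: ltW.
have : (0 < size (rts p))%N by rewrite size_rts//; lia.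
move: zB; case: (rts p) => // a s; rewrite !big_cons => zB _.
have sp : forall t : seq C, 0 <= \sum_(x <- t) cabs x.
  by move=> t; apply: sumr_ge0 => i _; exact: cabs_ge0.
have zK : forall x (t : seq C), K + \sum_(x <- t) cabs x < cabs z -> x \in t -> K <= cabs (z - x).
  move=> x t zt xt; have := cabsB_ge z x.
  have : cabs x <= \sum_(x <- t) cabs x.
    by rewrite (big_rem x)//= lerDl.
  lra.
have h1 : K <= cabs (z - a).
  by apply: (zK _ (a :: s)); rewrite ?mem_head// big_cons.
have h2 : 1 <= \prod_(x <- s) cabs (z - x).
  have : K + \sum_(x <- s) cabs x < cabs z by have := cabs_ge0 a; lra.
  elim: s {zB h1} => [|b s IH] zs; first by rewrite big_nil.
  rewrite big_cons -[X in X <= _]mulr1; apply: ler_pM => //.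
    by apply: le_trans K1 _; apply: (zK _ (b :: s)); rewrite ?mem_head.
  by apply: IH; move: zs; rewrite big_cons; have := cabs_ge0 b; lra.
rewrite -[X in X <= _]mulr1; apply: ler_pM => //; lra.
Qed.

End Polynomials.

(** * Counting roots with multiplicity *)

Section Counting.
Variable R : realType.
Local Notation C := (Cplx R).
Implicit Types (p q g f : {poly C}) (z w : C) (A V : set C).

(* Counted with multiplicity; meaningless for [p = 0]. *)
Definition nroots p A : nat := count (fun x => `[<A x>]) (rts p).

Lemma perm_rts p (c : C) (s : seq C) : c != 0 ->
  p = c *: \prod_(x <- s) ('X - x%:P) -> perm_eq (rts p) s.
Proof.
move=> c0 pE; apply: prod_XsubC_eq; apply: (scalerI c0); rewrite -pE.
by rewrite [RHS]rtsE pE lead_coefZ (monicP (monic_prod_XsubC _ _ _)) mulr1.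
Qed.

Lemma nrootsE p (c : C) (s : seq C) A : c != 0 ->
  p = c *: \prod_(x <- s) ('X - x%:P) ->
  nroots p A = count (fun x => `[<A x>]) s.
Proof. by move=> c0 /(perm_rts c0)/permP; apply. Qed.

Lemma nrootsM p q A : p != 0 -> q != 0 -> nroots (p * q) A = (nroots p A + nroots q A)%N.
Proof.
move=> p0 q0; rewrite -count_cat; apply: (@nrootsE _ (lead_coef p * lead_coef q)).
  by rewrite mulf_neq0// lead_coef_eq0.
by rewrite {1}[p]rtsE {1}[q]rtsE big_cat /= -scalerAl -scalerAr scalerA.
Qed.

Lemma nrootsXsubC z A : nroots ('X - z%:P) A = `[<A z>].
Proof.
rewrite (@nrootsE _ 1 [:: z])//= ?addn0 ?oner_eq0//.
by rewrite big_seq1 scale1r.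
Qed.

Lemma nroots_exp p n A : p != 0 -> nroots (p ^+ n) A = (n * nroots p A)%N.
Proof.
move=> p0; elim: n => [|n IH].
  rewrite expr0 mul0n (@nrootsE _ 1 [::])//= ?oner_eq0//.
  by rewrite big_nil scale1r.
by rewrite exprS nrootsM ?expf_neq0// IH mulSn.
Qed.

Lemma nroots_gt0 p A : p != 0 -> (0 < nroots p A)%N <-> exists2 x, A x & root p x.
Proof.
move=> p0; rewrite -has_count; split.
  by case/hasP => x; rewrite mem_rts// => px /asboolP Ax; exists x.
by case=> x Ax px; apply/hasP; exists x; rewrite ?mem_rts//; exact/asboolP.
Qed.

Lemma nroots_sub p A V : A `<=` V -> (nroots p A <= nroots p V)%N.
Proof. by move=> AV; apply: sub_count => x /asboolP /AV Vx; exact/asboolP. Qed.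

Lemma nroots_disj p A B V : A `&` B = set0 -> A `<=` V -> B `<=` V ->
  (nroots p A + nroots p B <= nroots p V)%N.
Proof.
move=> AB AV BV; rewrite /nroots -count_predUI addnC.
rewrite (_ : count (predI _ _) _ = 0)%N ?add0n.
  by apply: sub_count => x /orP[] /asboolP /= h; apply/asboolP; [exact: AV|exact: BV].
apply/eqP; rewrite -leqn0 leqNgt -has_count; apply/negP => /hasP[x _ /andP[]].
by move=> /asboolP Ax /asboolP Bx; have : (A `&` B) x by []; rewrite AB.
Qed.

Lemma nrootsU p A B : A `&` B = set0 ->
  nroots p (A `|` B) = (nroots p A + nroots p B)%N.
Proof.
move=> AB; apply/eqP; rewrite eqn_leq; apply/andP; split; last first.
  exact: nroots_disj.
rewrite /nroots -count_predUI; apply: leq_trans (leq_addr _ _).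
apply: sub_count => x /asboolP [h|h]; apply/orP; [left|right]; exact/asboolP.
Qed.

Lemma nrootsT p : p != 0 -> nroots p setT = (size p).-1.
Proof.
move=> p0; rewrite -size_rts// /nroots (eq_count (a2 := predT)) ?count_predT//.
by move=> x; apply/asboolP.
Qed.

Lemma nroots_eq p A B : (forall x, root p x -> (A x <-> B x)) ->
  nroots p A = nroots p B.
Proof.
have [->|p0] := eqVneq p 0.
  move=> h; congr count; apply: funext => x; congr asbool; apply/propext; apply: h.
  exact: root0.
move=> h; apply: eq_in_count => x; rewrite mem_rts// => /h AB.
by apply/asboolP/asboolP => /AB.
Qed.

Lemma nroots_compl p A : p != 0 -> (nroots p A + nroots p (~` A) = (size p).-1)%N.
Proof. by move=> p0; rewrite -nrootsU ?setICr// setUCr nrootsT. Qed.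

Lemma nroots_comp p f V : p != 0 -> (1 < size f)%N ->
  nroots (p \Po f) V = (\sum_(y <- rts p) nroots (f - y%:P) V)%N.
Proof.
move=> p0 f1; rewrite {1}[p]rtsE comp_polyZ -[LHS]add0n.
have -> : (\prod_(z <- rts p) ('X - z%:P)) \Po f = \prod_(z <- rts p) (f - z%:P).
  elim: (rts p) => [|a s IH]; first by rewrite !big_nil comp_polyC.
  by rewrite !big_cons comp_polyM IH comp_polyB comp_polyX comp_polyC.
have -> : forall q, nroots (lead_coef p *: q) V = nroots q V.
  move=> q; have [->|q0] := eqVneq q 0; first by rewrite scaler0.
  apply: (@nrootsE _ (lead_coef p * lead_coef q)).
    by rewrite mulf_neq0// lead_coef_eq0.
  by rewrite {1}[q]rtsE scalerA.
rewrite add0n; elim: (rts p) => [|a s IH].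
  by rewrite !big_nil (@nrootsE _ 1 [::])//= ?oner_eq0// big_nil scale1r.
rewrite !big_cons nrootsM ?subC_neq0// ?IH//.
by rewrite prodf_seq_neq0; apply/allP => i _; rewrite subC_neq0.
Qed.

Lemma nroots_factor p z : p != 0 ->
  exists2 q, q.[z] != 0 & p = q * ('X - z%:P) ^+ nroots p [set z].
Proof.
move=> p0; have [m [q]] := multiplicity_XsubC p z; rewrite p0 /= => qz pE.
have q0 : q != 0 by apply: contraNneq qz => ->; rewrite root0.
exists q; first by rewrite -rootE.
suff -> : nroots p [set z] = m by [].
rewrite pE nrootsM ?expf_neq0 ?polyXsubC_eq0// nroots_exp ?polyXsubC_eq0//.
rewrite nrootsXsubC asboolT// muln1.
rewrite (_ : nroots q _ = 0)%N ?add0n//.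
apply/eqP; rewrite -leqn0 leqNgt; apply/negP.
by move=> /(nroots_gt0 _ q0)[x ->]; exact/negP.
Qed.

(** For [p = q (X - z)^(m+1)] the derivative is [(X - z)^m] times a cofactor whose value at [z] is
    [(m + 1) q(z)], nonzero in characteristic 0. *)
Lemma nroots_deriv p z : p != 0 -> root p z ->
  nroots p [set z] = (nroots p^`() [set z]).+1.
Proof.
move=> p0 pz; have [q qz pE] := nroots_factor z p0.
have : (0 < nroots p [set z])%N by apply/(nroots_gt0 _ p0); exists z.
move: pE; case: (nroots p [set z]) => // m pE _.
pose s := q^`() * ('X - z%:P) + q *+ m.+1.
have sz : s.[z] != 0.
  by rewrite /s !hornerE subrr mulr0 add0r hornerMn mulrn_eq0 negb_or.
have s0 : s != 0 by apply: contraNneq sz => ->; rewrite horner0.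
have -> : p^`() = s * ('X - z%:P) ^+ m.
  rewrite pE derivM deriv_exp derivXsubC mul1r /s mulrDl exprS mulrA /=.
  by rewrite mulrnAl mulrnAr.
rewrite nrootsM ?expf_neq0 ?polyXsubC_eq0// nroots_exp ?polyXsubC_eq0//.
rewrite nrootsXsubC asboolT// muln1.
rewrite (_ : nroots s _ = 0)%N ?add0n//.
apply/eqP; rewrite -leqn0 leqNgt; apply/negP.
by move=> /(nroots_gt0 _ s0)[x ->]; rewrite rootE; exact/negP.
Qed.

(** Pigeonhole: of [size s + 1] points at spacing [h = t / (size s + 1)] on a segment issuing from
    [z0], no two lie within [h / 2] of the same member of [s]. *)
Lemma exists_avoiding (s : seq C) z0 (t : R) : 0 < t ->
  exists2 z, cabs (z - z0) <= t &
    forall x, x \in s -> t / (2 * (size s).+1%:R) <= cabs (z - x).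
Proof.
move=> t0; pose n := size s; pose h := t / n.+1%:R.
have n0 : 0 < n.+1%:R :> R by rewrite ltr0n.
have h0 : 0 < h by rewrite divr_gt0.
have hh : t / (2 * n.+1%:R) = h / 2 by rewrite /h invfM; ring.
rewrite hh.
pose Z (i : 'I_n.+1) : C := z0 + (h * i%:R)%:C%C.
apply: contrapT => H.
have {H} : forall i, exists j : 'I_n, cabs (Z i - nth 0 s j) < h / 2.
  move=> i; apply: contrapT => Hi; apply: H; exists (Z i).
    rewrite /Z addrAC subrr add0r cabs_real ger0_norm; last by rewrite mulr_ge0// ltW.
    rewrite /h mulrAC -mulrA ler_piMr ?(ltW t0)// ler_pdivrMr// mul1r ler_nat.
    exact: ltnW.
  move=> x xs; rewrite leNgt; apply/negP => xh; apply: Hi.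
  have xi : (index x s < n)%N by rewrite index_mem.
  by exists (Ordinal xi); rewrite /= nth_index.
move=> /choice[F FP].
have Finj : injective F.
  move=> i j Fij; apply/eqP; case: (i =P j) => // /eqP ij; exfalso.
  have := FP i; have := FP j; rewrite Fij => h1 h2.
  have h3 : cabs (Z i - Z j) < h.
    set a := nth 0 s (F j) in h1 h2.
    by have := cabs_triangle a (Z i) (Z j); rewrite (cabs_sub a (Z j)); lra.
  move: h3; rewrite /Z opprD addrACA subrr add0r -rmorphB cabs_real -mulrBr normrM.
  rewrite (gtr0_norm h0) gtr_pMr// ltNge => /negP; apply.
  wlog ltij : i j ij {Fij h1 h2} / (i < j)%N.
    move=> W; have := ij; rewrite -val_eqE neq_ltn => /orP[] ij'; first exact: W ij'.
    by rewrite distrC; apply: W ij'; rewrite eq_sym.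
  rewrite distrC -natrB ?(ltnW ltij)// normr_nat ler1n; lia.
by have := leq_card F Finj; rewrite !card_ord ltnn.
Qed.

(* Away from [z0] the cofactor of the roots near [z0] is bounded below, so fewer than [k] roots would make [g - w] larger
   than order [k] at distance [t] from [z0]. *)
Lemma nroots_ball_lower g w0 z0 (e : R) : (1 < size g)%N -> 0 < e ->
  exists2 d : R, 0 < d & forall w, cabs (w - w0) < d ->
   (nroots (g - w0%:P) [set z0] <= nroots (g - w%:P) (cdisk z0 e))%N.
Proof.
move=> g1 e0; set P0 := g - w0%:P.
have P00 : P0 != 0 by exact: subC_neq0.
have [q qz P0E] := nroots_factor z0 P00.
have [k kE] : exists k, k = nroots P0 [set z0] by eexists.
rewrite -kE in P0E *.
have [n nE] : exists n, n = (size g).-1 by eexists.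
have e20 : 0 < e / 2 by lra.
have e21 : 1 <= 1 + 2 * e by lra.
have [z1 z1e z1P] : exists2 z1, cabs (z1 - z0) <= e / 2 & P0.[z1] != 0.
  have [z1 z1e z1s] := exists_avoiding (rts P0) z0 e20; exists z1 => //.
  apply/negP => /eqP P0z1; have /z1s : z1 \in rts P0 by rewrite mem_rts// rootE P0z1.
  by rewrite subrr cabs0 leNgt divr_gt0// mulr_gt0.
have [c1 c1E] : exists c1 : R, c1 = cabs P0.[z1] by eexists.
have c10 : 0 < c1 by rewrite c1E cabs_gt0.
have [K KE] : exists K : R, K = (1 + 2 * e) ^+ n by eexists.
have K1 : 1 <= K by rewrite KE; apply: exprn_ege1.
have h3 : 1 <= 3 :> R by lra.
have [L LE] : exists L : R, L = 3 ^+ n by eexists.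
have L1 : 1 <= L by rewrite LE; apply: exprn_ege1.
(* [K] bounds the product of the near factors at [z1], and [L] is the constant of [poly_harnack] for
   passing from points close to [z0] to [z1]; so [c2] bounds the cofactor of the near roots from
   below close to [z0]. *)
have [c2 c2E] : exists c2 : R, c2 = c1 / (2 * K * L) by eexists.
have c20 : 0 < c2 by rewrite c2E divr_gt0// !mulr_gt0//; lra.
have [u uE] : exists u : R, u = (2 * n.+1%:R)^-1 by eexists.
have n0 : 1 <= n.+1%:R :> R by rewrite ler1n.
have u0 : 0 < u by rewrite uE invr_gt0 mulr_gt0//; lra.
have u1 : u <= 1 by rewrite uE invf_le1; lra.
have [d1 d10 qd1] := poly_cont q z0 ltr01.
have [M ME] : exists M : R, M = cabs q.[z0] + 1 by eexists.
have M0 : 0 < M by rewrite ME; have := cabs_ge0 q.[z0]; lra.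
have [k0|kpos] := posnP k; first by exists 1 => // w _; rewrite k0.
have [c3 c3E] : exists c3 : R, c3 = c2 * u ^+ k.-1 by eexists.
have c30 : 0 < c3 by rewrite c3E mulr_gt0// exprn_gt0.
(* At a point within [t] of [z0] and away from the near roots, [|g - w|] would be at least
   [c3 t^(k-1)], yet at most [|w - w0| + M t^k]; the choice of [t] and of the bound on [w] makes
   each of these two terms at most a quarter of the former. *)
have [t tE] : exists t : R, t = 
  Num.min (Num.min 1 (e / 4)) (Num.min (d1 / 2) (c3 / (4 * M))) by eexists.
have t0 : 0 < t.
  rewrite tE !lt_min ltr01/=; apply/and3P; split; [lra|lra|].
  by rewrite divr_gt0// mulr_gt0.
have t1 : t <= 1 by rewrite tE !ge_min lexx.
have te : t <= e / 4 by rewrite tE !ge_min lexx ?orbT.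
have td : t <= d1 / 2 by rewrite tE !ge_min lexx ?orbT.
have tc : t <= c3 / (4 * M) by rewrite tE !ge_min lexx ?orbT.
have tk0 : 0 < t ^+ k.-1 by rewrite exprn_gt0.
exists (Num.min (c1 / 2) (c3 * t ^+ k.-1 / 4)).
  by rewrite lt_min !divr_gt0// mulr_gt0.
move=> w; rewrite lt_min => /andP[w1 w2]; rewrite leqNgt; apply/negP => jk.
set Pw := g - w%:P in jk.
have Pw0 : Pw != 0 by exact: subC_neq0.
have PwE : forall z, Pw.[z] = P0.[z] + (w0 - w).
  by move=> z; rewrite /Pw /P0 !(hornerD, hornerN, hornerC) addrA subrK.
pose near x := cabs (x - z0) < e.
pose A := \prod_(x <- rts Pw | near x) ('X - x%:P).
pose B := lead_coef Pw *: \prod_(x <- rts Pw | ~~ near x) ('X - x%:P).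
have PAB : Pw = A * B.
  by rewrite {1}[Pw]rtsE /A /B -scalerAr (bigID near).
have szPw : size Pw = size g by exact: size_subC.
have B0 : B != 0.
  by apply: contraNneq Pw0 => B0; rewrite PAB B0 mulr0.
have AE z : cabs A.[z] = \prod_(x <- rts Pw | near x) cabs (z - x).
  rewrite /A horner_prod -big_filter cabs_prod big_filter.
  by apply: eq_bigr => x _; rewrite hornerXsubC.
have jE : count near (rts Pw) = nroots Pw (cdisk z0 e).
  apply: eq_count => x; apply/idP/asboolP => //.
have Brt : forall x, root B x -> e <= cabs (x - z0).
  move=> x; rewrite /B rootZ ?lead_coef_eq0// -big_filter root_prod_XsubC.
  by rewrite mem_filter /near -leNgt => /andP[].
have szB : ((size B).-1 <= n)%N.
  have : (size B <= size Pw)%N by apply: dvdp_leq => //; rewrite PAB dvdp_mull.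
  by rewrite nE szPw -!subn1; exact: leq_sub2r.
have A1 : cabs A.[z1] <= K.
  rewrite AE KE.
  have : (count near (rts Pw) <= n)%N.
    by apply: leq_trans (count_size _ _) _; rewrite nE size_rts// szPw.
  rewrite -big_filter -size_filter => szn.
  apply: (@le_trans _ _ ((1 + 2 * e) ^+ size [seq x <- rts Pw | near x])); last first.
    exact: ler_weXn2l szn.
  have : all near [seq x <- rts Pw | near x] by exact: filter_all.
  elim: [seq x <- rts Pw | near x] => [|x s IH] /=; first by rewrite big_nil.
  move=> /andP[xe /IH {}IH]; rewrite big_cons exprS; apply: ler_pM => //.
  - exact: cabs_ge0.
  - by apply: prodr_ge0 => i _; exact: cabs_ge0.
  - move: xe; rewrite /near; have := cabs_triangle z0 z1 x; rewrite (cabs_sub z0 x); lra.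
have Bz1 : c1 / (2 * K) <= cabs B.[z1].
  have : c1 / 2 <= cabs Pw.[z1].
    rewrite PwE; have := cabsB_ge P0.[z1] (- (w0 - w)); rewrite opprK cabsN (cabs_sub w0).
    by rewrite -c1E; lra.
  rewrite PAB hornerM cabsM => h.
  have : c1 / 2 <= K * cabs B.[z1].
    by apply: le_trans h _; rewrite ler_wpM2r// cabs_ge0.
  by move=> h5; rewrite invfM mulrA ler_pdivrMr ?[_ * K]mulrC//; lra.
have Bz : forall z, cabs (z - z0) <= t -> c2 <= cabs B.[z].
  move=> z zt; have prem : forall x, root B x -> e / 2 <= cabs (x - z).
    by move=> x /Brt xe; have := cabs_triangle z x z0; lra.
  have := poly_harnack z1 e20 prem.
  set X := _ ^+ _ => h.
  have XL : X <= L.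
    rewrite /X LE.
    apply: (@le_trans _ _ (3 ^+ (size B).-1)); last by rewrite ler_weXn2l.
    apply: lerXn2r; rewrite ?nnegrE//.
      by have := divr_ge0 (cabs_ge0 (z1 - z)) (ltW e20); lra.
    have : cabs (z1 - z) / (e / 2) <= 2.
      rewrite ler_pdivrMr//; have := cabs_triangle z0 z1 z; rewrite (cabs_sub z0 z); lra.
    lra.
  have : c1 / (2 * K) <= cabs B.[z] * L.
    apply: le_trans Bz1 _; apply: le_trans h _; rewrite ler_wpM2l//; exact: cabs_ge0.
  have L0 : 0 < L by lra.
  have K0 : 0 < K by lra.
  rewrite c2E => h6; rewrite invfM mulrA ler_pdivrMr//.
have [z zt zs] := exists_avoiding [seq x <- rts Pw | near x] z0 t0.
have Az : u ^+ k.-1 * t ^+ k.-1 <= cabs A.[z].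
  rewrite AE -exprMn -big_filter.
  have sz : (size [seq x <- rts Pw | near x] <= k.-1)%N.
    by rewrite size_filter jE -ltnS prednK.
  have sz2 : (size [seq x <- rts Pw | near x] <= n)%N.
    rewrite size_filter; apply: leq_trans (count_size _ _) _.
    by rewrite nE size_rts// szPw.
  have ut0 : 0 < u * t by rewrite mulr_gt0.
  have ut1 : u * t <= 1 by nra.
  apply: (@le_trans _ _ ((u * t) ^+ size [seq x <- rts Pw | near x])).
    by apply: ler_wiXn2l => //; exact: ltW.
  have : all (fun x => u * t <= cabs (z - x)) [seq x <- rts Pw | near x].
    apply/allP => x /zs; apply: le_trans; rewrite mulrC ler_wpM2l ?(ltW t0)//.
    rewrite uE lef_pV2 ?posrE; [|by rewrite mulr_gt0|by rewrite mulr_gt0].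
    by rewrite ler_wpM2l// ler_nat ltnS.
  elim: [seq x <- rts Pw | near x] {sz sz2 zs} => [|x s IH] /=; first by rewrite big_nil.
  move=> /andP[xe /IH {}IH]; rewrite big_cons exprS; apply: ler_pM => //; [exact: ltW|].
  by apply: exprn_ge0; exact: ltW.
have low : c3 * t ^+ k.-1 <= cabs Pw.[z].
  rewrite PAB hornerM cabsM c3E -mulrA mulrC; apply: ler_pM => //.
  - by rewrite mulr_ge0// exprn_ge0// ltW.
  - exact: ltW.
  - exact: Bz.
have up : cabs Pw.[z] <= cabs (w - w0) + M * t ^+ k.
  rewrite PwE; apply: (le_trans (cabsD _ _)); rewrite (cabs_sub w0) addrC lerD2l.
  rewrite P0E hornerM cabsM horner_exp hornerXsubC cabsX.
  apply: ler_pM; rewrite ?cabs_ge0 ?exprn_ge0 ?cabs_ge0//.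
    have := qd1 z ltac:(lra); have := cabsB_ge q.[z] q.[z0]; rewrite ME; lra.
  by apply: lerXn2r; rewrite ?nnegrE ?cabs_ge0 ?(ltW t0).
have : M * t ^+ k <= c3 / 4 * t ^+ k.-1.
  rewrite -{1}(prednK kpos) exprS mulrA ler_wpM2r ?(ltW tk0)//.
  have : t * (4 * M) <= c3 by rewrite -ler_pdivlMr// mulr_gt0.
  lra.
by have : 0 < c3 * t ^+ k.-1 by [rewrite mulr_gt0]; lra.
Qed.

End Counting.

(** * Dependence of preimage counts on the value *)

Section RootsInOpenSets.
Variable R : realType.
Local Notation C := (Cplx R).
Implicit Types (p q g f : {poly C}) (z w : C) (A V : set C).

Lemma isolate_seq (s : seq C) z :
  exists2 e : R, 0 < e & forall x, x \in s -> x != z -> e < cabs (x - z).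
Proof.
elim: s => [|a s [e e0 es]]; first by exists 1.
have [->|az] := eqVneq a z.
  by exists e => // x; rewrite inE => /orP[/eqP ->|]; [rewrite eqxx|exact: es].
have a0 : 0 < cabs (a - z) by rewrite cabs_gt0 subr_eq0.
exists (Num.min e (cabs (a - z) / 2)); first by rewrite lt_min e0 divr_gt0.
move=> x; rewrite inE gt_min => /orP[/eqP -> _|xs xz].
  by apply/orP; right; lra.
by rewrite es.
Qed.

Lemma isolate_root p z : p != 0 ->
  exists2 e : R, 0 < e & forall x, root p x -> cabs (x - z) <= e -> x = z.
Proof.
move=> p0; have [e e0 es] := isolate_seq (rts p) z; exists e => // x px xe.
by apply/eqP; apply: contraLR xe => xz; rewrite -ltNge es// mem_rts.
Qed.

Lemma open_far (z : C) (e : R) : open [set x | e < cabs (x - z)].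
Proof.
apply/openC_P => x /= xe; exists (cabs (x - z) - e); first lra.
by move=> y yx /=; have := cabs_triangle y x z; rewrite (cabs_sub x y); lra.
Qed.

Lemma open_poly_preimage f (U : set C) : open U -> open [set x | U f.[x]].
Proof.
move=> /openC_P oU; apply/openC_P => x /= Ux; have [e e0 eU] := oU _ Ux.
have [d d0 df] := poly_cont f x e0; exists d => // y /df; exact: eU.
Qed.

(** Induction on the count: one root [r] is split off by a disk without other roots, where
    [nroots_ball_lower] applies; the part of [V] outside the closed disk is still open. *)
Lemma nroots_open_lower g w0 V : (1 < size g)%N -> open V ->
  exists2 d : R, 0 < d & forall w, cabs (w - w0) < d ->
   (nroots (g - w0%:P) V <= nroots (g - w%:P) V)%N.
Proof.
move=> g1; have P0 := subC_neq0 w0 g1.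
move: {2}(nroots _ _) (leqnn (nroots (g - w0%:P) V)) => n.
elim: n V => [|n IH] V nV oV.
  by exists 1 => // w _; move: nV; rewrite leqn0 => /eqP ->.
have [v0|] := posnP (nroots (g - w0%:P) V); first by exists 1 => // w _; rewrite v0.
move=> /(nroots_gt0 _ P0)[r Vr Pr].
have [e1 e10 iso] := isolate_root r P0.
have /openC_P/(_ r Vr)[e2 e20 e2V] := oV.
pose e := Num.min e1 e2.
have e0 : 0 < e by rewrite lt_min e10.
pose V' := V `&` [set x | e < cabs (x - r)].
have oV' : open V' by apply: openI => //; exact: open_far.
have dis A : A `<=` [set x | cabs (x - r) <= e] -> A `&` V' = set0.
  by move=> Ae; apply/seteqP; split=> // x [/Ae /= h [_ /=]]; rewrite ltNge h.
have VE : nroots (g - w0%:P) V = (nroots (g - w0%:P) [set r] + nroots (g - w0%:P) V')%N.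
  rewrite -nrootsU; last by apply: dis => x ->; rewrite /= subrr cabs0 ltW.
  apply: nroots_eq => x Px; split=> [Vx|[->//|[]//]].
  have [->|xr] := eqVneq x r; [by left|right; split=> //=].
  rewrite ltNge; apply: contraNN xr => xe; apply/eqP; apply: iso => //.
  by apply: le_trans xe _; rewrite ge_min lexx.
have [|d1 d10 h1] := IH V' _ oV'.
  have : (0 < nroots (g - w0%:P) [set r])%N by apply/(nroots_gt0 _ P0); exists r.
  lia.
have [d2 d20 h2] := nroots_ball_lower w0 r g1 e0.
exists (Num.min d1 d2); first by rewrite lt_min d10.
move=> w; rewrite lt_min => /andP[/h1 {}h1 /h2 {}h2].
rewrite VE; apply: leq_trans (leq_add h2 h1) _; apply: nroots_disj.
- by apply: dis => x /ltW.
- by move=> x xe; apply: e2V; apply: lt_le_trans xe _; rewrite ge_min lexx orbT.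
- by move=> x [].
Qed.

(** The total count is the degree, so a lower bound outside the closed disk is an upper bound
    inside. *)
Lemma nroots_ball_upper g w0 z0 (e : R) : (1 < size g)%N ->
  (forall x, g.[x] = w0 -> cabs (x - z0) <= e -> x = z0) -> 0 < e ->
  exists2 d : R, 0 < d & forall w, cabs (w - w0) < d ->
   (nroots (g - w%:P) (cdisk z0 e) <= nroots (g - w0%:P) [set z0])%N.
Proof.
move=> g1 iso e0; have [d d0 dV] := nroots_open_lower w0 g1 (@open_far z0 e).
exists d => // w /dV {}dV.
have P0 := subC_neq0 w0 g1; have Pw := subC_neq0 w g1.
have E1 := nroots_compl [set x | e < cabs (x - z0)] P0.
have E2 := nroots_compl [set x | e < cabs (x - z0)] Pw.
rewrite !size_subC// in E1 E2.
have E3 : nroots (g - w0%:P) (~` [set x | e < cabs (x - z0)]) = nroots (g - w0%:P) [set z0].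
  apply: nroots_eq => x; rewrite rootBC => /eqP gx; split=> /= [/negP|->].
    by rewrite -leNgt; exact: iso.
  by apply/negP; rewrite -leNgt subrr cabs0 ltW.
have E4 : (nroots (g - w%:P) (cdisk z0 e) <=
   nroots (g - w%:P) (~` [set x | (e < cabs (x - z0))%R]))%N.
  by apply: nroots_sub => x; rewrite /cdisk /= => xe; apply/negP; rewrite -leNgt ltW.
apply: (leq_trans E4); rewrite -E3.
by rewrite -(leq_add2l (nroots (g - w%:P) [set x | (e < cabs (x - z0))%R])) E2 -E1 leq_add2r.
Qed.

(** The hypotheses on [V] make [f : V -> U] proper. The counts in [V] and in the rest of the
    preimage of [U] are both lower semicontinuous and add up to the degree, so both are locally
    constant. *)
Lemma nroots_const f (U V : set C) : (1 < size f)%N -> open U -> connected U ->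
  open V -> (forall x, V x -> U f.[x]) ->
  (forall x, closure V x -> U f.[x] -> V x) ->
  forall y y', U y -> U y' -> nroots (f - y%:P) V = nroots (f - y'%:P) V.
Proof.
move=> f1 oU cU oV VU clV.
pose V' := [set x | U f.[x]] `&` ~` (closure V).
have oV' : open V'.
  by apply: openI; [exact: open_poly_preimage|exact/closed_openC/closed_closure].
have tot : forall y, U y -> (nroots (f - y%:P) V + nroots (f - y%:P) V' = (size f).-1)%N.
  move=> y Uy; have := nroots_compl V (subC_neq0 y f1); rewrite size_subC// => <-.
  congr addn; apply: nroots_eq => x; rewrite rootBC => /eqP fx; split.
    by move=> [_ h] Vx; apply: h; exact: subset_closure.
  by move=> nV; split=> /=; [rewrite fx|move=> cV; apply: nV; apply: clV => //; rewrite fx].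
move=> y y' Uy Uy'.
apply/esym/(connected_locally_constant (A := U)
  (P := fun t => nroots (f - t%:P) V = nroots (f - y%:P) V)) => //; last exact: Uy.
  move=> t Ut; have [d1 d10 h1] := nroots_open_lower t f1 oV.
  have [d2 d20 h2] := nroots_open_lower t f1 oV'.
  exists (Num.min d1 d2); first by rewrite lt_min d10.
  move=> u Uu; rewrite lt_min => /andP[/h1 {}h1 /h2 {}h2].
  have := tot t Ut; have := tot u Uu; lia.
Qed.

(** [g] is proper from the component to [D], so its degree there is constant, and it is positive
    because of [z]. *)
Lemma component_surj g (A D : set C) z w : (1 < size g)%N -> open A -> open D ->
  connected D -> (forall x, A x -> D g.[x]) ->
  (forall x, closure A x -> D g.[x] -> A x) -> A z -> D w ->
  exists2 x, connected_component A z x & g.[x] = w.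
Proof.
move=> g1 oA oD cD AD clA Az Dw.
have E : nroots (g - g.[z]%:P) (connected_component A z) =
         nroots (g - w%:P) (connected_component A z).
  apply: (nroots_const (U := D)) => //; last exact: AD.
  - exact: open_connected_component.
  - by move=> x /connected_component_sub /AD.
  - move=> x clx Dx; apply: connected_component_clopen => //.
    by apply: clA => //; apply: closureS clx; exact: connected_component_sub.
have : (0 < nroots (g - w%:P) (connected_component A z))%N.
  rewrite -E; apply/(nroots_gt0 _ (subC_neq0 _ g1)); exists z.
    exact: connected_component_refl.
  by rewrite rootBC.
move=> /(nroots_gt0 _ (subC_neq0 _ g1))[x xA]; rewrite rootBC => /eqP gx.
by exists x.
Qed.

End RootsInOpenSets.

(** * Components of sublevel sets of polynomials *)

Section Lemniscates.
Variable R : realType.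
Local Notation C := (Cplx R).
Variable g : {poly C}.
Hypothesis g1 : (1 < size g)%N.
Implicit Types (z w : C) (A V : set C) (r : R).

(** Empty when [|g(z)| >= r], so that any member also certifies [|g(z)| < r]; see [lemn_base]. *)
Definition lemn r z : set C := connected_component [set x | cabs g.[x] < r] z.

Lemma open_sublevel r : open [set x | cabs g.[x] < r].
Proof.
have := @open_poly_preimage R g (cdisk 0 r) (@open_cdisk _ _ _).
by congr open; apply/seteqP; split=> x; rewrite /cdisk /= subr0.
Qed.

Lemma lemn_open r z : open (lemn r z).
Proof. by apply: open_connected_component; exact: open_sublevel. Qed.

Lemma lemn_lt r z x : lemn r z x -> cabs g.[x] < r.
Proof. by move=> /connected_component_sub. Qed.

Lemma lemn_refl r z : cabs g.[z] < r -> lemn r z z.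
Proof. by move=> zr; apply: connected_component_refl. Qed.

Lemma lemn_sym r z x : lemn r z x -> lemn r x z.
Proof. exact: connected_component_sym. Qed.

Lemma lemn_trans r x z y : lemn r z x -> lemn r x y -> lemn r z y.
Proof. exact: connected_component_trans. Qed.

Lemma lemn_base r z x : lemn r z x -> cabs g.[z] < r.
Proof. by move=> /lemn_sym /lemn_lt. Qed.

Lemma lemn_mono r r' z : r <= r' -> lemn r z `<=` lemn r' z.
Proof.
move=> rr x xr; apply: (@connected_component_max _ _ (lemn r z)) => //.
- exact: lemn_refl (lemn_base xr).
- by move=> y /lemn_lt /= yr; lra.
- exact: component_connected.
Qed.

Lemma lemn_closure r z x : closure (lemn r z) x -> cabs g.[x] < r -> lemn r z x.
Proof. by move=> cx xr; apply: connected_component_clopen => //; exact: open_sublevel. Qed.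

Lemma closure_sublevel r x : closure [set y | cabs g.[y] < r] x -> cabs g.[x] <= r.
Proof.
move=> /closureC_P cx; rewrite leNgt; apply/negP => rx.
have [d d0 dg] := poly_cont g x (ltac:(lra) : 0 < cabs g.[x] - r).
have [y /= yr yx] := cx d d0.
by have := dg y yx; have := cabsB_ge g.[x] g.[y]; rewrite (cabs_sub g.[x]); lra.
Qed.

Lemma lemn_closure_le r z x : closure (lemn r z) x -> cabs g.[x] <= r.
Proof.
move=> cx; apply: closure_sublevel; apply: closureS cx.
exact: connected_component_sub.
Qed.

Lemma lemn_near r z x : lemn r z x -> exists2 e : R, 0 < e & cdisk x e `<=` lemn r z.
Proof.
by move=> zx; have /openC_P/(_ x zx)[e e0 eL] := @lemn_open r z; exists e.
Qed.

Lemma sublevel_near r x : cabs g.[x] < r ->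
  exists2 e : R, 0 < e & forall y, cabs (y - x) < e -> lemn r x y.
Proof. by move=> xr; have [e e0 eL] := lemn_near (lemn_refl xr); exists e. Qed.

(** [g] is proper from the component to the disk of radius [r]; the common count is its degree. *)
Lemma lemn_nroots r z w : cabs w < r ->
  nroots (g - w%:P) (lemn r z) = nroots g (lemn r z).
Proof.
move=> wr; transitivity (nroots (g - 0%:P) (lemn r z)); last by rewrite subr0.
have r0 : 0 < r by apply: le_lt_trans wr; exact: cabs_ge0.
apply: (nroots_const (U := cdisk 0 r)) => //.
- exact: open_cdisk.
- by apply: convex_connected => x y t xr yr tt; rewrite /cdisk /=; apply: cdisk_convex.
- exact: lemn_open.
- by move=> x /lemn_lt; rewrite /cdisk /= subr0.
- by move=> x cx; rewrite /cdisk /= subr0; exact: lemn_closure.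
- by rewrite /cdisk /= subr0.
- by have : cabs (0 - 0 : C) < r by rewrite subrr cabs0.
Qed.

Lemma lemn_same r z x : lemn r z x -> lemn r z = lemn r x.
Proof. exact: same_connected_component. Qed.

(** Left continuity in the level: being reached at some lower level is locally constant on
    [lemn r z]. *)
Lemma lemn_inc r z x : lemn r z x -> exists2 r', r' < r & lemn r' z x.
Proof.
move=> zx.
apply: (connected_locally_constant (A := lemn r z)
  (P := fun x => exists2 r', r' < r & lemn r' z x) _ _ (x := z)) => //.
- exact: component_connected.
- move=> y /lemn_lt yr.
  have yr1 : cabs g.[y] < (cabs g.[y] + r) / 2 by lra.
  have [e e0 ey] := sublevel_near yr1; exists e => // u _ /ey uy.
  have max_lt r' : r' < r -> Num.max r' ((cabs g.[y] + r) / 2) < r.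
    by move=> r'r; rewrite gt_max r'r; lra.
  have uy' r' : lemn (Num.max r' ((cabs g.[y] + r) / 2)) y u.
    by apply: lemn_mono uy; rewrite le_max lexx orbT.
  have up r' v : lemn r' z v -> lemn (Num.max r' ((cabs g.[y] + r) / 2)) z v.
    by apply: lemn_mono; rewrite le_max lexx.
  split=> -[r' r'r zv]; exists (Num.max r' ((cabs g.[y] + r) / 2)); try exact: max_lt.
    exact: lemn_trans (up _ _ zv) (uy' _).
  exact: lemn_trans (up _ _ zv) (lemn_sym (uy' _)).
- exact: lemn_refl (lemn_base zx).
- have zr := lemn_base zx.
  by exists ((cabs g.[z] + r) / 2); [lra|apply: lemn_refl; lra].
Qed.

Lemma lemn_inc_seq r z (s : seq C) : cabs g.[z] < r ->
  exists r', [/\ r' < r, cabs g.[z] < r' & forall x, x \in s -> lemn r z x -> lemn r' z x].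
Proof.
move=> zr; elim: s => [|a s [r1 [r1r zr1 h1]]].
  by exists ((cabs g.[z] + r) / 2); split=> //; lra.
have [za|nza] := pselect (lemn r z a); last first.
  exists r1; split=> // x; rewrite inE => /orP[/eqP ->|]; [by []|exact: h1].
have [r2 r2r h2] := lemn_inc za.
exists (Num.max r1 r2); split; first by rewrite gt_max r1r.
  by rewrite lt_max zr1.
move=> x; rewrite inE => /orP[/eqP -> _|xs /(h1 _ xs)].
  by apply: lemn_mono h2; rewrite le_max lexx orbT.
by apply: lemn_mono; rewrite le_max lexx.
Qed.

Lemma pos_filter : Filter (fun A : set R => exists2 d : R, 0 < d &
  forall t, 0 < t -> t <= d -> A t).
Proof.
split=> [|A B [d d0 dA] [e e0 eB]|A B AB [d d0 dA]].
- by exists 1.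
- exists (Num.min d e); first by rewrite lt_min d0.
  by move=> t t0; rewrite le_min => /andP[h1 h2]; split; [exact: dA|exact: eB].
- by exists d => // t t0 td; apply: AB; exact: dA.
Qed.

(** Turns local positive constants on a compact set into a single one, for conditions that weaken as
    the constant decreases. *)
Lemma compact_pos_lower (K : set C) (P : R -> C -> Prop) : compact K ->
  (forall t t' x, P t x -> t' <= t -> P t' x) ->
  (forall y, K y -> exists2 d : R, 0 < d & forall z, cabs (z - y) < d -> P d z) ->
  exists2 d : R, 0 < d & forall z, K z -> P d z.
Proof.
move=> cK mP H; have [|d d0 dK] := compact_tube pos_filter (P := P) cK.
  move=> y /H[d d0 dP]; exists d => //; exists d => // t t0 td z zy.
  by apply: mP td; exact: dP.
by exists d => //; exact: dK.
Qed.

Lemma poly_lower_compact (K : set C) (h : {poly C}) : compact K ->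
  (forall x, K x -> h.[x] != 0) ->
  exists2 d : R, 0 < d & forall x, K x -> d <= cabs h.[x].
Proof.
move=> cK hK; apply: (@compact_pos_lower K (fun t x => t <= cabs h.[x])) => //.
  by move=> t t' x /[swap]; exact: le_trans.
move=> y /hK hy; have c0 : 0 < cabs h.[y] / 2 by rewrite divr_gt0// cabs_gt0.
have [d d0 dh] := poly_cont h y c0.
exists (Num.min d (cabs h.[y] / 2)); first by rewrite lt_min d0.
move=> z; rewrite lt_min => /andP[/dh zd _]; rewrite ge_min; apply/orP; right.
by have := cabsB_ge h.[y] h.[z]; rewrite (cabs_sub h.[y]); lra.
Qed.

(** [Q] is a compact and relatively open piece of [{|g| <= r}]. The boundary of a small
    neighbourhood of [Q] is compact and avoids that set, so [|g| >= r + e] on it, and the component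
    at level [r + e] cannot cross it. *)
Lemma lemn_isolated r (Q : set C) z : compact Q -> (forall x, Q x -> cabs g.[x] <= r) ->
  (forall x, Q x -> exists2 e : R, 0 < e &
     forall y, cabs (y - x) < e -> cabs g.[y] <= r -> Q y) -> Q z ->
  exists2 r', r < r' & forall x, lemn r' z x -> cabs g.[x] <= r -> Q x.
Proof.
move=> cQ Qr Qop Qz.
have [d d0 dQ] : exists2 d : R, 0 < d & forall x, Q x ->
    forall y, cabs (y - x) < d -> cabs g.[y] <= r -> Q y.
  apply: (@compact_pos_lower Q
    (fun d x => forall y, cabs (y - x) < d -> cabs g.[y] <= r -> Q y)) => //.
    by move=> t t' x H t't y yx; apply: H; lra.
  move=> y Qy; have [e e0 eQ] := Qop y Qy; exists (e / 2); first lra.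
  by move=> x xy u ux; apply: eQ; have := cabs_triangle x u y; lra.
have [B gB] := poly_unbounded r g1.
pose O : set C := [set y | exists2 x, Q x & cabs (y - x) < d / 2].
have oO : open O.
  apply/openC_P => y /= [x Qx yx]; exists (d / 2 - cabs (y - x)); first lra.
  by move=> u uy; exists x => //; have := cabs_triangle y u x; lra.
pose K := closure O `&` ~` O.
have KE : forall y, K y -> r < cabs g.[y].
  move=> y [/closureC_P clO nO]; rewrite ltNge; apply/negP => yr.
  have [u /= [x Qx ux] uy] := clO (d / 2) ltac:(lra).
  have Qy : Q y.
    by apply: (dQ x Qx) => //; have := cabs_triangle u y x; rewrite (cabs_sub y u); lra.
  by apply: nO; exists y; rewrite ?subrr ?cabs0//; lra.
have cK : compact K.
  apply: (@bounded_closed_compactC _ _ (B + d)).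
    by apply: closedI; [exact: closed_closure|exact: open_closedC].
  move=> y [/closureC_P clO _]; have [u /= [x Qx ux] uy] := clO (d / 2) ltac:(lra).
  have xB := gB x (Qr x Qx).
  have := cabs_triangle u y x; have := cabsB_ge y x; rewrite (cabs_sub y u); lra.
have [e e0 eK] : exists2 e : R, 0 < e & forall y, K y -> r + e <= cabs g.[y].
  apply: (@compact_pos_lower K (fun e y => r + e <= cabs g.[y])) => //.
    by move=> t t' x ? ?; lra.
  move=> y /KE yr; have c0 : 0 < (cabs g.[y] - r) / 2 by lra.
  have [d1 d10 dg] := poly_cont g y c0.
  exists (Num.min d1 ((cabs g.[y] - r) / 2)); first by rewrite lt_min d10.
  move=> u; rewrite lt_min => /andP[/dg h _].
  have : Num.min d1 ((cabs g.[y] - r) / 2) <= (cabs g.[y] - r) / 2 by rewrite ge_min lexx orbT.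
  by have := cabsB_ge g.[y] g.[u]; rewrite (cabs_sub g.[y]); lra.
exists (r + e); first lra.
move=> x zx xr.
have [u Qu xu] : O x.
  apply: (connected_sub_open (A := lemn (r + e) z) (@component_connected _ _ _) oO _ _ zx).
    exists z; split; first exact: lemn_refl (lemn_base zx).
    by exists z; rewrite ?subrr ?cabs0//; lra.
  move=> y /lemn_lt yr clO; apply: contrapT => nO.
  by have := eK y (conj clO nO); lra.
by apply: (dQ u Qu) => //; lra.
Qed.

Lemma convex_lens (w0 : C) (r e : R) : connected [set w | cabs w < r /\ cabs (w - w0) < e].
Proof.
apply: convex_connected => x y t /= [xr xe] [yr ye] tt; split; last exact: cdisk_convex.
by have := @cdisk_convex _ 0 x y r t; rewrite !subr0; apply.
Qed.

(** The lens [{|w| < r, |w - w0| < eta}] is convex, and [g] is proper over it on the disk around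
    [z0], whose bounding circle is mapped outside the lens; so the component of [x] in the preimage
    covers the lens. As the lens lies in [{|w| < r}], this component stays in [lemn r x]. *)
Lemma lens_surj (w0 z0 : C) (r e eta : R) x w :
  (forall y, cabs (y - z0) = e -> eta <= cabs (g.[y] - w0)) ->
  cabs (x - z0) < e -> cabs g.[x] < r -> cabs (g.[x] - w0) < eta ->
  cabs w < r -> cabs (w - w0) < eta ->
  exists y, [/\ cabs (y - z0) < e, g.[y] = w & lemn r x y].
Proof.
move=> circ xe xr xw wr ww.
pose D : set C := [set w | cabs w < r /\ cabs (w - w0) < eta].
pose A : set C := cdisk z0 e `&` [set y | D g.[y]].
have oD : open D.
  have -> : D = cdisk 0 r `&` cdisk w0 eta.
    by apply/seteqP; split=> u; rewrite /D /cdisk /= subr0.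
  by apply: openI; exact: open_cdisk.
have oA : open A by apply: openI; [exact: open_cdisk|exact: open_poly_preimage].
have [||||y xy gy] := @component_surj R g A D x w g1 oA oD (@convex_lens _ _ _).
- by move=> y [].
- move=> y /closureC_P cly Dy; split=> //; rewrite /cdisk /=.
  have : cabs (y - z0) <= e.
    rewrite leNgt; apply/negP => ye.
    have [u [ue _] uy] := cly (cabs (y - z0) - e) ltac:(lra).
    by move: ue; rewrite /cdisk /=; have := cabs_triangle u y z0; rewrite (cabs_sub y u); lra.
  rewrite le_eqVlt => /orP[/eqP ye|//].
  by have := circ y ye; case: Dy; lra.
- by [].
- by [].
exists y; split=> //; first by have := connected_component_sub xy; case.
apply: (@connected_component_max _ _ (connected_component A x)) => //.
- exact: connected_component_refl.
- by move=> u /connected_component_sub[_ []].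
- exact: component_connected.
Qed.

Lemma circle_lower (w0 z0 : C) (e1 e2 : R) : 0 < e1 ->
  (forall x, g.[x] = w0 -> cabs (x - z0) <= e2 -> x = z0) ->
  exists2 eta : R, 0 < eta & forall x, e1 <= cabs (x - z0) <= e2 -> eta <= cabs (g.[x] - w0).
Proof.
move=> e10 iso.
pose K : set C := [set x | e1 <= cabs (x - z0) <= e2].
have cK : compact K.
  apply: (@bounded_closed_compactC _ _ (cabs z0 + e2)).
    have -> : K = ~` (cdisk z0 e1) `&` ~` [set x | e2 < cabs (x - z0)].
      apply/seteqP; split=> x; rewrite /K /cdisk /=.
        by move=> /andP[h1 h2]; split; apply/negP; rewrite -leNgt.
      by move=> [/negP h1 /negP h2]; rewrite !leNgt h1 h2.
    by apply: closedI; apply: open_closedC; [exact: open_cdisk|exact: open_far].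
  by move=> x /= /andP[_ h]; have := cabsB_ge x z0; lra.
have [x Kx|d d0 dK] := @poly_lower_compact K (g - w0%:P) cK.
  rewrite -rootE rootBC; apply/negP => /eqP gx; move: Kx => /= /andP[h1 h2].
  by move: h1; rewrite (iso x gx h2) subrr cabs0; lra.
by exists d => // x /dK; rewrite !hornerE.
Qed.

Lemma lemn_adjacent r z0 : 0 < r -> cabs g.[z0] = r ->
  exists (e : R) (s : seq C), [/\ 0 < e,
    (size s <= nroots (g - g.[z0]%:P) [set z0])%N,
    (forall t, t \in s -> cabs g.[t] < r /\ closure (lemn r t) z0) &
    forall y, cabs (y - z0) < e -> cabs g.[y] < r -> exists2 t, t \in s & lemn r t y].
Proof.
move=> r0 gz0; set w0 := g.[z0] in gz0 *.
have P0 := subC_neq0 w0 g1.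
have [e e0 iso'] := isolate_root z0 P0.
have iso x : g.[x] = w0 -> cabs (x - z0) <= e -> x = z0.
  by move=> gx; apply: iso'; rewrite rootBC gx.
have [eta eta0 circ] := circle_lower e0 iso.
have circ' y : cabs (y - z0) = e -> eta <= cabs (g.[y] - w0).
  by move=> ye; apply: circ; rewrite ye lexx.
have [d d0 up] := nroots_ball_upper g1 iso e0.
pose ws (t : R) : C := (1 - t)%:C%C * w0.
have wsd t : 0 < t -> cabs (ws t - w0) = t * r.
  move=> t0; rewrite /ws rmorphB rmorph1 mulrBl mul1r addrAC subrr add0r cabsN cabsM.
  by rewrite cabs_real gtr0_norm// gz0.
have wsr t : 0 < t < 1 -> cabs (ws t) < r.
  move=> /andP[t0 t1]; rewrite /ws cabsM cabs_real gz0 ger0_norm; last lra.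
  by nra.
pose T := Num.min (1 / 2) (Num.min eta d / (2 * r)).
have T0 : 0 < T.
  by rewrite lt_min !divr_gt0 ?mulr_gt0 ?lt_min ?eta0 ?d0.
have T1 : T < 1 by rewrite gt_min; apply/orP; left; lra.
have Te : T * r < Num.min eta d.
  have : T <= Num.min eta d / (2 * r) by rewrite ge_min lexx orbT.
  rewrite ler_pdivlMr ?mulr_gt0// => h.
  have : 0 < Num.min eta d by rewrite lt_min eta0.
  lra.
have [Teta Td] : T * r < eta /\ T * r < d.
  by move: Te; rewrite lt_min => /andP.
have T01 : 0 < T < 1 by rewrite T0.
have [e1 e10 ge1] := poly_cont g z0 eta0.
pose s := [seq x <- rts (g - (ws T)%:P) | `[< cdisk z0 e x >]].
exists (Num.min e e1), s; split.
- by rewrite lt_min e0.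
- by rewrite size_filter; apply: up; rewrite wsd.
- move=> t; rewrite mem_filter mem_rts ?subC_neq0// rootBC => /andP[/asboolP te /eqP gt].
  have tr : cabs g.[t] < r by rewrite gt wsr.
  (* The same lens at a smaller scale: a preimage, in the component of [t], of a value still closer
     to [g(z0)] must lie within [e2] of [z0]. *)
  split=> //; apply/closureC_P => e2 e20.
  pose e3 := Num.min e2 e.
  have e30 : 0 < e3 by rewrite lt_min e20.
  have [eta3 eta30 circ3] := circle_lower e30 iso.
  pose T3 := Num.min T (eta3 / (2 * r)).
  have T30 : 0 < T3 by rewrite lt_min T0 divr_gt0 ?mulr_gt0.
  have T3T : T3 <= T by rewrite ge_min lexx.
  have T3e : T3 * r < eta3.
    have : T3 <= eta3 / (2 * r) by rewrite ge_min lexx orbT.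
    by rewrite ler_pdivlMr ?mulr_gt0//; lra.
  have [|||y [ye gy ty]] := @lens_surj w0 z0 r e eta t (ws T3) circ' te tr.
  + by rewrite gt wsd.
  + by apply: wsr; rewrite T30 (le_lt_trans T3T).
  + by rewrite wsd// (le_lt_trans _ Teta)// ler_wpM2r// ltW.
  exists y => //; rewrite ltNge; apply/negP => e2y.
  have e3y : e3 <= cabs (y - z0) <= e by rewrite (ltW ye) andbT (le_trans _ e2y)// ge_min lexx.
  by have := circ3 y e3y; rewrite gy wsd// leNgt T3e.
- move=> y; rewrite lt_min => /andP[ye /ge1 ye1] yr.
  have [|x [xe gx yx]] := @lens_surj w0 z0 r e eta y (ws T) circ' ye yr ye1 (wsr _ T01).
    by rewrite wsd.
  exists x; last exact: lemn_sym.
  by rewrite mem_filter mem_rts ?subC_neq0// rootBC gx eqxx andbT; apply/asboolP.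
Qed.

End Lemniscates.

(** * Roots against critical points in a sublevel component *)

Section CriticalCount.
Variable R : realType.
Local Notation C := (Cplx R).
Variable g : {poly C}.
Hypothesis g1 : (1 < size g)%N.
Implicit Types (z w : C) (A X : set C) (r : R).
Local Notation lemn := (lemn g).
Local Notation g' := (g^`()).

Lemma poly_neq0 : g != 0. Proof. by rewrite -size_poly_gt0; lia. Qed.

Lemma deriv_neq0 : g' != 0.
Proof.
apply/eqP => g0; have /polyP/(_ (size g).-2) := g0.
rewrite coef_deriv coef0 => /eqP; rewrite mulrn_eq0 /=.
rewrite (_ : (size g).-2.+1 = (size g).-1); last by lia.
by rewrite -lead_coefE lead_coef_eq0 (negbTE poly_neq0).
Qed.

(** A union of components of [{|g| < r}]: the pieces about to merge are collected at level [r],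
    where their union is not yet connected. *)
Definition saturated r A := forall x, A x -> cabs g.[x] < r /\ lemn r x `<=` A.

Lemma lemn_saturated r z : saturated r (lemn r z).
Proof. by move=> x zx; split; [exact: lemn_lt zx|rewrite (lemn_same zx)]. Qed.

Lemma saturated_closure r A x : saturated r A -> closure A x -> cabs g.[x] < r -> A x.
Proof.
move=> sA /closureC_P cx xr; have [e e0 ex] := sublevel_near xr.
have [y Ay /ex yx] := cx e e0.
by have [_] := sA y Ay; apply; exact: lemn_sym.
Qed.

Lemma saturated_near r A x : saturated r A -> A x ->
  exists2 e : R, 0 < e & forall y, cabs (y - x) < e -> A y.
Proof.
move=> sA Ax; have [xr xA] := sA x Ax; have [e e0 ex] := sublevel_near xr.
by exists e => // y /ex; exact: xA.
Qed.

Lemma saturated_closure_le r A x : saturated r A -> closure A x -> cabs g.[x] <= r.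
Proof.
move=> sA cx; apply: (@closure_sublevel _ g); by apply: closureS cx => y /sA[yr _].
Qed.

Lemma compact_closure_sublevel r A : (forall x, A x -> cabs g.[x] < r) -> compact (closure A).
Proof.
move=> Ar; have [B gB] := poly_unbounded r g1.
apply: (@bounded_closed_compactC _ _ B); first exact: closed_closure.
move=> x cx; apply: gB; apply: (@closure_sublevel _ g).
by apply: closureS cx.
Qed.

Lemma level_near r x (e : R) : 0 < r -> cabs g.[x] <= r -> 0 < e ->
  exists2 y, cabs (y - x) < e & cabs g.[y] < r.
Proof.
move=> r0 xr e0; have [d d0 dx] := poly_open x g1 e0.
pose t := Num.min (1 / 2) (d / (2 * r)).
have t0 : 0 < t by rewrite lt_min !divr_gt0 ?mulr_gt0.
have t1 : t <= 1 / 2 by rewrite ge_min lexx.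
have td : t <= d / (2 * r) by rewrite ge_min lexx orbT.
have {}td : t * r < d by move: td; rewrite ler_pdivlMr ?mulr_gt0//; lra.
have a0 := cabs_ge0 g.[x].
have [|y yx gy] := dx ((1 - t)%:C%C * g.[x]).
  rewrite rmorphB rmorph1 mulrBl mul1r addrAC subrr add0r cabsN cabsM cabs_real gtr0_norm//.
  by apply: le_lt_trans td; rewrite ler_wpM2l// ltW.
exists y => //; rewrite gy cabsM cabs_real ger0_norm; last lra.
by nra.
Qed.

(* When the level passes [r], two components of [{|g| < r}] can only merge at a critical
   point; the hypothesis excludes that [A] merges with its complement. *)
Lemma lemn_grow r A z : 0 < r -> saturated r A ->
  (forall x, closure A x -> root g' x -> cabs g.[x] = r ->
    exists2 e : R, 0 < e & forall y, cabs (y - x) < e -> cabs g.[y] < r -> A y) ->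
  A z -> exists2 r', r < r' & forall x, lemn r' z x -> cabs g.[x] <= r -> closure A x.
Proof.
move=> r0 sA crit Az.
have good x : closure A x -> exists2 e : R, 0 < e &
    forall y, cabs (y - x) < e -> cabs g.[y] < r -> A y.
  move=> cx; have := saturated_closure_le sA cx.
  rewrite le_eqVlt => /orP[/eqP xr|xr]; last first.
    have [e e0 ex] := saturated_near sA (saturated_closure sA cx xr).
    by exists e => // y /ex.
  have [px|npx] := pselect (root g' x); first exact: crit.
  have [e [s [e0 ss _ sP]]] := lemn_adjacent g1 r0 xr.
  have s1 : (size s <= 1)%N.
    apply: leq_trans ss _; rewrite nroots_deriv ?subC_neq0 ?rootBC//.
    rewrite derivB derivC subr0 ltnS leqn0 -[_ == _]negbK -lt0n; apply/negP.
    by move=> /(nroots_gt0 _ deriv_neq0)[y ->].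
  exists e => // y ye yr; have [t ts ty] := sP y ye yr.
  have /closureC_P/(_ e e0)[u Au ue] := cx.
  have [ur uA] := sA u Au.
  have [t' ts' tu] := sP u ue ur.
  have tt' : t = t'.
    by case: s s1 ts ts' {ss sP} => [|a [|b s]]//= _; rewrite !inE => /eqP -> /eqP ->.
  by apply: uA; apply: lemn_trans ty; rewrite tt'; exact: lemn_sym.
apply: (lemn_isolated g1 (Q := closure A)).
- by apply: (@compact_closure_sublevel r) => x /sA[].
- by move=> x cx; exact: saturated_closure_le sA cx.
- move=> x /good[e e0 ex]; exists (e / 2); first lra.
  move=> y yx yr; apply/closureC_P => d d0.
  have m0 : 0 < Num.min d (e / 2) by rewrite lt_min d0; lra.
  have [u uy ur] := level_near r0 yr m0.
  move: uy; rewrite lt_min => /andP[ud ue].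
  exists u => //; apply: ex => //.
  by have := cabs_triangle y u x; lra.
- exact: subset_closure.
Qed.

Let E r := forall z, (nroots g (lemn r z) <= (nroots g' (lemn r z)).+1)%N.

(** By [E r] a new component brings at most one root more than critical points; a component already
    in [A] brings nothing. [X] holds points on or above the level, hence disjoint from all
    components. *)
Lemma saturated_absorb r A X (N : nat) (s : seq C) : E r -> saturated r A ->
  (forall x, X x -> r <= cabs g.[x]) ->
  (forall t, t \in s -> cabs g.[t] < r) ->
  (nroots g A <= N + nroots g' (A `|` X))%N ->
  exists A', [/\ saturated r A', A `<=` A', forall t, t \in s -> A' t,
    forall x, A' x -> A x \/ exists2 t, t \in s & lemn r t x &
    (nroots g A' <= N + nroots g' (A' `|` X) + count (fun t => `[<~ A t>]) s)%N].
Proof.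
move=> Er + Xr; elim: s A N => [|t s IH] A N sA sr nA.
  by exists A; split=> //; rewrite ?addn0//; left.
have [At|nAt] := pselect (A t).
  have [|A' [sA' AA' sA2 A'P nA']] := IH A N sA _ nA.
    by move=> x xs; apply: sr; rewrite inE xs orbT.
  exists A'; split=> //.
  - by move=> x; rewrite inE => /orP[/eqP ->|/sA2//]; exact: AA'.
  - move=> x /A'P[|[u us ux]]; [by left|right]; exists u => //.
    by rewrite inE us orbT.
  - by apply: leq_trans nA' _; rewrite /= leq_add2l leq_addl.
have tr : cabs g.[t] < r by apply: sr; rewrite inE eqxx.
pose B := A `|` lemn r t.
have AB : A `&` lemn r t = set0.
  apply/seteqP; split=> // x [Ax tx]; apply: nAt; have [_] := sA x Ax; apply.
  exact: lemn_sym.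
have sB : saturated r B.
  move=> x [/sA[xr xA]|tx].
    by split=> // y /xA; left.
  have [xr xt] := lemn_saturated tx; split=> // y /xt; by right.
have nB : (nroots g B <= N.+1 + nroots g' (B `|` X))%N.
  rewrite /B nrootsU//.
  have -> : A `|` lemn r t `|` X = (A `|` X) `|` lemn r t.
    by rewrite -!setUA [_ `|` X]setUC.
  rewrite (@nrootsU _ _ (A `|` X)).
    by have := Er t; lia.
  rewrite setIUl AB set0U; apply/seteqP; split=> // x [/Xr + /lemn_lt].
  by rewrite leNgt => /negP.
have [|A' [sA' BA' sA2 A'P nA']] := IH B N.+1 sB _ nB.
  by move=> x xs; apply: sr; rewrite inE xs orbT.
exists A'; split=> //.
- by move=> x Ax; apply: BA'; left.
- move=> x; rewrite inE => /orP[/eqP ->|/sA2//]; apply: BA'; right; exact: lemn_refl.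
- move=> x /A'P[[|tx]|[u us ux]].
  + by left.
  + by right; exists t => //; rewrite inE eqxx.
  + by right; exists u => //; rewrite inE us orbT.
- apply: leq_trans nA' _; rewrite /= asboolT// addSn addnA addn1.
  rewrite -addSn ltnS leq_add2l.
  apply: sub_count => x /asboolP nBx; apply/asboolP => Ax; apply: nBx; by left.
Qed.

(** Invariant: the roots in [A] exceed the critical points in [A] and [X] by at most one. A critical
    point [x] of level [r] in the closure of [A], of multiplicity [k] in [g'], touches at most
    [k + 1] components, one of them already in [A]; absorbing the others adds at most [k], which is
    what putting [x] into [X] adds to the count of [g']. When no such [x] is left, [lemn_grow] shows
    that no root outside [A] is reached slightly above [r]. *)
Lemma critical_count_step r z A (X : seq C) : 0 < r -> E r -> root g z ->
  uniq X -> (forall x, x \in X -> [/\ root g' x, cabs g.[x] = r,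
     (exists2 e : R, 0 < e & forall y, cabs (y - x) < e -> cabs g.[y] < r -> A y) &
     forall r', r < r' -> lemn r' z x]) ->
  saturated r A -> A z -> (forall r' x, r < r' -> A x -> lemn r' z x) ->
  (nroots g A <= 1 + nroots g' (A `|` [set x | x \in X]))%N ->
  exists2 r0, r < r0 & forall r', r < r' <= r0 ->
    (nroots g (lemn r' z) <= (nroots g' (lemn r' z)).+1)%N.
Proof.
move=> r0 Er gz.
have [n] := ubnP (size (rts g') - size X)%N; elim: n => // n IH in A X *.
rewrite ltnS => nX uX XP sA Az Az' nA.
have [[x [cx px xr xX]]|none] := pselect (exists x, [/\ closure A x, root g' x,
    cabs g.[x] = r & x \notin X]); last first.
  have [|r1 rr1 r1P] := lemn_grow r0 sA _ Az.
    move=> x cx px xr; have [xX|xX] := boolP (x \in X); first by have [] := XP x xX.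
    by exfalso; apply: none; exists x.
  exists r1 => // r' /andP[rr' r'r1].
  apply: (@leq_trans (nroots g A)).
    rewrite (@nroots_eq _ g _ (A `&` lemn r' z)).
      by apply: nroots_sub => y [].
    move=> y gy; split=> [zy|[]//]; split=> //.
    have gy0 : cabs g.[y] = 0 by rewrite (eqP gy) cabs0.
    apply: (saturated_closure sA); last by rewrite gy0.
    by apply: r1P; [exact: lemn_mono zy|rewrite gy0 ltW].
  apply: leq_trans nA _; rewrite add1n ltnS; apply: nroots_sub => y [Ay|yX].
    exact: Az'.
  by have [_ _ _] := XP y yX; apply.
have [e [s [e0 ss sr sP]]] := lemn_adjacent g1 r0 xr.
have XP' y : y \in X -> r <= cabs g.[y] by case/XP => _ -> _ _.
have [|A' [sA' AA' sA2 A'P nA']] := saturated_absorb (s := s) Er sA XP' _ nA.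
  by move=> t /sr[].
have zx r' : r < r' -> lemn r' z x.
  move=> rr'; have xr' : cabs g.[x] < r' by rewrite xr.
  have [d d0 dx] := sublevel_near xr'.
  have /closureC_P/(_ d d0)[y Ay /dx xy] := cx.
  by apply: (lemn_trans (Az' r' y rr' Ay)); exact: lemn_sym.
apply: (IH A' (x :: X)).
- have : (size (x :: X) <= size (rts g'))%N.
    apply: uniq_leq_size; first by rewrite /= xX.
    move=> y; rewrite inE mem_rts ?deriv_neq0// => /orP[/eqP ->//|/XP[]//].
  by rewrite /= => h; apply: leq_trans nX; exact: ltn_sub2l.
- by rewrite /= xX.
- move=> y; rewrite inE => /orP[/eqP ->|/XP[py yr [d d0 dy] yz]]; split=> //.
    exists e => // u ue ur; have [t ts tu] := sP u ue ur.
    by have [_] := sA' t (sA2 t ts); apply.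
  by exists d => // u ud ur; apply: AA'; exact: dy.
- by [].
- exact: AA'.
- move=> r' y rr' /A'P[/(Az' _ _ rr')//|[t ts ty]].
  apply: (lemn_trans (zx r' rr')).
  have [tr ct] := sr t ts.
  have xr' : cabs g.[x] < r' by rewrite xr.
  have [d d0 dx] := sublevel_near xr'.
  have /closureC_P/(_ d d0)[u tu /dx xu] := ct.
  apply: (lemn_trans xu); apply: (lemn_trans (lemn_sym (lemn_mono (ltW rr') tu))).
  exact: lemn_mono (ltW rr') _ ty.
- apply: (leq_trans nA'); rewrite -addnA leq_add2l.
  have -> : A' `|` [set y | y \in x :: X] = (A' `|` [set y | y \in X]) `|` [set x].
    rewrite -setUA; congr setU; apply/seteqP; split=> y /=; rewrite inE.
      by move=> /orP[/eqP ->|]; [right|left].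
    by move=> [->|->]; rewrite ?eqxx ?orbT.
  rewrite (@nrootsU _ g' (A' `|` _)) ?leq_add2l; last first.
    apply/seteqP; split=> // y [[A'y|yX] /= yx]; move: xX xr; rewrite -yx.
      by have [+ _] := sA' y A'y => + _ h; rewrite h ltxx.
    by rewrite yX.
  have k : nroots (g - g.[x]%:P) [set x] = (nroots g' [set x]).+1.
    by rewrite nroots_deriv ?subC_neq0 ?rootBC// derivB derivC subr0.
  rewrite k in ss; rewrite -ltnS; apply: leq_trans ss.
  (* One representative belongs to [A] already, namely that of a point of [A] close to [x]; this
     saves the unit between [k + 1] and [k]. *)
  rewrite -(count_predC (fun t => `[<~ A t>]) s) -addn1 leq_add2l -has_count.
  have /closureC_P/(_ e e0)[u Au ue] := cx.
  have [ur uA] := sA u Au; have [t ts tu] := sP u ue ur.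
  apply/hasP; exists t => //=; apply/negP => /asboolP; apply; apply: uA.
  exact: lemn_sym.
Qed.

(* The Riemann-Hurwitz inequality for components of [{|g| < r}], by real induction on [r]. *)
Lemma critical_count r : E r.
Proof.
have E0 r' : r' <= 0 -> E r'.
  move=> r0 z; suff -> : nroots g (lemn r' z) = 0%N by [].
  apply/eqP; rewrite -leqn0 leqNgt; apply/negP => /(nroots_gt0 _ poly_neq0)[x /lemn_lt + _].
  by have := cabs_ge0 g.[x]; lra.
have Eroot r' : (forall z, root g z -> (nroots g (lemn r' z) <= (nroots g' (lemn r' z)).+1)%N) ->
    E r'.
  move=> H z; have [->//|] := posnP (nroots g (lemn r' z)).
  move=> /(nroots_gt0 _ poly_neq0)[x zx gx]; rewrite (lemn_same zx); exact: H.
apply: contrapT => nEr.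
pose S := [set r | ~ E r].
have hS : has_inf S.
  split; first by exists r.
  by exists 0 => r' nE'; rewrite leNgt; apply/negP => r0; apply: nE'; apply: E0; exact: ltW.
pose r0 := inf S.
have Elt r' : r' < r0 -> E r'.
  move=> r'r0; apply: contrapT => nE'; have := ge_inf hS.2 nE'.
  by rewrite -/r0 leNgt r'r0.
have r00 : 0 <= r0.
  apply: lb_le_inf; first exact: hS.1.
  by move=> r' nE'; rewrite leNgt; apply/negP => r'0; apply: nE'; apply: E0; exact: ltW.
have Er0 : E r0.
  apply: Eroot => z gz.
  have [r0E|r0n] := eqVneq r0 0; first by apply: E0; rewrite r0E.
  have zr : cabs g.[z] < r0 by rewrite (eqP gz) cabs0 lt_def r0n.
  (* At the infimum itself only the finitely many roots of [g] and [g'] matter, and those in the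
     component at level [r0] are there at a lower level. *)
  have [r' [r'r0 _ sP]] := lemn_inc_seq (rts g ++ rts g') zr.
  have eqn p : p != 0 -> {subset rts p <= rts g ++ rts g'} ->
      nroots p (lemn r0 z) = nroots p (lemn r' z).
    move=> p0 sub; apply: nroots_eq => x px; split=> [zx|].
      by apply: sP => //; apply: sub; rewrite mem_rts.
    by apply: lemn_mono; exact: ltW.
  rewrite !eqn ?poly_neq0 ?deriv_neq0//.
  - exact: Elt.
  - by move=> x; rewrite mem_cat => ->; rewrite orbT.
  - by move=> x; rewrite mem_cat => ->.
have up z : root g z -> exists2 r1, r0 < r1 & forall r', r0 < r' <= r1 ->
    (nroots g (lemn r' z) <= (nroots g' (lemn r' z)).+1)%N.
  move=> gz; have gz0 : cabs g.[z] = 0 by rewrite (eqP gz) cabs0.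
  have [r0E|r0n] := eqVneq r0 0; last first.
    have r0p : 0 < r0 by rewrite lt_def r0n.
    apply: (@critical_count_step r0 z (lemn r0 z) [::]) => //.
    - exact: lemn_saturated.
    - by apply: lemn_refl; rewrite gz0.
    - by move=> r' x rr'; apply: lemn_mono; exact: ltW.
    - rewrite (_ : [set x | x \in [::]] = set0) ?setU0//.
      by apply/seteqP; split.
  (* Level 0 has no component to start from; just above it the component of [z] contains no other
     root, and [g'] has there one root less in multiplicity. *)
  have [e e0 iso] := isolate_root z poly_neq0.
  have [||||r1 r01 r1P] := @lemn_isolated R g g1 0 [set z] z.
  - exact: compact_set1.
  - by move=> x ->; rewrite gz0.
  - move=> x ->; exists e => // y ye y0; apply: iso; last exact: ltW.
    by rewrite rootE -cabs_eq0 eq_le y0 cabs_ge0.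
  - by [].
  exists r1; first by rewrite r0E.
  move=> r' /andP[rr' r'r1].
  apply: (@leq_trans (nroots g [set z])).
    rewrite (@nroots_eq _ g _ ([set z] `&` lemn r' z)).
      by apply: nroots_sub => y [].
    move=> y gy; split=> [zy|[]//]; split=> //.
    by apply: r1P; [exact: lemn_mono zy|rewrite (eqP gy) cabs0].
  rewrite nroots_deriv ?poly_neq0// ltnS; apply: nroots_sub => y ->.
  by apply: lemn_refl; rewrite gz0 -r0E.
have [r1 r01 r1P] : exists2 r1, r0 < r1 & forall z, z \in rts g -> forall r', r0 < r' <= r1 ->
    (nroots g (lemn r' z) <= (nroots g' (lemn r' z)).+1)%N.
  have : {subset rts g <= rts g} by [].
  elim: {1 3}(rts g) => [|a s IH] sub; first by exists (r0 + 1); [lra|].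
  have [|r1 r01 r1P] := IH; first by move=> x xs; apply: sub; rewrite inE xs orbT.
  have [|r2 r02 r2P] := up a; first by rewrite -mem_rts ?poly_neq0// sub// inE eqxx.
  exists (Num.min r1 r2); first by rewrite lt_min r01.
  move=> z; rewrite inE => /orP[/eqP ->|zs] r'; rewrite le_min => /and3P[h1 h2 h3].
    by apply: r2P; rewrite h1.
  by apply: r1P => //; rewrite h1.
have [r' nE' r'r1] := inf_lt hS.1 r01.
apply: nE'; apply: Eroot => z gz.
have [r'r0|r0r'] := leP r' r0.
  by move: r'r0; rewrite le_eqVlt => /orP[/eqP ->|/Elt]; [exact: Er0|apply].
by apply: r1P; [rewrite mem_rts ?poly_neq0|rewrite r0r' ltW].
Qed.

Lemma lemn_crit_exists r z x y : lemn r z x -> lemn r z y -> root g x -> root g y -> x != y ->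
  exists2 c, lemn r z c & root g' c.
Proof.
move=> zx zy gx gy xy; apply/(nroots_gt0 _ deriv_neq0); rewrite -ltnS.
apply: leq_trans (critical_count r z).
have -> : 2%N = (1 + 1)%N by [].
have pos u : root g u -> (0 < nroots g [set u])%N.
  by move=> gu; apply/(nroots_gt0 _ poly_neq0); exists u.
apply: leq_trans (leq_add (pos x gx) (pos y gy)) _.
apply: nroots_disj; last 2 first.
- by move=> u ->.
- by move=> u ->.
by apply/seteqP; split=> // u [-> /= xyE]; move: xy; rewrite xyE eqxx.
Qed.

(** Without critical points the degree of [g] on the component is at most one. *)
Lemma lemn_nocrit_inj r z x y : (forall c, lemn r z c -> ~ root g' c) ->
  lemn r z x -> lemn r z y -> g.[x] = g.[y] -> x = y.
Proof.
move=> nc zx zy gxy; apply: contrapT => xy.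
have k : (nroots g (lemn r z) <= 1)%N.
  apply: leq_trans (critical_count r z) _; rewrite ltnS leqn0 -[_ == _]negbK -lt0n.
  by apply/negP => /(nroots_gt0 _ deriv_neq0)[c /nc].
have := lemn_nroots g1 z (lemn_lt zx); move=> h4.
have pos u : g.[u] = g.[x] -> (0 < nroots (g - g.[x]%:P) [set u])%N.
  by move=> gu; apply/(nroots_gt0 _ (subC_neq0 _ g1)); exists u => //; rewrite rootBC gu.
have := @nroots_disj _ (g - g.[x]%:P) [set x] [set y] (lemn r z).
have := pos x erefl; have := pos y (esym gxy).
move=> h1 h2 h3.
rewrite -h4 in k.
have : (nroots (g - g.[x]%:P) [set x] + nroots (g - g.[x]%:P) [set y] <=
  nroots (g - g.[x]%:P) (lemn r z))%N.
  apply: h3; last 2 first.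
  - by move=> u ->.
  - by move=> u ->.
  by apply/seteqP; split=> // u [-> /= xyE]; apply: xy.
by move=> h5; have := leq_trans (leq_add h2 h1) (leq_trans h5 k).
Qed.

(** The degree is the same at both levels, so [lemn r' z] already contains a preimage of [g(x)]; by
    injectivity on the larger component this is [x]. *)
Lemma lemn_nocrit_sub r r' z x : (forall c, lemn r z c -> ~ root g' c) -> r' <= r ->
  cabs g.[z] < r' -> lemn r z x -> cabs g.[x] < r' -> lemn r' z x.
Proof.
move=> nc r'r zr' zx xr'.
have [y zy gy] : exists2 y, lemn r' z y & g.[y] = g.[x].
  have : (0 < nroots (g - g.[x]%:P) (lemn r' z))%N.
    rewrite lemn_nroots// -(lemn_nroots g1 z zr'); apply/(nroots_gt0 _ (subC_neq0 _ g1)).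
    by exists z; [exact: lemn_refl|rewrite rootBC].
  by case/(nroots_gt0 _ (subC_neq0 _ g1)) => y zy; rewrite rootBC => /eqP; exists y.
by rewrite (lemn_nocrit_inj nc zx (lemn_mono r'r zy) (esym gy)).
Qed.

(** No critical point is available for a merger between the levels [r'] and [r]. Real induction:
    [t0] is the infimum of the bad levels; left continuity makes [t0] good, and [lemn_grow] makes
    the levels just above it good. *)
Lemma lemn_interval r r' z x : 0 < r' -> (forall c, lemn r z c -> root g' c -> cabs g.[c] < r') ->
  cabs g.[z] < r' -> lemn r z x -> cabs g.[x] < r' -> lemn r' z x.
Proof.
move=> r'0 crit zr' zx xr'.
have [rr'|r'r] := leP r r'; first exact: lemn_mono zx.
apply: contrapT => nx.
pose P t := lemn t z `&` [set u | cabs g.[u] < r'] `<=` lemn r' z.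
pose T := [set t | r' <= t /\ ~ P t].
have Tr : T r by split; [exact: ltW|move=> H; apply: nx; apply: H].
have hT : has_inf T by split; [exists r|exists r' => t []].
pose t0 := inf T.
have r't0 : r' <= t0 by apply: lb_le_inf; [exists r|move=> t []].
have t0r : t0 <= r by apply: ge_inf => //; exact: hT.2.
have Plt t : r' <= t < t0 -> P t.
  move=> /andP[r't tt0]; apply: contrapT => nP; have : t0 <= t by apply: ge_inf => //; exact: hT.2.
  by rewrite leNgt tt0.
have Pt0 : P t0.
  move: r't0; rewrite le_eqVlt => /orP[/eqP <- u []//|r't0] u [zu /= ur'].
  have [t tt0 zt] := lemn_inc zu.
  apply: (Plt (Num.max t r')); first by rewrite le_max lexx orbT gt_max tt0.
  by split=> //; apply: lemn_mono zt; rewrite le_max lexx.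
have t0lt : t0 < r.
  rewrite lt_neqAle t0r andbT; apply/eqP => t0E; apply: nx; apply: Pt0; rewrite t0E; by split.
have zt0 : lemn t0 z z by apply: lemn_refl; exact: lt_le_trans zr' r't0.
have [||t1 t01 t1P] := @lemn_grow t0 (lemn t0 z) z _ (@lemn_saturated _ _) _ zt0.
- exact: lt_le_trans r'0 r't0.
- move=> c cc pc ct0; exfalso.
  have : lemn r z c.
    apply: lemn_closure => //; last by rewrite ct0.
    by apply: closureS cc; exact: lemn_mono (ltW t0lt).
  by move=> /crit -/(_ pc); rewrite ct0 ltNge r't0.
have [t [r't nP] tt1] := inf_lt hT.1 t01.
apply: nP => u [zu /= ur']; apply: Pt0; split=> //=.
have ut0 : cabs g.[u] < t0 by exact: lt_le_trans ur' r't0.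
apply: lemn_closure => //; apply: t1P; last exact: ltW.
by apply: lemn_mono zu; exact: ltW.
Qed.

End CriticalCount.

(** * Minimum modulus, geometric decay, connected images *)

Section MinimumModulus.
Variable R : realType.
Local Notation C := (Cplx R).

Lemma min_modulus (h : C -> C) (A : set C) (m : R) : open A -> compact (closure A) ->
  (forall x, closure A x -> forall e : R, 0 < e -> exists2 d : R, 0 < d &
     forall y, closure A y -> cabs (y - x) < d -> cabs (h y - h x) < e) ->
  (forall x, A x -> forall e : R, 0 < e -> exists2 y, cabs (y - x) < e & cabs (h y) < cabs (h x)) ->
  (forall x, closure A x -> ~ A x -> m <= cabs (h x)) ->
  forall x, closure A x -> m <= cabs (h x).
Proof.
move=> /openC_P oA cA hc hd hm x cx.
have [||y cy ymax] := @compact_max R (closure A) (fun y => - cabs (h y)) cA.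
- by exists x.
- move=> y cy e e0; have [d d0 dh] := hc y cy e e0; exists d => // z cz /(dh z cz).
  have := cabsB_ge (h y) (h z); rewrite (cabs_sub (h y)); lra.
suff my : m <= cabs (h y) by have := ymax x cx; lra.
have [Ay|] := pselect (A y); last exact: hm.
have [e e0 eA] := oA y Ay; have [z zy hz] := hd y Ay e e0.
have := ymax z (subset_closure (eA z zy)); lra.
Qed.

Lemma poly_decrease (q : {poly C}) x (e : R) : (1 < size q)%N -> q.[x] != 0 -> 0 < e ->
  exists2 y, cabs (y - x) < e & cabs q.[y] < cabs q.[x].
Proof.
move=> q1 qx e0; have qx0 : 0 < cabs q.[x] by rewrite cabs_gt0.
by apply: level_near.
Qed.

Lemma geometric_small (t K e : R) : 0 <= t < 1 -> 0 < e ->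
  exists N : nat, forall n, (N <= n)%N -> t ^+ n * K < e.
Proof.
move=> /andP[t0 t1] e0.
have nt : `|t| < 1 by rewrite ger0_norm.
have K0 : 0 < `|K| + 1 by have := normr_ge0 K; lra.
have e1 : 0 < e / (`|K| + 1) by rewrite divr_gt0.
have /cvgr0_norm_lt/(_ _ e1)[N _ NP] := cvg_expr nt.
exists N => n /NP /=; rewrite ger0_norm ?exprn_ge0// ltr_pdivlMr// => h.
apply: le_lt_trans h; rewrite ler_wpM2l ?exprn_ge0//.
by have := ler_norm K; lra.
Qed.

Lemma poly_connected_image (q : {poly C}) (A : set C) : connected A ->
  connected [set q.[x] | x in A].
Proof.
move=> cA; apply: connected_continuous_connected => //.
apply: continuous_subspaceT => x V /nbhs_cabs[e e0 eV].
have [d d0 dq] := poly_cont q x e0.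
by apply/nbhs_cabs; exists d => // y /dq; exact: eV.
Qed.

End MinimumModulus.

(** * Immediate basins of polynomial iterates *)

Section Iterates.
Variable R : realType.
Local Notation C := (Cplx R).
Variable f : {poly C}.
Implicit Types (z w : C) (A V : set C) (r : R).

Definition pit n : {poly C} := iter n (fun q => q \Po f) 'X.

Lemma pit_comp n : pit n.+1 = pit n \Po f. Proof. by []. Qed.

Lemma pitS n z : (pit n.+1).[z] = (pit n).[f.[z]].
Proof. by rewrite /pit iterS horner_comp. Qed.

Lemma pitE n z : (pit n).[z] = iter n (horner f) z.
Proof. by elim: n z => [|n IH] z; [rewrite hornerX|rewrite pitS IH -iterSr]. Qed.

Lemma pitSr n z : (pit n.+1).[z] = f.[(pit n).[z]].
Proof. by rewrite !pitE iterS. Qed.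

Lemma pitD m n z : (pit (m + n)).[z] = (pit m).[(pit n).[z]].
Proof. by rewrite !pitE iterD. Qed.

Lemma pit_deriv_root n x : root (pit n)^`() x ->
  exists2 i, (i < n)%N & root f^`() (pit i).[x].
Proof.
elim: n x => [|n IH] x; first by rewrite derivX rootE hornerC oner_eq0.
rewrite pit_comp deriv_comp rootM => /orP[|fx]; last first.
  by exists 0%N => //; rewrite hornerX.
by rewrite rootE horner_comp => /IH[i ni]; exists i.+1 => //; rewrite pitS.
Qed.

Hypothesis f1 : (1 < size f)%N.

Lemma size_pit n : (1 < size (pit n))%N.
Proof.
elim: n => [|n IH]; first by rewrite size_polyX.
have : (0 < (size (pit n.+1)).-1)%N.
  by rewrite pit_comp size_comp_poly -!subn1 muln_gt0 !subn_gt0 IH.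
by lia.
Qed.

Hypothesis f0 : f.[0] = 0.

Lemma pit0 n : (pit n).[0] = 0.
Proof. by elim: n => [|n IH]; [rewrite hornerX|rewrite pitS f0]. Qed.

Lemma pit_deriv0 n : (pit n)^`().[0] = f^`().[0] ^+ n.
Proof.
elim: n => [|n IH]; first by rewrite derivX hornerC expr0.
by rewrite pit_comp deriv_comp hornerM horner_comp f0 IH exprSr.
Qed.

Definition lit n r : set C := lemn (pit n) r 0.

Lemma lit0 n r : 0 < r -> lit n r 0.
Proof. by move=> r0; apply: lemn_refl; rewrite pit0 cabs0. Qed.

Lemma lit_lt n r x : lit n r x -> cabs (pit n).[x] < r.
Proof. exact: lemn_lt. Qed.

Lemma lit_gt0 n r x : lit n r x -> 0 < r.
Proof. by move=> /lemn_base; rewrite pit0 cabs0. Qed.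

Lemma lit_connected n r : connected (lit n r).
Proof. exact: component_connected. Qed.

Lemma lit_mono_r n r r' : r <= r' -> lit n r `<=` lit n r'.
Proof. exact: lemn_mono. Qed.

Lemma lit_max n r A x : connected A -> A 0 -> (forall y, A y -> cabs (pit n).[y] < r) ->
  A x -> lit n r x.
Proof. by move=> cA A0 Ar Ax; apply: (@connected_component_max _ _ A). Qed.

Lemma lit_image m n r x : lit (m + n) r x -> lit m r (pit n).[x].
Proof.
move=> hx; apply: (@lit_max _ _ [set (pit n).[y] | y in lit (m + n) r]).
- by apply: poly_connected_image; exact: lit_connected.
- by exists 0; [exact: lit0 (lit_gt0 hx)|rewrite pit0].
- by move=> _ [y /lit_lt + <-]; rewrite pitD.
- by exists x.
Qed.

Lemma lit_imageS n r x : lit n.+1 r x -> lit n r f.[x].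
Proof. by rewrite -addn1 => /lit_image; rewrite pitSr hornerX. Qed.

Variables (theta r0 : R).
Hypothesis theta01 : 0 <= theta < 1.
Hypothesis fcontract : forall z, cabs z <= r0 -> cabs f.[z] <= theta * cabs z.

Lemma pit_contract n z : cabs z <= r0 -> cabs (pit n).[z] <= theta ^+ n * cabs z.
Proof.
move=> zr; have /andP[t0 t1] := theta01; elim: n => [|n IH].
  by rewrite hornerX expr0 mul1r.
have h : cabs (pit n).[z] <= r0.
  apply: le_trans IH (le_trans _ zr); rewrite ler_piMl ?cabs_ge0//.
  by rewrite exprn_ile1// ltW.
rewrite pitSr exprS -mulrA; apply: le_trans (fcontract h) _.
by rewrite ler_wpM2l.
Qed.

Lemma pit_le n z : cabs z <= r0 -> cabs (pit n).[z] <= cabs z.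
Proof.
have /andP[t0 t1] := theta01; move=> /(pit_contract n)/le_trans; apply.
by rewrite ler_piMl ?cabs_ge0// exprn_ile1// ltW.
Qed.

Lemma pit_ltS n z : cabs z <= r0 -> cabs (pit n.+1).[z] <= theta * cabs z.
Proof. by move=> zr; rewrite pitSr; have h := pit_le n zr;
  apply: le_trans (fcontract (le_trans h zr)) _; rewrite ler_wpM2l//; case/andP: theta01.
Qed.

Lemma lemn_pit_mono m n r x : r <= r0 -> (m <= n)%N -> lemn (pit m) r x `<=` lemn (pit n) r x.
Proof.
move=> rr mn y xy.
apply: (@connected_component_max _ _ (lemn (pit m) r x)) => //.
- exact: lemn_refl (lemn_base xy).
- move=> u /lemn_lt ur; rewrite -(subnK mn) /= pitD; apply: le_lt_trans (ur).
  by apply: pit_le; exact: ltW (lt_le_trans ur rr).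
- exact: component_connected.
Qed.

Lemma lit_mono m n r : r <= r0 -> (m <= n)%N -> lit m r `<=` lit n r.
Proof. exact: lemn_pit_mono. Qed.

Lemma closure_lit n r : 0 < r -> r <= r0 -> closure (lit n r) `<=` lit n.+1 r.
Proof.
move=> r'0 rr x cx; apply: lemn_closure.
  by apply: closureS cx; exact: lit_mono.
have xr : cabs (pit n).[x] <= r by exact: lemn_closure_le cx.
rewrite pitSr; apply: le_lt_trans (fcontract (le_trans xr rr)) _.
have /andP[t0 t1] := theta01.
by have := cabs_ge0 (pit n).[x]; nra.
Qed.

Lemma lit_crit n r x : r <= r0 -> lit n r x -> root (pit n)^`() x ->
  exists i, [/\ (i < n)%N, root f^`() (pit i).[x] & lit (n - i) r (pit i).[x]].
Proof.
move=> rr hx /pit_deriv_root[i ni fi]; exists i; split=> //.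
by apply: lit_image; rewrite subnK// ltnW.
Qed.

(** The union of the [lit n r] is open, and closed relative to the basin: a basin point in its
    closure eventually enters the disk of radius [r] together with a neighbourhood, which is then
    joined to the union at a common level. *)
Lemma immediate_basinE r x : 0 < r -> r <= r0 ->
  immediate_basin (horner f) 0 x <-> exists n, lit n r x.
Proof.
move=> r'0 rr; have small z : cabs z < r -> basin (horner f) 0 z.
  move=> zr; apply/cvgC_P => e e0.
  have [N NP] := geometric_small (cabs z) theta01 e0.
  exists N => // n /= Nn; rewrite subr0 -pitE; apply: le_lt_trans (NP n Nn).
  by apply: pit_contract; lra.
have basinS n z : basin (horner f) 0 (pit n).[z] -> basin (horner f) 0 z.
  move=> /cvgC_P H; apply/cvgC_P => e /H[N _ NP]; exists (N + n)%N => // k /= Nk.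
  have := NP (k - n)%N; rewrite /= leq_subRL; last by apply: leq_trans Nk; rewrite leq_addl.
  rewrite addnC => /(_ Nk); rewrite pitE -iterD subnK//.
  by apply: leq_trans Nk; rewrite leq_addl.
split=> [xB|[n hx]]; last first.
  apply: (@connected_component_max _ _ (lit n r)) => //; last exact: lit_connected.
    exact: lit0.
  by move=> y /lit_lt /small /basinS.
pose U : set C := [set x | exists n, lit n r x].
have oU : open U.
  apply/openC_P => y [n /lemn_near[e e0 eL]]; exists e => // z /eL ?; by exists n.
apply: (@connected_sub_open _ (immediate_basin (horner f) 0) U) => //.
- exact: component_connected.
- exists 0; split; last by exists 0%N; exact: lit0.
  apply: connected_component_refl; apply: small; rewrite cabs0//.
- move=> y /connected_component_sub /cvgC_P/(_ r r'0)[n _ /(_ n (leqnn n))].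
  rewrite /= subr0 -pitE => yr /closureC_P cy.
  have [e e0 ye] := sublevel_near yr.
  have [u [m mu] /ye yu] := cy e e0.
  exists (maxn n m).
  apply: (@lemn_trans _ _ _ u); first by apply: lit_mono mu; rewrite ?leq_maxr.
  by apply: lemn_sym; apply: lemn_pit_mono yu; rewrite ?leq_maxl.
Qed.

(* If the component of [{|pit n| < r}] around 0 contained no critical point, then
   [pit n / 'X] would not vanish on it, against the minimum principle. *)
Lemma lit_has_crit n r rho : (2 < size f)%N -> 0 < r -> r <= r0 -> r <= rho ->
  (forall z, rho < cabs z -> rho < cabs f.[z]) ->
  f^`().[0] != 0 -> cabs f^`().[0] ^+ n * rho < r ->
  exists2 x, lit n r x & root f^`() x.
Proof.
move=> f2 r'0 rr rrho esc mu0 nr.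
have [n0|npos] := posnP n; first by move: nr; rewrite n0 expr0 mul1r ltNge rrho.
have rho0 : 0 < rho by lra.
have escn k z : rho < cabs z -> rho < cabs (pit k).[z].
  by move=> zr; elim: k => [|k IH]; [rewrite hornerX|rewrite pitSr esc].
have p0 := poly_neq0 (size_pit n).
have : root (pit n) 0 by rewrite rootE pit0.
move=> /factor_theorem[q]; rewrite subr0 => pE.
have q1 : (1 < size q)%N.
  have q0 : q != 0 by apply: contraNneq p0 => q0; rewrite pE q0 mul0r.
  have : (2 < size (pit n))%N.
    case: n npos {nr pE p0} => // k _.
    rewrite -(@ltn_predRL 1) pit_comp size_comp_poly.
    by move: f2 (size_pit k); case: (size f) => [|[|[|b]]]//=; case: (size (pit k)) => [|[|a]].
  by rewrite pE size_mulX.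
have q00 : q.[0] = f^`().[0] ^+ n.
  by rewrite -pit_deriv0 pE derivM derivX hornerD !hornerM hornerX mulr0 add0r hornerC mulr1.
have q0 : q.[0] != 0 by rewrite q00 expf_neq0.
have [c nc cp] : exists2 c, lit n r c & root (pit n)^`() c.
  have [[x [hx qx]]|nox] := pselect (exists x, lit n r x /\ root q x).
    apply: (lemn_crit_exists (size_pit n) (r := r) (z := 0) (x := 0) (y := x)) => //.
    - exact: lit0.
    - by rewrite rootE pit0.
    - by rewrite pE rootM qx.
    - by apply: contraTneq qx => <-; rewrite rootE.
  exfalso.
  (* On the boundary [|pit n| = r], and [|x| <= rho] because orbits that start beyond [rho] stay
     beyond [rho >= r]; hence [|q(x)| = r / |x| >= r / rho], against
     [|q(0)| = |f'(0)|^n < r / rho]. *)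
  have : r / rho <= cabs q.[0].
    apply: (@min_modulus _ (horner q) (lit n r)).
    - exact: lemn_open.
    - by apply: (compact_closure_sublevel (size_pit n) (r := r)) => x /lit_lt.
    - move=> x _ e e0; have [d d0 dq] := poly_cont q x e0; exists d => // y _; exact: dq.
    - move=> x hx e e0; apply: poly_decrease => //.
      by apply/negP => qx; apply: nox; exists x.
    - move=> x cx nx.
      have xr : cabs (pit n).[x] = r.
        apply: le_anti; rewrite (lemn_closure_le cx) leNgt; apply/negP => xr.
        by apply: nx; exact: lemn_closure.
      have xrho : cabs x <= rho.
        by rewrite leNgt; apply/negP => /(escn n); rewrite xr ltNge rrho.
      move: xr; rewrite pE hornerM hornerX cabsM => xr.
      by rewrite ler_pdivrMr// -xr ler_wpM2l ?cabs_ge0.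
    - by apply: subset_closure; exact: lit0.
  by rewrite q00 cabsX ler_pdivrMr// leNgt nr.
have [i [ni fi hi]] := lit_crit rr nc cp.
exists (pit i).[c] => //; apply: lit_mono hi => //; exact: leq_subr.
Qed.

(** [f] is proper from [lit n.+1 r] to [lit n r], so its degree there is well defined. *)
Lemma lit_fcount n r v : lit n r v ->
  nroots (f - v%:P) (lit n.+1 r) = nroots f (lit n.+1 r).
Proof.
move=> hv; transitivity (nroots (f - 0%:P) (lit n.+1 r)); last by rewrite subr0.
apply: (nroots_const (U := lit n r)) => //.
- exact: lemn_open.
- exact: lit_connected.
- exact: lemn_open.
- exact: lit_imageS.
- by move=> x cx /lit_lt; rewrite -pitS; exact: lemn_closure.
- exact: lit0 (lit_gt0 hv).
Qed.

Lemma lit_count_comp n r (p : {poly C}) : p != 0 ->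
  (nroots (p \Po f) (lit n.+1 r) = nroots f (lit n.+1 r) * nroots p (lit n r))%N.
Proof.
move=> p0; rewrite nroots_comp// [nroots p _]/nroots.
elim: (rts p) => [|y s IH]; first by rewrite big_nil muln0.
rewrite big_cons IH /= mulnDr; congr addn.
have [hy|ny] := pselect (lit n r y); first by rewrite asboolT// muln1 lit_fcount.
rewrite asboolF// muln0; apply/eqP; rewrite -leqn0 leqNgt; apply/negP.
move=> /(nroots_gt0 _ (subC_neq0 _ f1))[x /lit_imageS hx]; rewrite rootBC => /eqP fx.
by apply: ny; rewrite -fx.
Qed.

Lemma lit_count_crit n r :
  (nroots (pit n.+1)^`() (lit n.+1 r) =
   nroots f (lit n.+1 r) * nroots (pit n)^`() (lit n r) + nroots f^`() (lit n.+1 r))%N.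
Proof.
rewrite pit_comp deriv_comp.
by rewrite nrootsM ?comp_poly_eq0 ?deriv_neq0 ?size_pit// lit_count_comp ?deriv_neq0 ?size_pit.
Qed.

Lemma lit_count n r : (nroots (pit n.+1) (lit n.+1 r) =
   nroots f (lit n.+1 r) * nroots (pit n) (lit n r))%N.
Proof. by rewrite pit_comp lit_count_comp ?poly_neq0 ?size_pit. Qed.

(** Let [d] be the degree of [f] on [lit n.+1 r]. The Riemann-Hurwitz inequality at level [n + 1],
    minus [d] times the assumed equality at level [n], leaves the inequality for [f] alone. *)
Lemma lit_degree_le n r :
  nroots (pit n) (lit n r) = (nroots (pit n)^`() (lit n r)).+1 ->
  (nroots f (lit n.+1 r) <= (nroots f^`() (lit n.+1 r)).+1)%N.
Proof.
move=> eqn; have := critical_count (size_pit n.+1) r 0.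
by rewrite -/(lit n.+1 r) lit_count// lit_count_crit// eqn mulnS -addnS addnC leq_add2l.
Qed.

End Iterates.

(** * Families of polynomials *)

Section Lenses.
Variable R : realType.
Local Notation C := (Cplx R).
Variable g : {poly C}.
Hypothesis g1 : (1 < size g)%N.
Implicit Types (x y : C) (e t : R).

Lemma lens_data x0 e : 0 < e -> exists2 e1, 0 < e1 <= e & exists2 eta, 0 < eta &
  forall y, cabs (y - x0) = e1 -> eta <= cabs (g.[y] - g.[x0]).
Proof.
move=> e0; have [e2 e20 iso] := isolate_root x0 (subC_neq0 g.[x0] g1).
pose e1 := Num.min e e2.
have e10 : 0 < e1 by rewrite lt_min e0.
exists e1; first by rewrite e10 ge_min lexx.
have [|eta eta0 H] := @circle_lower _ g g.[x0] x0 e1 e1 e10.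
  move=> x gx xe; apply: iso; first by rewrite rootBC gx.
  by apply: le_trans xe _; rewrite ge_min lexx orbT.
by exists eta => // y ye; apply: H; rewrite ye lexx.
Qed.

(** Apply [lens_surj] from a point of the component close to [x0]; the value [(1 - t) g(x0)] lies
    radially below the level, inside the lens. *)
Lemma lens_reach x0 e : 0 < cabs g.[x0] -> closure (lemn g (cabs g.[x0]) 0) x0 -> 0 < e ->
  exists2 eta, 0 < eta & forall t, 0 < t <= 1 -> t * cabs g.[x0] < eta ->
    exists y, [/\ cabs (y - x0) < e, lemn g (cabs g.[x0]) 0 y & g.[y] = (1 - t)%:C%C * g.[x0]].
Proof.
set r := cabs g.[x0] => r0 /closureC_P cx e0.
have [e1 /andP[e10 e1e] [eta eta0 circ]] := lens_data x0 e0.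
exists eta => // t t01 tr.
have [d d0 gd] := poly_cont g x0 eta0.
have m0 : 0 < Num.min d e1 by rewrite lt_min d0.
have [u Lu] := cx _ m0; rewrite lt_min => /andP[ud ue].
have [|||||y [ye gy uy]] := @lens_surj _ g g1 g.[x0] x0 r e1 eta u ((1 - t)%:C%C * g.[x0]) circ.
- by [].
- exact: lemn_lt Lu.
- exact: gd.
- by rewrite cabs_scale -/r; [nra|lra].
- by rewrite cabs_scale_sub gtr0_norm//; lra.
by exists y; split=> //; [lra|exact: lemn_trans Lu uy].
Qed.

End Lenses.

Section Families.
Variable R : realType.
Local Notation C := (Cplx R).
Variables (I : Type) (F : set_system I).
Context {FF : Filter F}.
Implicit Types (z w : C) (r e d : R).

(** Joint convergence of [(G i)(y)] to [g(z)] as [y] tends to [z]: it amounts to locally uniform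
    convergence and passes to compositions at once. *)
Definition luconv (G : I -> {poly C}) (g : {poly C}) := forall z e, 0 < e ->
  exists2 d, 0 < d & F [set i | forall y, cabs (y - z) < d -> cabs ((G i).[y] - g.[z]) < e].

Definition ptconv (x : I -> C) (x0 : C) := forall e, 0 < e -> F [set i | cabs (x i - x0) < e].

Lemma luconv_point G g x x0 : luconv G g -> ptconv x x0 ->
  ptconv (fun i => (G i).[x i]) g.[x0].
Proof.
move=> Gg xx e e0; have [d d0 H] := Gg x0 e e0.
by apply: filterS2 H (xx d d0) => i /= h; exact: h.
Qed.

Lemma luconv_pit G g n : luconv G g -> luconv (fun i => pit (G i) n) (pit g n).
Proof.
move=> Gg; elim: n => [|n IH] z e e0.
  by exists e => //; apply: nearW => i y; rewrite !hornerX.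
have [d d0 H] := Gg (pit g n).[z] e e0; have [d1 d10 H1] := IH z d d0.
exists d1 => //; apply: filterS2 H H1 => i /= h h1 y /h1 /h.
by rewrite !pitSr.
Qed.

Lemma ptconv_cabs x x0 e : ptconv x x0 -> 0 < e ->
  F [set i | cabs x0 - e < cabs (x i) < cabs x0 + e].
Proof.
move=> xx e0; apply: filterS (xx e e0) => i /= h.
have := cabsB_ge (x i) x0; have := cabsB_ge x0 (x i); rewrite (cabs_sub x0); lra.
Qed.

Variables (G : I -> {poly C}) (g : {poly C}).
Hypothesis Gg : luconv G g.
Hypotheses (G0 : forall i, (G i).[0] = 0) (g0 : g.[0] = 0).
Hypotheses (G1 : forall i, (1 < size (G i))%N) (g1 : (1 < size g)%N).

(** The property is locally constant on the component: a small disk on which [|g|] stays below [r]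
    by a margin is crossed by segments in the sublevel set of [G i], eventually in [i]. The strict
    [r' < r] leaves room for levels that move with the parameter. *)
Lemma lemn_open_family r x : lemn g r 0 x -> exists r', [/\ r' < r, 0 < r' &
  exists2 d, 0 < d & F [set i | forall y, cabs (y - x) < d -> lemn (G i) r' 0 y]].
Proof.
move=> gx; pose P x := exists r', [/\ r' < r, 0 < r' &
  exists2 d, 0 < d & F [set i | forall y, cabs (y - x) < d -> lemn (G i) r' 0 y]].
have disk y : cabs g.[y] < r -> exists r', [/\ r' < r, 0 < r' & exists2 d, 0 < d &
    F [set i | forall u v, cabs (u - y) < d -> cabs (v - y) < d -> lemn (G i) r' u v]].
  move=> yr; have e0 : 0 < (r - cabs g.[y]) / 2 by lra.
  have [d d0 H] := Gg y e0.
  have a0 := cabs_ge0 g.[y].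
  exists ((cabs g.[y] + r) / 2); split; [lra|lra|]; exists d => //.
  apply: filterS H => i /= h u v ud vd.
  apply: segment_component => t tt /=.
  have := h _ (cdisk_convex ud vd tt).
  by have := cabsB_ge (G i).[u + t%:C%C * (v - u)] g.[y]; lra.
apply: (@connected_locally_constant _ (lemn g r 0) P _ _ 0 x) => //.
- exact: component_connected.
- move=> y /lemn_lt /disk[ry [ryr ry0 [d d0 H]]].
  exists (d / 2); first lra; move=> u _ ud.
  have key v v' : cabs (v - y) < d / 2 -> cabs (v' - y) < d / 2 -> P v -> P v'.
    move=> vd v'd [r' [r'r r'0 [d' d'0 H']]].
    exists (Num.max r' ry); split; [by rewrite gt_max r'r|by rewrite lt_max r'0|].
    exists (d / 2); first lra.
    apply: filterS2 H H' => i /= h h' w wd.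
    apply: (@lemn_trans _ _ _ v).
      apply: lemn_mono (h' v _); first by rewrite le_max lexx.
      by rewrite subrr cabs0.
    apply: (@lemn_mono _ _ ry); first by rewrite le_max lexx orbT.
    by apply: h; [|have := cabs_triangle v' w y]; lra.
  split; apply: key => //; rewrite subrr cabs0; lra.
- by apply: lemn_refl; exact: lemn_base gx.
- have [r' [r'r r'0 [d d0 H]]] := disk 0 (lemn_base gx).
  exists r'; split=> //; exists d => //; apply: filterS H => i /= h y; apply: h.
  by rewrite subrr cabs0.
Qed.

(** [|g| >= r' > r] on the compact boundary of [lemn g r' 0], hence eventually [|G i| > r] there,
    and the component of [G i] cannot leave. *)
Lemma lemn_lim_family r r' : r < r' -> F [set i | lemn (G i) r 0 `<=` lemn g r' 0].
Proof.
move=> rr'; have [r0|r0] := leP r 0.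
  apply: nearW => i x /lemn_lt; by have := cabs_ge0 (G i).[x]; lra.
pose L := lemn g r' 0.
have L0 : L 0 by apply: lemn_refl; rewrite g0 cabs0; lra.
have oL : open L by exact: lemn_open.
pose K := closure L `&` ~` L.
have cK : compact K.
  apply: (@subclosed_compact _ K (closure L)).
  - by apply: closedI; [exact: closed_closure|exact: open_closedC].
  - by apply: (compact_closure_sublevel g1 (r := r')) => x /lemn_lt.
  - by move=> x [].
have : F [set i | forall z, K z -> r < cabs (G i).[z]].
  apply: (compact_tube FF (P := fun i z => r < cabs (G i).[z]) cK) => y [cy nLy].
  have yr' : r' <= cabs g.[y].
    by rewrite leNgt; apply/negP => h; apply: nLy; exact: lemn_closure.
  have e0 : 0 < r' - r by lra.
  have [d d0 H] := Gg y e0; exists d => //; apply: filterS H => i /= h z /h.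
  have := cabsB_ge g.[y] (G i).[z]; rewrite (cabs_sub g.[y]); lra.
apply: filterS => i /= H.
apply: (@connected_sub_open _ (lemn (G i) r 0) L) => //.
- exact: component_connected.
- by exists 0; split=> //; apply: lemn_refl; rewrite G0 cabs0.
- move=> x /lemn_lt xr cx; apply: contrapT => nL.
  by have := H x (conj cx nL); lra.
Qed.

Lemma circle_family (x : I -> C) x0 e eta : ptconv x x0 -> 0 < eta ->
  (forall y, cabs (y - x0) = e -> eta <= cabs (g.[y] - g.[x0])) ->
  F [set i | forall y, cabs (y - x0) = e -> eta / 2 <= cabs ((G i).[y] - (G i).[x i])].
Proof.
move=> xx eta0 circ; pose K := [set y | cabs (y - x0) = e].
have cK : compact K.
  apply: (@bounded_closed_compactC _ _ (cabs x0 + e)).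
    have -> : K = ~` (cdisk x0 e) `&` ~` [set x | e < cabs (x - x0)].
      apply/seteqP; split=> y; rewrite /K /cdisk /=.
        by move=> ->; rewrite ltxx.
      by move=> [/negP h1 /negP h2]; apply: le_anti; rewrite !leNgt h1 h2.
    by apply: closedI; apply: open_closedC; [exact: open_cdisk|exact: open_far].
  by move=> y; rewrite /K /= => h; have := cabsB_ge y x0; lra.
have e40 : 0 < eta / 4 by lra.
have H1 := luconv_point Gg xx e40.
have H2 : F [set i | forall y, K y -> 3 / 4 * eta <= cabs ((G i).[y] - g.[x0])].
  apply: (compact_tube FF (P := fun i y => 3 / 4 * eta <= cabs ((G i).[y] - g.[x0])) cK).
  move=> y Ky; have [d d0 H] := Gg y e40; exists d => //; apply: filterS H => i /= h z /h.
  have := circ y Ky; have := cabs_triangle (G i).[z] g.[y] g.[x0].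
  rewrite (cabs_sub g.[y] (G i).[z]); lra.
apply: filterS2 H1 H2 => i /= h1 h2 y /h2.
have := cabs_triangle (G i).[x i] (G i).[y] g.[x0]; lra.
Qed.

(** A form of [lens_reach] with constants that do not depend on the member of the family; the level
    is that of the moving point [x i]. *)
Lemma lens_family (x : I -> C) x0 e : ptconv x x0 -> 0 < e ->
  exists d eta, [/\ 0 < d, 0 < eta & F [set i | forall u t, cabs (u - x0) < d ->
    lemn (G i) (cabs (G i).[x i]) 0 u -> 0 < t <= 1 -> t * cabs (G i).[x i] <= eta ->
    exists y, [/\ cabs (y - x0) < e, lemn (G i) (cabs (G i).[x i]) 0 y &
      (G i).[y] = (1 - t)%:C%C * (G i).[x i]]]].
Proof.
move=> xx e0; have [e1 /andP[e10 e1e] [eta eta0 circ]] := lens_data g1 x0 e0.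
have H1 := circle_family xx eta0 circ.
have eta80 : 0 < eta / 8 by lra.
have H2 := luconv_point Gg xx eta80.
have [d d0 H3] := Gg x0 eta80.
have m0 : 0 < Num.min d e1 by rewrite lt_min d0.
exists (Num.min d e1), (eta / 4); split=> //; first lra.
apply: filterS2 (filterI H1 H2) H3 => i /= [circi wi] ui u t.
have [w wE] : exists w, w = (G i).[x i] by eexists.
rewrite -wE in circi wi *; rewrite lt_min => /andP[/ui {}ui ue] Lu t01 tw.
have w0 : 0 < cabs w.
  by have := lemn_base Lu; have := cabs_ge0 (G i).[0]; lra.
have [|||||y [ye gy uy]] := @lens_surj _ (G i) (G1 i) w x0 (cabs w) e1 (eta / 2) u
    ((1 - t)%:C%C * w) circi.
- by [].
- exact: lemn_lt Lu.
- have := cabs_triangle g.[x0] (G i).[u] w; rewrite (cabs_sub g.[x0] w); lra.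
- by rewrite cabs_scale; [nra|lra].
- by rewrite cabs_scale_sub gtr0_norm; lra.
by exists y; split=> //; [lra|exact: lemn_trans Lu uy].
Qed.

Definition nocrit (h : {poly C}) r := forall y, lemn h r 0 y -> ~ root h^`() y.

(** The lens gives a point [y] near [x0] of value [(1 - t) (G i)(x i)] in the component at level
    [|(G i)(x i)|]. In the absence of critical points, [lemn_nocrit_sub] moves [y] to the component
    at the lower level [(1 - t / 4) r], and this strict drop allows the passage to [g]. *)
Lemma petal_closed (x : I -> C) x0 e : ptconv x x0 -> 0 < cabs g.[x0] -> 0 < e ->
  F [set i | closure (lemn (G i) (cabs (G i).[x i]) 0) (x i) ->
    nocrit (G i) (cabs (G i).[x i]) ->
    exists2 y, lemn g (cabs g.[x0]) 0 y & cabs (y - x0) < e].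
Proof.
move=> xx; set r := cabs g.[x0] => r0 e0.
have [d [eta [d0 eta0 HL]]] := lens_family xx e0.
have d20 : 0 < d / 2 by lra.
have eta2r : 0 < eta / (2 * r) by rewrite divr_gt0// mulr_gt0.
have [t [t0 t1]] := exists_below2 (ltr01 : 0 < 1 :> R) eta2r.
rewrite ler_pdivlMr ?mulr_gt0// => tr.
have tr0 : 0 < t * r by rewrite mulr_gt0.
have tr80 : 0 < t * r / 8 by lra.
have H6 : F [set i | lemn (G i) ((1 - t / 4) * r) 0 `<=` lemn g r 0].
  by apply: lemn_lim_family; lra.
apply: filterS2 (filterI HL (xx _ d20)) (filterI (ptconv_cabs (luconv_point Gg xx) tr80) H6).
move=> i /= [lens xi] [+ Li] /closureC_P clx nc.
rewrite -/r => /andP[ri1 ri2].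
have [u Lu ux] := clx _ d20.
have [||||y [ye Ly gy]] := lens u t.
- by have := cabs_triangle (x i) u x0; lra.
- exact: Lu.
- by rewrite t0.
- by nra.
exists y; last exact: ye.
apply: Li; apply: (@lemn_nocrit_sub _ (G i) (G1 i) (cabs (G i).[x i]) _ 0 y).
- by move=> c Lc pc; exact: (nc c Lc pc).
- by nra.
- by rewrite G0 cabs0; nra.
- exact: Ly.
- by rewrite gy cabs_scale; [nra|lra].
Qed.

(** For a lens point [y] of value [(1 - t) (G i)(x i)] the lower bound on [h] gives
    [|y - x i|^2 <= t |(G i)(x i)| / m]; so these points of the component tend to [x i] itself and
    do not merely stay near [x0]. *)
Lemma petal_open (x : I -> C) x0 (h : I -> C -> C) d0 m : ptconv x x0 ->
  0 < cabs g.[x0] -> closure (lemn g (cabs g.[x0]) 0) x0 -> 0 < d0 -> 0 < m ->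
  F [set i | forall y, cabs (y - x0) < d0 -> m <= cabs (h i y)] ->
  (forall i y, (G i).[y] - (G i).[x i] = (y - x i) ^+ 2 * h i y) ->
  F [set i | closure (lemn (G i) (cabs (G i).[x i]) 0) (x i)].
Proof.
move=> xx; set r := cabs g.[x0] => r0 /closureC_P clx d00 m0 Hm hE.
have [d [eta [d_0 eta0 HL]]] := lens_family xx d00.
have [u Lu ux] := clx d d_0.
have [r' [r'r r'0 [d2 d20 H4]]] := lemn_open_family Lu.
have rr0 : 0 < r - r' by lra.
apply: filterS2 (filterI (ptconv_cabs (luconv_point Gg xx) rr0) H4) (filterI HL Hm).
move=> i /= [/andP[+ _] hu] [lens hm]; rewrite -/r => ri.
have [w wE] : exists w : R, w = cabs (G i).[x i] by eexists.
rewrite -wE in ri lens *.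
have Liu : lemn (G i) w 0 u.
  by apply: (@lemn_mono _ _ r'); [lra|apply: hu; rewrite subrr cabs0].
have w0 : 0 < w by lra.
apply/closureC_P => e e0.
have me0 : 0 < m * (e / 2) ^+ 2 by rewrite mulr_gt0// exprn_gt0//; lra.
have eta1 : 0 < Num.min eta (m * (e / 2) ^+ 2) / (2 * w).
  by rewrite divr_gt0 ?lt_min ?eta0// mulr_gt0.
have [t [t0 t1]] := exists_below2 (ltr01 : 0 < 1 :> R) eta1.
rewrite ler_pdivlMr ?mulr_gt0// le_min => /andP[tw tm].
have tw0 : 0 < t * w by rewrite mulr_gt0.
have [||||y [ye Ly gy]] := lens u t.
- exact: ux.
- exact: Liu.
- by rewrite t0.
- lra.
exists y; first exact: Ly.
have := hE i y; rewrite gy => /(congr1 (@cabs R)).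
rewrite cabs_scale_sub cabsM cabsX gtr0_norm// -wE => E.
have hy := hm y ye.
rewrite ltNge; apply/negP => ey.
have e2 : (e / 2) ^+ 2 <= cabs (y - x i) ^+ 2.
  by apply: lerXn2r; rewrite ?nnegrE ?cabs_ge0//; lra.
have : m * (e / 2) ^+ 2 <= cabs (y - x i) ^+ 2 * cabs (h i y).
  rewrite mulrC; apply: ler_pM => //; [by apply: exprn_ge0; lra|exact: ltW].
by rewrite -E; lra.
Qed.

(** Take [y] in the limit component with [g(y) = (1 - t) g(x0)] and let [v = y - x0]. As [h] is
    nearly the constant [k], [(G i)(x i + s v)] is close to [(1 - s^2 t) (G i)(x i)], hence below
    the level for [0 < s <= 1]; the end [s = 1] is close to [y] and so in the component. *)
Lemma petal_segment (x : I -> C) x0 (h : I -> C -> C) (h0 : C -> C) k : ptconv x x0 ->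
  0 < cabs g.[x0] -> closure (lemn g (cabs g.[x0]) 0) x0 -> k != 0 ->
  (forall e, 0 < e -> exists2 d, 0 < d &
    F [set i | forall y, cabs (y - x0) < d -> cabs (h i y - k) < e] /\
    forall y, cabs (y - x0) < d -> cabs (h0 y - k) < e) ->
  (forall i y, (G i).[y] - (G i).[x i] = (y - x i) ^+ 2 * h i y) ->
  (forall y, g.[y] - g.[x0] = (y - x0) ^+ 2 * h0 y) ->
  exists2 v : C, v != 0 & F [set i | forall s : R, 0 < s <= 1 ->
    lemn (G i) (cabs (G i).[x i]) 0 (x i + s%:C%C * v)].
Proof.
move=> xx; set r := cabs g.[x0] => r0 clx k0 Hh hE h0E.
(* With [|h - k| < |k| / 8] the relative error of [h] is at most 2/7, and with values moving by less
   than [r / 8] the total error [(2/7 + 1/8) t r] stays below the gain, which is at least [7/8 t r],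
   all up to the factor [s^2]. *)
have kp : 0 < cabs k / 8 by rewrite divr_gt0// cabs_gt0.
have [d d0 [Hd h0d]] := Hh _ kp.
have d20 : 0 < d / 2 by lra.
have [eta eta0 reach] := lens_reach g1 r0 clx d20.
have eta2r : 0 < eta / (2 * r) by rewrite divr_gt0// mulr_gt0.
have half0 : 0 < 1 / 2 :> R by lra.
have [t [t0 t1]] := exists_below2 half0 eta2r.
rewrite ler_pdivlMr ?mulr_gt0// => tw.
have tr0 : 0 < t * r by rewrite mulr_gt0.
have [||y [ye Ly gy]] := reach t; [lra|rewrite -/r; lra|].
rewrite -/r in Ly.
pose v := y - x0.
have Ey : v ^+ 2 * h0 y = - (t%:C%C * g.[x0]).
  by rewrite -h0E gy rmorphB rmorph1 mulrBl mul1r addrAC subrr add0r.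
have v0 : v != 0.
  apply/eqP => v0; move: Ey; rewrite v0 expr0n mul0r => /eqP.
  rewrite eq_sym oppr_eq0 mulf_eq0 => /orP[/eqP/(congr1 (@cabs R))|/eqP gx].
    by rewrite cabs_real cabs0 gtr0_norm//; lra.
  by move: r0; rewrite /r gx cabs0; lra.
exists v => //.
have [r' [r'r r'0 [d2 d20' H4]]] := lemn_open_family Ly.
have mr0 : 0 < Num.min (r - r') (r / 8) by rewrite lt_min; apply/andP; split; lra.
have H5 := luconv_point Gg xx mr0.
have md0 : 0 < Num.min d2 (d / 2) by rewrite lt_min d20'; lra.
have H6 := xx _ md0.
apply: filterS2 (filterI H5 H6) (filterI H4 Hd) => i /= [wi].
rewrite lt_min => /andP[xi2 xid] [Li hd] s s01.
move: wi; rewrite lt_min => /andP[wi1 wi2].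
have [w wE] : exists w, w = (G i).[x i] by eexists.
rewrite -wE in wi1 wi2 *.
have wr : cabs g.[x0] - cabs w <= cabs (w - g.[x0]).
  by rewrite (cabs_sub w); exact: cabsB_ge.
rewrite -/r in wr.
have vd : cabs v < d / 2 by rewrite /v; lra.
have E t' : 0 < t' <= 1 -> cabs (G i).[x i + t'%:C%C * v] < cabs w.
  move=> /andP[t'0 t'1].
  have yd : cabs (x i + t'%:C%C * v - x0) < d.
    have -> : x i + t'%:C%C * v - x0 = (x i - x0) + t'%:C%C * v by ring.
    apply: le_lt_trans (cabsD _ _) _; rewrite cabsM cabs_real gtr0_norm//.
    have := cabs_ge0 v; nra.
  have h1 := hd _ yd.
  have h2 := h0d y ltac:(lra).
  set hi := h i _ in h1.
  pose E := v ^+ 2 * (hi - h0 y).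
  have -> : (G i).[x i + t'%:C%C * v] =
      (1 - t' ^+ 2 * t)%:C%C * w + (t' ^+ 2)%:C%C * (E - t%:C%C * (g.[x0] - w)).
    have := hE i (x i + t'%:C%C * v); rewrite -/hi -wE => /eqP; rewrite subr_eq => /eqP ->.
    have -> : E = v ^+ 2 * hi + t%:C%C * g.[x0] by rewrite /E mulrBr Ey opprK.
    rewrite !(rmorphB, rmorphM, rmorphXn, rmorph1) /=; ring.
  have V0 : 0 <= cabs v ^+ 2 by rewrite exprn_ge0// cabs_ge0.
  have Vt : cabs v ^+ 2 * cabs (h0 y) = t * r.
    by rewrite -cabsX -cabsM Ey cabsN cabsM cabs_real gtr0_norm.
  have hk : 7 / 8 * cabs k <= cabs (h0 y).
    have := cabsB_ge k (h0 y); rewrite (cabs_sub k); lra.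
  have h12 : cabs (hi - h0 y) <= cabs k / 4.
    have := cabs_triangle k hi (h0 y); rewrite (cabs_sub k); lra.
  have EE : cabs E <= 2 / 7 * (t * r).
    rewrite /E cabsM cabsX -Vt.
    apply: (@le_trans _ _ (cabs v ^+ 2 * (2 / 7 * cabs (h0 y)))); last lra.
    by rewrite ler_wpM2l//; lra.
  have T2 : 0 < t' ^+ 2 <= 1 by rewrite exprn_gt0// exprn_ile1// ltW.
  have [T TE] : exists T, T = t' ^+ 2 by eexists.
  rewrite -TE in T2 *; have /andP[T0 T1] := T2.
  apply: le_lt_trans (cabsD _ _) _; rewrite cabs_scale; last first.
    by apply/andP; split; [rewrite mulr_ge0// ltW|nra].
  rewrite cabsM cabs_real gtr0_norm//.
  have : cabs (E - t%:C%C * (g.[x0] - w)) <= 2 / 7 * (t * r) + t * (r / 8).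
    have h3 : cabs (t%:C%C * (g.[x0] - w)) <= t * (r / 8).
      by rewrite cabsM cabs_real (gtr0_norm t0) (cabs_sub g.[x0]) ler_wpM2l// ltW.
    by apply: le_trans (cabsD _ _) _; rewrite cabsN lerD.
  move=> EB; apply: (@le_lt_trans _ _ ((1 - T * t) * cabs w + T * (2 / 7 * (t * r) + t * (r / 8)))).
    by rewrite lerD2l ler_wpM2l// ltW.
  have P0 : 0 < T * t by rewrite mulr_gt0.
  have wr8 : 7 / 8 * r <= cabs w by lra.
  have : T * t * (7 / 8 * r) <= T * t * cabs w by rewrite ler_wpM2l// ltW.
  have : 0 < T * t * r by rewrite mulr_gt0.
  lra.
have Lv : lemn (G i) (cabs w) 0 (x i + v).
  apply: (@lemn_mono _ _ r'); first lra.
  by apply: Li; rewrite /v addrA addrAC addrK.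
apply: (lemn_trans Lv); apply: segment_component => a a01 /=.
have /andP[s0 s1] := s01; have /andP[a0 a1] := a01.
have -> : x i + v + a%:C%C * (x i + s%:C%C * v - (x i + v)) = x i + (1 - a * (1 - s))%:C%C * v.
  rewrite !(rmorphB, rmorphM, rmorph1) /=; ring.
by apply: E; nra.
Qed.

End Families.

(** * Cubics in terms of their critical points *)

Section Cubic.
Variable R : realType.
Local Notation C := (Cplx R).
Implicit Types (a b z w : C) (r : R).

(** The cubic of the family with critical points [a] and [b]: its derivative is [3 (z - a) (z - b)],
    and [3 a b] is the multiplier of the fixed point 0. *)
Definition cub a b : {poly C} := fpoly (3 * a * b) (- (3 / 2 * (a + b))).

Lemma fpolyE (mu c : C) z : (fpoly mu c).[z] = mu * z + c * z ^+ 2 + z ^+ 3.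
Proof. by rewrite !(hornerD, hornerZ, hornerXn, hornerX). Qed.

Lemma size_fpoly (mu c : C) : size (fpoly mu c) = 4%N.
Proof.
rewrite /fpoly addrC size_polyDl ?size_polyXn//.
apply: leq_ltn_trans (size_polyD _ _) _; rewrite gtn_max; apply/andP; split.
  by apply: leq_ltn_trans (size_scale_leq _ _) _; rewrite size_polyX.
by apply: leq_ltn_trans (size_scale_leq _ _) _; rewrite size_polyXn.
Qed.

Lemma fpoly1 (mu c : C) : (1 < size (fpoly mu c))%N. Proof. by rewrite size_fpoly. Qed.

Lemma fpoly0 (mu c : C) : (fpoly mu c).[0] = 0.
Proof. by rewrite fpolyE; ring. Qed.

Lemma deriv_fpolyE (mu c : C) z : (fpoly mu c)^`().[z] = mu + 2 * c * z + 3 * z ^+ 2.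
Proof.
rewrite /fpoly !derivD !derivZ derivX !derivXn.
rewrite !(hornerD, hornerZ, hornerMn, hornerXn, hornerX, hornerC).
by rewrite -[2.-1]/1%N -[3.-1]/2%N; ring.
Qed.

Lemma cubE a b z : (cub a b).[z] = 3 * a * b * z - 3 / 2 * (a + b) * z ^+ 2 + z ^+ 3.
Proof. by rewrite fpolyE; ring. Qed.

Lemma deriv_cub a b : (cub a b)^`() = 3 *: (('X - a%:P) * ('X - b%:P)).
Proof.
rewrite /cub /fpoly !derivD !derivZ derivX !derivXn /=.
have -> : - (3 / 2 * (a + b)) *: ('X^1 *+ 2) = (- (3 * (a + b))) *: 'X.
  by rewrite -scalerMnr scalerMnl expr1; congr (_ *: _); field.
rewrite -!mul_polyC !(rmorphM, rmorphN, rmorphD, rmorph_nat); ring.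
Qed.

Lemma cub_crit a b z : root (cub a b)^`() z <-> z = a \/ z = b.
Proof.
rewrite deriv_cub rootZ ?pnatr_eq0// rootM !root_XsubC; split.
  by move=> /orP[/eqP|/eqP]; [left|right].
by move=> [->|->]; rewrite eqxx ?orbT.
Qed.

Lemma cub_deriv0 a b : (cub a b)^`().[0] = 3 * a * b.
Proof. by rewrite deriv_fpolyE; ring. Qed.

Lemma nroots_deriv_cub a b V :
  nroots (cub a b)^`() V = (`[<V a>] + `[<V b>])%N.
Proof.
rewrite (@nrootsE _ _ 3 [:: a; b]) ?pnatr_eq0//=; first by rewrite addn0.
by rewrite deriv_cub big_cons big_seq1.
Qed.

Lemma cubC a b : cub a b = cub b a.
Proof. by rewrite /cub (addrC a) mulrAC. Qed.

Lemma cub_crit_double a b V : V a -> (2 <= nroots (cub a b - (cub a b).[a]%:P) V)%N.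
Proof.
move=> Va; have f1 := fpoly1 (3 * a * b) (- (3 / 2 * (a + b))).
apply: (@leq_trans (nroots (cub a b - (cub a b).[a]%:P) [set a])).
  rewrite nroots_deriv ?subC_neq0 ?rootBC// derivB derivC subr0 ltnS.
  by apply/(nroots_gt0 _ (deriv_neq0 f1)); exists a => //; apply/cub_crit; left.
by apply: nroots_sub => x ->.
Qed.

(** The divided difference of [cub a b] between [u] and [v]. *)
Definition cub_diff a b (u v : C) : C :=
  3 * a * b - 3 / 2 * (a + b) * (u + v) + (u ^+ 2 + u * v + v ^+ 2).

(** The quotient of [f^(n+1)(y) - f^(n+1)(a)] by [(y - a)^2], the index being one below the number
    of iterations; the double zero comes from [f'(a) = 0]. *)
Fixpoint crit_quot a b n y : C :=
  if n is k.+1 then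
    crit_quot a b k y * cub_diff a b (pit (cub a b) n).[y] (pit (cub a b) n).[a]
  else y + a / 2 - 3 / 2 * b.

Lemma crit_quotE a b n y : (pit (cub a b) n.+1).[y] - (pit (cub a b) n.+1).[a] =
  (y - a) ^+ 2 * crit_quot a b n y.
Proof.
elim: n => [|n IH]; first by rewrite !pitSr !hornerX !cubE /=; field.
rewrite [crit_quot _ _ _ _]/= mulrA -IH pitSr [in X in _ - X]pitSr.
move: (pit (cub a b) n.+1).[y] (pit (cub a b) n.+1).[a] => u v.
by rewrite !cubE /cub_diff; ring.
Qed.

Lemma cub_diff_diag a b u : cub_diff a b u u = (cub a b)^`().[u].
Proof. by rewrite deriv_fpolyE /cub_diff; field. Qed.

Lemma crit_quot_neq0 a b n : a != b ->
  (forall i, (0 < i <= n)%N -> ~ root (cub a b)^`() (pit (cub a b) i).[a]) ->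
  crit_quot a b n a != 0.
Proof.
move=> ab; elim: n => [|n IH] H.
  have -> : crit_quot a b 0 a = 3 / 2 * (a - b) by rewrite /=; field.
  by rewrite mulf_neq0 ?subr_eq0// mulf_neq0 ?invr_eq0 ?pnatr_eq0.
rewrite [crit_quot _ _ _ _]/= mulf_neq0 ?cub_diff_diag//.
  by apply: IH => i /andP[i0 ni]; apply: H; rewrite i0 ltnW.
by rewrite -rootE; apply/negP; apply: (H n.+1); rewrite /= leqnn.
Qed.

(** Indeed [f(a) - f(b) = - (a - b)^3 / 2]. *)
Lemma cub_val_inj a b : (cub a b).[a] = (cub a b).[b] -> a = b.
Proof.
rewrite !cubE => /eqP; rewrite -subr_eq0.
have -> : 3 * a * b * a - 3 / 2 * (a + b) * a ^+ 2 + a ^+ 3 -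
  (3 * a * b * b - 3 / 2 * (a + b) * b ^+ 2 + b ^+ 3) = - (a - b) ^+ 3 / 2 by field.
rewrite mulf_eq0 invr_eq0 pnatr_eq0 orbF oppr_eq0 expf_eq0 /= subr_eq0.
by move=> /eqP.
Qed.

End Cubic.

(** * Early critical points, and degrees until the other one enters *)

Section Early.
Variable R : realType.
Local Notation C := (Cplx R).
Variables (a b : C) (theta r0 : R) (N : nat).
Local Notation f := (cub a b).
Local Notation g := (pit f N).
Hypothesis theta01 : 0 <= theta < 1.
Hypothesis fcontract : forall z, cabs z <= r0 -> cabs f.[z] <= theta * cabs z.
Implicit Types (z w : C) (r : R).

Let f1 : (1 < size f)%N := fpoly1 _ _.
Let f0 : f.[0] = 0 := fpoly0 _ _.
Let g1 := size_pit f1 N.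

(* [w] is one of the first critical points met by the component of [{|f^N| < r}] around 0
   when [r] grows. *)
Definition early w := [/\ 0 < cabs g.[w] < r0, ~ lit f N (cabs g.[w]) a,
  ~ lit f N (cabs g.[w]) b & closure (lit f N (cabs g.[w])) w].

(** A critical point of [f^N] in the component is mapped by some [f^i] to [a] or [b], inside
    [lit f (N - i) r], which is contained in [lit f N r]. *)
Lemma lit_nocrit r : r <= r0 -> ~ lit f N r a -> ~ lit f N r b -> nocrit g r.
Proof.
move=> rr na nb y hy /(lit_crit f0 rr hy)[i [ni /cub_crit fi]].
move=> /(lit_mono theta01 fcontract rr (leq_subr i N)).
by case: fi => ->.
Qed.

Lemma lit_crit_closure r x : 0 < r -> r <= r0 -> closure (lit f N r) x -> root g^`() x ->
  closure (lit f N r) a \/ closure (lit f N r) b.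
Proof.
move=> r'0 rr cx /pit_deriv_root[i ni /cub_crit fi].
suff : closure (lit f N r) (pit f i).[x] by case: fi => ->; [left|right].
apply/closureC_P => e e0; have [d d0 dp] := poly_cont (pit f i) x e0.
move: cx => /closureC_P/(_ d d0)[y hy /dp yx].
exists (pit f i).[y] => //.
apply: (lit_mono theta01 fcontract rr (leq_subr i N)).
by apply: lit_image => //; rewrite subnK// ltnW.
Qed.

(** At the supremum [t] of the levels whose component contains neither critical point, one of them
    is in the closure: otherwise, by [lit_crit_closure], the closure contains no critical point of
    [f^N], and [lemn_grow] carries the property beyond [t]. *)
Lemma early_exists : 3 * a * b != 0 -> lit f N r0 a \/ lit f N r0 b -> early a \/ early b.
Proof.
move=> ab0 hab.
have r'0 : 0 < r0 by case: hab => /(lit_gt0 f0).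
have [a0 b0] : a != 0 /\ b != 0.
  by move: ab0; rewrite !mulf_eq0 !negb_or => /andP[/andP[_ ->] ->].
pose S := [set r | r <= r0 /\ ~ lit f N r a /\ ~ lit f N r b].
have S0 : S 0 by split; [lra|split => /(lit_gt0 f0); rewrite ltxx].
have hS : has_sup S by split; [exists 0|exists r0 => r []].
pose t := sup S.
have t0 : 0 <= t by apply: ub_le_sup => //; exact: hS.2.
have below r : r < t -> ~ lit f N r a /\ ~ lit f N r b.
  move=> /(sup_gt hS.1)[r' [_ [na nb]] rr']; split=> h.
    by apply: na; exact: lit_mono_r (ltW rr') _ h.
  by apply: nb; exact: lit_mono_r (ltW rr') _ h.
have [nta ntb] : ~ lit f N t a /\ ~ lit f N t b.
  by split=> /lemn_inc[r' /below[na nb] h]; [exact: na|exact: nb].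
have tr : t < r0.
  have [r' r'r0 hr'] : exists2 r', r' < r0 & lit f N r' a \/ lit f N r' b.
    by case: hab => /lemn_inc[r' r'r h]; exists r' => //; [left|right].
  apply: le_lt_trans r'r0; rewrite leNgt; apply/negP => /below[na nb].
  by case: hr'.
have above r : t < r -> r <= r0 -> lit f N r a \/ lit f N r b.
  move=> tlr rr; apply: contrapT => /not_orP[na nb].
  have : r <= t by apply: ub_le_sup; [exact: hS.2|].
  by rewrite leNgt tlr.
have tpos : 0 < t.
  (* At small levels the component of 0 lies in a disk that contains neither [a] nor [b], which are
     nonzero because [3 a b] is. *)
  rewrite lt_def t0 andbT; apply/eqP => tE.
  pose e := Num.min (cabs a) (cabs b).
  have e0 : 0 < e by rewrite lt_min !cabs_gt0 a0.
  have [e1 /andP[e10 e1e] [eta eta0 circ]] := lens_data g1 0 e0.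
  have [ea eb] : e1 <= cabs a /\ e1 <= cabs b.
    by split; apply: le_trans e1e _; rewrite ge_min lexx ?orbT.
  pose r := Num.min eta r0.
  have r0' : 0 < r by rewrite lt_min eta0.
  have sub : lit f N r `<=` cdisk 0 e1.
    apply: connected_sub_open; [exact: lit_connected|exact: open_cdisk| |].
      exists 0; split; first exact: lit0.
      by have : cabs (0 - 0 : C) < e1 by rewrite subrr cabs0.
    move=> x /lit_lt xr /closureC_P cx; rewrite /cdisk /= ltNge; apply/negP => ex.
    have xe : cabs (x - 0) <= e1.
      rewrite leNgt; apply/negP => xe.
      have [y + yx] := cx (cabs (x - 0) - e1) ltac:(lra).
      by rewrite /cdisk /=; have := cabs_triangle y x 0; rewrite (cabs_sub x y); lra.
    have := circ x (le_anti (introT andP (conj xe ex))).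
    rewrite pit0// subr0 leNgt => /negP; apply; apply: lt_le_trans xr _.
    by rewrite ge_min lexx.
  have rr : r <= r0 by rewrite ge_min lexx orbT.
  have [|/sub|/sub] := above r _ rr; first by rewrite tE.
    by rewrite /cdisk /= subr0 ltNge ea.
  by rewrite /cdisk /= subr0 ltNge eb.
have lev w : closure (lit f N t) w -> ~ lit f N t w -> cabs g.[w] = t.
  move=> cw nw; apply: le_anti; rewrite (lemn_closure_le cw) leNgt.
  by apply/negP => h; apply: nw; exact: lemn_closure.
have [ca|nca] := pselect (closure (lit f N t) a).
  left; have E := lev a ca nta; split; rewrite E; [|exact: nta|exact: ntb|exact: ca].
  apply/andP; split; [exact: tpos|exact: tr].
have [cb|ncb] := pselect (closure (lit f N t) b).
  right; have E := lev b cb ntb; split; rewrite E; [|exact: nta|exact: ntb|exact: cb].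
  apply/andP; split; [exact: tpos|exact: tr].
exfalso.
have [|r1 tr1 r1P] := @lemn_grow _ g g1 t (lit f N t) 0 tpos
    (@lemn_saturated _ _ _ _) _ (lit0 f0 N tpos).
  move=> x cx gx; case: (lit_crit_closure tpos (ltW tr) cx gx) => [/nca|/ncb]; case.
have {r1P} out w : w = a \/ w = b -> exists2 r2, t < r2 <= r0 & ~ lit f N r2 w.
  move=> wab; have [wt|tw] := leP (cabs g.[w]) t.
    exists (Num.min r1 r0); first by rewrite lt_min tr1 tr ge_min lexx orbT.
    move=> /(lit_mono_r (r' := r1)) h; have := r1P w (h _) wt; rewrite ge_min lexx => /(_ isT).
    case: wab => [->|->]; [exact: nca|exact: ncb].
  exists (Num.min (cabs g.[w]) r0); first by rewrite lt_min tw tr ge_min lexx orbT.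
  by move=> /lit_lt; rewrite lt_min ltxx.
have [ra /andP[tra ra0] na] := out a (or_introl erefl).
have [rb /andP[trb rb0] nb] := out b (or_intror erefl).
have [||h|h] := above (Num.min ra rb).
- by rewrite lt_min tra.
- by rewrite ge_min ra0.
- by apply: na; apply: lit_mono_r h; rewrite ge_min lexx.
- by apply: nb; apply: lit_mono_r h; rewrite ge_min lexx orbT.
Qed.

Section EarlyA.
Hypothesis ea : early a.
Local Notation r := (cabs g.[a]).

Let r00 : 0 < r. Proof. by case: ea => /andP[]. Qed.
Let rr : r <= r0. Proof. by case: ea => /andP[_ /ltW]. Qed.
Let nc : nocrit g r. Proof. by case: ea => _ na nb _; exact: lit_nocrit. Qed.

Lemma early_lit_a M : (N < M)%N -> lit f M r a.
Proof.
move=> NM; apply: (lit_mono theta01 fcontract rr NM).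
by apply: (closure_lit theta01 fcontract r00 rr); case: ea.
Qed.

Lemma early_inj x y : lit f N r x -> lit f N r y -> g.[x] = g.[y] -> x = y.
Proof. by move=> hx hy; apply: (lemn_nocrit_inj g1 _ hx hy) => c /nc. Qed.

(** From level [N + 1] until [b] enters, [a] is the only critical point of [f] in the component: the
    degree is at most 2 by [lit_degree_le] and at least 2 since [a] is a double preimage of [f(a)].
    Equality in Riemann-Hurwitz at one level feeds the next, so both claims go through one
    induction. *)
Lemma early_count k : ~ lit f (N + k) r b ->
  nroots (pit f (N + k)) (lit f (N + k) r) =
    (nroots (pit f (N + k))^`() (lit f (N + k) r)).+1 /\
  ((0 < k)%N -> nroots f (lit f (N + k) r) = 2%N).
Proof.
elim: k => [|k IH] nb.
  rewrite addn0; split=> //.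
  have k0 : nroots g^`() (lit f N r) = 0%N.
    apply/eqP; rewrite -leqn0 leqNgt; apply/negP.
    by move=> /(nroots_gt0 _ (deriv_neq0 g1))[x /nc].
  apply/eqP; rewrite eqn_leq critical_count// k0.
  apply/(nroots_gt0 _ (poly_neq0 g1)); exists 0; first exact: lit0.
  by rewrite rootE pit0.
have [|E1 _] := IH.
  by move=> h; apply: nb; apply: (lit_mono theta01 fcontract rr _ h); rewrite leq_add2l.
rewrite addnS in nb *.
have ha : lit f (N + k).+1 r a by apply: early_lit_a; rewrite ltnS leq_addr.
have e2 : nroots f (lit f (N + k).+1 r) = 2%N.
  apply/eqP; rewrite eqn_leq; apply/andP; split.
    apply: leq_trans (lit_degree_le f1 f0 E1) _.
    by rewrite nroots_deriv_cub asboolT// asboolF.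
  have hfa : lit f (N + k) r f.[a] by exact: lit_imageS.
  by rewrite -(lit_fcount f1 f0 hfa); exact: cub_crit_double.
split=> //; rewrite lit_count// lit_count_crit// e2 E1 nroots_deriv_cub.
by rewrite asboolT// asboolF//; lia.
Qed.

Lemma early_count2 M v : (N <= M)%N -> ~ lit f M.+1 r b -> lit f M r v ->
  nroots (f - v%:P) (lit f M.+1 r) = 2%N.
Proof.
move=> NM nb hv; rewrite lit_fcount//.
have := @early_count (M.+1 - N)%N; rewrite subnKC ?leqW// => /(_ nb)[_ ->//].
by rewrite subn_gt0.
Qed.

(** [f^N] is injective on [lit f N r], so [f(y) = f(a)]; the two preimages of [f(a)] in
    [lit f N.+1 r] are [a] counted twice. *)
Lemma early_double_unique y : ~ lit f N.+1 r b -> lit f N.+1 r y ->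
  (pit f N.+1).[y] = (pit f N.+1).[a] -> y = a.
Proof.
move=> nb hy; rewrite !pitS => E.
have ha := early_lit_a (ltnSn N).
have {}E : f.[y] = f.[a] by apply: early_inj => //; exact: lit_imageS.
apply: contrapT => ya.
have := early_count2 (leqnn N) nb (lit_imageS f0 ha).
have f2 := @nroots_disj _ (f - f.[a]%:P) [set a] [set y] (lit f N.+1 r).
have d1 := cub_crit_double b (erefl a : [set a] a).
have d2 : (0 < nroots (f - f.[a]%:P) [set y])%N.
  by apply/(nroots_gt0 _ (subC_neq0 _ f1)); exists y => //; rewrite rootBC E.
have : (nroots (f - f.[a]%:P) [set a] + nroots (f - f.[a]%:P) [set y] <=
  nroots (f - f.[a]%:P) (lit f N.+1 r))%N.
  by apply: f2; [apply/seteqP; split=> // u [-> /= au]; apply: ya|move=> u ->|move=> u ->].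
by move=> + E2; rewrite E2 => h; have := leq_trans (leq_add d1 d2) h.
Qed.

Lemma early_eq : lit f N.+1 r b -> (pit f N.+1).[b] = (pit f N.+1).[a] -> a = b.
Proof.
move=> hb; rewrite !pitS => E; apply: cub_val_inj; apply/esym.
by apply: early_inj => //; apply: lit_imageS => //; exact: early_lit_a.
Qed.

(** [f] has degree 2 on both [lit f M.+1 r] and [lit f M.+2 r]: the preimages of [f(x)] are already
    in the smaller set. *)
Lemma early_pullback M x : (N <= M)%N -> ~ lit f M.+2 r b -> lit f M.+2 r x ->
  lit f M r f.[x] -> lit f M.+1 r x.
Proof.
move=> NM nb hx hfx; apply: contrapT => nx.
have nb' : ~ lit f M.+1 r b by move=> h; apply: nb; apply: (lit_mono theta01 fcontract rr _ h).
have c1 := early_count2 NM nb' hfx.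
have c2 := early_count2 (leqW NM) nb (lit_imageS f0 hx).
have d : (0 < nroots (f - f.[x]%:P) [set x])%N.
  by apply/(nroots_gt0 _ (subC_neq0 _ f1)); exists x => //; rewrite rootBC.
have : (nroots (f - f.[x]%:P) (lit f M.+1 r) + nroots (f - f.[x]%:P) [set x] <=
  nroots (f - f.[x]%:P) (lit f M.+2 r))%N.
  apply: nroots_disj.
  - by apply/seteqP; split=> // u [+ /= ux]; rewrite ux => /nx.
  - exact: (lit_mono theta01 fcontract rr (leqnSn _)).
  - by move=> u ->.
by rewrite c1 c2; move: d; case: nroots.
Qed.

(** Otherwise [f(b)] would have two preimages in [lit f M.+1 r] and the double preimage [b] outside,
    four in all for a cubic. *)
Lemma early_pullback_crit M : (N <= M)%N -> lit f M r f.[b] -> lit f M.+1 r b.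
Proof.
move=> NM hfb; apply: contrapT => nb.
have c1 := early_count2 NM nb hfb.
have d := cub_crit_double a (erefl b : [set b] b); rewrite cubC in d.
have : (nroots (f - f.[b]%:P) (lit f M.+1 r) + nroots (f - f.[b]%:P) [set b] <=
  nroots (f - f.[b]%:P) setT)%N.
  by apply: nroots_disj => //; apply/seteqP; split=> // u [+ /= ux]; rewrite ux => /nb.
rewrite c1 nrootsT ?subC_neq0// size_subC// size_fpoly => h.
by have := leq_trans (leq_add (leqnn 2) d) h.
Qed.

(** The first membership alone puts [f^(j+1)(b)] in level [N + 1]; being one level lower is pulled
    back step by step along the orbit of [b], by [early_pullback] and finally by
    [early_pullback_crit]. *)
Lemma early_entry M j : (N + j.+1 = M)%N -> lit f M.+1 r b -> lit f N r (pit f j.+1).[b] ->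
  lit f M r b.
Proof.
move=> NjM hb hj; apply: contrapT => nb.
have key i : (i <= j)%N -> lit f (N + i) r (pit f (j.+1 - i)).[b].
  elim: i => [_|i IH ij]; first by rewrite addn0 subn0.
  have h := IH (ltnW ij); rewrite addnS.
  apply: early_pullback; first exact: leq_addr.
  - move=> h'; apply: nb; apply: (lit_mono theta01 fcontract rr _ h'); lia.
  - by apply: lit_image => //; rewrite (_ : ((N + i).+2 + _)%N = M.+1)//; lia.
  - by rewrite -pitSr (_ : (j.+1 - i.+1).+1 = (j.+1 - i)%N)//; lia.
have := key j (leqnn j); rewrite subSn// subnn pitSr hornerX => h.
apply: nb; rewrite -NjM addnS; apply: early_pullback_crit => //; exact: leq_addr.
Qed.

(** Critical points of [f^m] in [lit f m r] are of three sorts: those mapped to [a], with value at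
    most [theta r]; [b] itself; and those that reach [b] after at least one iterate, which would put
    [b] in [lit f m.-1 r]. So [lemn_interval] applies. *)
Lemma early_interval m r' : (N < m)%N -> lit f m r b -> ~ lit f m.-1 r b ->
  theta * r < r' -> cabs (pit f m).[b] < r' -> lit f m r' b.
Proof.
move=> Nm hb nb tr' br'.
have r'0 : 0 < r' by apply: le_lt_trans br'; exact: cabs_ge0.
apply: (lemn_interval (size_pit f1 m) r'0 _ _ hb br'); last by rewrite pit0// cabs0.
move=> x hx /(lit_crit f0 rr hx)[i [im /cub_crit[E|E] hi]]; rewrite E in hi.
  have Ni : (N < m - i)%N.
    rewrite ltnNge; apply/negP => /(lit_mono theta01 fcontract rr)/(_ _ hi).
    by case: ea.
  have -> : m = (((m - i - N).-1.+1 + N) + i)%N by lia.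
  rewrite pitD E pitD; apply: le_lt_trans tr'.
  by apply: (pit_ltS theta01 fcontract).
case: i im E hi => [|i] im E hi.
  by move: E; rewrite hornerX => ->.
exfalso; apply: nb; apply: (lit_mono theta01 fcontract rr _ hi); lia.
Qed.

End EarlyA.

(** Near [a] and near [b] the component contains points with the same value [(1 - t) f^N(a)];
    injectivity identifies them, although they are closer than half of [|a - b|] to [a] and to [b]
    respectively. *)
Lemma early_same : early a -> early b -> g.[a] = g.[b] -> a = b.
Proof.
move=> ea eb gab; apply: contrapT => /eqP ab.
have [/andP[r00 rr'] na nb ca] := ea; have rr := ltW rr'.
have [_ _ _] := eb; rewrite -gab => cb.
set r := cabs g.[a] in r00 rr na nb ca cb.
have d0 : 0 < cabs (a - b) / 2 by rewrite divr_gt0// cabs_gt0 subr_eq0.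
have [eta1 eta10 n1] := lens_reach g1 r00 ca d0.
have [eta2 eta20 n2] : exists2 eta : R, 0 < eta & forall t, 0 < t <= 1 -> t * r < eta ->
    exists y, [/\ cabs (y - b) < cabs (a - b) / 2, lit f N r y & g.[y] = (1 - t)%:C%C * g.[a]].
  rewrite /r gab; apply: (lens_reach g1); 
    [rewrite -gab; exact: r00|rewrite -gab; exact: cb|exact: d0].
have m0 : 0 < Num.min eta1 eta2 / (2 * r).
  by rewrite divr_gt0 ?lt_min ?eta10// mulr_gt0.
have [t [t0 t1]] := exists_below2 (ltr01 : 0 < 1 :> R) m0.
rewrite ler_pdivlMr ?mulr_gt0// le_min => /andP[tr1 tr2].
have tr0 : 0 < t * r by rewrite mulr_gt0.
have t01 : 0 < t <= 1 by rewrite t0.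
have [|y1 [y1a h1 E1]] := n1 t t01; first by rewrite -/r; lra.
have [|y2 [y2b h2 E2]] := n2 t t01; first lra.
have y12 : y1 = y2 by apply: (early_inj ea) => //; rewrite E1 E2.
have := cabs_triangle y1 a b; rewrite (cabs_sub a y1); rewrite -y12 in y2b; lra.
Qed.

End Early.

(** * Calculus of convergence along a filter *)

Section PointConvergence.
Variable R : realType.
Local Notation C := (Cplx R).
Variables (I : Type) (F : set_system I).
Context {FF : Filter F}.

Lemma ptconvP (x : I -> C) (x0 : C) : ptconv F x x0 <-> (x @ F --> x0).
Proof. by rewrite cvgC_P. Qed.

Lemma ptconv_cst (c : C) : ptconv F (fun=> c) c.
Proof. by move=> e e0; apply: nearW => i /=; rewrite subrr cabs0. Qed.

Lemma ptconvD (x y : I -> C) (x0 y0 : C) : ptconv F x x0 -> ptconv F y y0 ->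
  ptconv F (fun i => x i + y i) (x0 + y0).
Proof.
move=> xx yy e e0; have e20 : 0 < e / 2 by lra.
apply: filterS2 (xx _ e20) (yy _ e20) => i /= h1 h2.
rewrite opprD addrACA; apply: le_lt_trans (cabsD _ _) _; lra.
Qed.

Lemma ptconvM (x y : I -> C) (x0 y0 : C) : ptconv F x x0 -> ptconv F y y0 ->
  ptconv F (fun i => x i * y i) (x0 * y0).
Proof.
move=> xx yy e e0; have a0 := cabs_ge0 x0; have b0 := cabs_ge0 y0.
have [m mE] : exists m, m = 1 + cabs x0 + cabs y0 by eexists.
have m0 : 0 < m by lra.
have [d dE] : exists d, d = Num.min 1 (e / (2 * m)) by eexists.
have d0 : 0 < d by rewrite dE lt_min ltr01 divr_gt0// mulr_gt0.
have d1 : d <= 1 by rewrite dE ge_min lexx.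
have dm : d * m <= e / 2.
  have : d <= e / (2 * m) by rewrite dE ge_min lexx orbT.
  by rewrite ler_pdivlMr ?mulr_gt0//; lra.
apply: filterS2 (xx _ d0) (yy _ d0) => i /= h1 h2.
have -> : x i * y i - x0 * y0 = (x i - x0) * (y i - y0) + (x i - x0) * y0 + x0 * (y i - y0).
  by ring.
have c1 := cabs_ge0 (x i - x0); have c2 := cabs_ge0 (y i - y0).
apply: le_lt_trans (cabsD _ _) _; rewrite (cabsM x0).
have := cabsD ((x i - x0) * (y i - y0)) ((x i - x0) * y0); rewrite !cabsM; nra.
Qed.

Lemma ptconvN (x : I -> C) (x0 : C) : ptconv F x x0 -> ptconv F (fun i => - x i) (- x0).
Proof. by move=> /ptconvP xx; apply/ptconvP; apply: cvgN. Qed.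

Lemma ptconvX (x : I -> C) (x0 : C) n : ptconv F x x0 -> ptconv F (fun i => x i ^+ n) (x0 ^+ n).
Proof.
move=> xx; elim: n => [|n IH]; first exact: ptconv_cst.
by rewrite exprS; under [X in ptconv _ X]eq_fun do rewrite exprS; exact: ptconvM.
Qed.

Lemma ptconvV (x : I -> C) (x0 : C) : x0 != 0 -> ptconv F x x0 ->
  ptconv F (fun i => (x i)^-1) x0^-1.
Proof. by move=> x00 /ptconvP xx; apply/ptconvP; apply: cvgV. Qed.

Lemma ptconv_horner (q : {poly C}) (x : I -> C) (x0 : C) : ptconv F x x0 ->
  ptconv F (fun i => q.[x i]) q.[x0].
Proof.
move=> xx e e0; have [d d0 dq] := poly_cont q x0 e0.
by apply: filterS (xx d d0) => i /= /dq.
Qed.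

(** The product of [F] with the neighbourhoods of [z]; it turns [luconv] into an ordinary limit in
    two variables. *)
Definition jnear (z : C) : set_system (I * C) := [set P | exists2 d : R, 0 < d &
  F [set i | forall y : C, cabs (y - z) < d -> P (i, y)]].

Global Instance jnear_filter z : Filter (jnear z).
Proof.
split=> [|P Q [d d0 HP] [e e0 HQ]|P Q PQ [d d0 HP]].
- by exists 1 => //; apply: nearW.
- exists (Num.min d e); first by rewrite lt_min d0.
  apply: filterS2 HP HQ => i /= hP hQ y; rewrite lt_min => /andP[yd ye].
  by split; [exact: hP|exact: hQ].
- by exists d => //; apply: filterS HP => i /= h y /h; exact: PQ.
Qed.

Lemma ptconv_fst (x : I -> C) (x0 z : C) : ptconv F x x0 -> ptconv (jnear z) (fun iy => x iy.1) x0.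
Proof. by move=> xx e e0; exists 1 => //; apply: filterS (xx e e0) => i /= h y _. Qed.

Lemma ptconv_snd z : ptconv (jnear z) (fun iy => iy.2) z.
Proof. by move=> e e0; exists e => //; apply: nearW => i y. Qed.

Lemma luconvP (G : I -> {poly C}) g : luconv F G g <->
  forall z, ptconv (jnear z) (fun iy => (G iy.1).[iy.2]) g.[z].
Proof. by []. Qed.

End PointConvergence.

(** * Laurent polynomials: open mapping, maximum principle, Rouche's theorem *)

Section Laurent.
Variable R : realType.
Local Notation C := (Cplx R).
Implicit Types (p q z w : C) (h u v : C -> C) (A : set C).

Definition pnear p : set_system C := [set P | exists2 d : R, 0 < d &
  forall q, cabs (q - p) < d -> P q].

Global Instance pnear_filter p : Filter (pnear p).
Proof.
split=> [|P Q [d d0 HP] [e e0 HQ]|P Q PQ [d d0 HP]].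
- by exists 1.
- exists (Num.min d e); first by rewrite lt_min d0.
  by move=> q; rewrite lt_min => /andP[qd qe]; split; [exact: HP|exact: HQ].
- by exists d => // q /HP; exact: PQ.
Qed.

Lemma ptconv_id p : ptconv (pnear p) id p. Proof. by move=> e e0; exists e. Qed.

Lemma pnear_neq0 p : p != 0 -> pnear p [set q | q != 0].
Proof.
move=> p0; exists (cabs p); first by rewrite cabs_gt0.
by move=> q qp /=; apply: contraTneq qp => ->; rewrite sub0r cabsN ltxx.
Qed.

(** The value at 0 is left free, since the parametrisation of a slice by a critical point [p]
    excludes [p = 0]. *)
Definition laurent h := exists (n : {poly C}) k, forall p, p != 0 -> h p * p ^+ k = n.[p].

Lemma laurent_cst (c : C) : laurent (fun=> c).
Proof. by exists c%:P, 0%N => p _; rewrite hornerC mulr1. Qed.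

Lemma laurent_id : laurent id.
Proof. by exists 'X, 0%N => p _; rewrite hornerX mulr1. Qed.

Lemma laurent_inv (c : C) : laurent (fun p => c / p).
Proof. by exists c%:P, 1%N => p p0; rewrite hornerC expr1 mulfVK. Qed.

Lemma laurentM u v : laurent u -> laurent v -> laurent (fun p => u p * v p).
Proof.
move=> [n [k H]] [n' [k' H']]; exists (n * n'), (k + k')%N => p p0.
by rewrite hornerM -H// -H'// exprD mulrACA.
Qed.

Lemma laurentD u v : laurent u -> laurent v -> laurent (fun p => u p + v p).
Proof.
move=> [n [k H]] [n' [k' H']]; exists (n * 'X^k' + n' * 'X^k), (k + k')%N => p p0.
by rewrite hornerD !hornerM !hornerXn -H// -H'// exprD; ring.
Qed.

Lemma laurentN u : laurent u -> laurent (fun p => - u p).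
Proof. by move=> [n [k H]]; exists (- n), k => p p0; rewrite hornerN -H// mulNr. Qed.

Lemma laurentB u v : laurent u -> laurent v -> laurent (fun p => u p - v p).
Proof. by move=> lu lv; apply: laurentD => //; exact: laurentN. Qed.

Lemma laurentX u n : laurent u -> laurent (fun p => u p ^+ n).
Proof.
move=> lu; elim: n => [|n IH]; first exact: laurent_cst.
have -> : (fun p => u p ^+ n.+1) = (fun p => u p * u p ^+ n).
  by apply: funext => p; rewrite exprS.
exact: laurentM.
Qed.

Lemma laurent_cont h p : laurent h -> p != 0 -> ptconv (pnear p) h (h p).
Proof.
move=> [n [k H]] p0.
have E q : q != 0 -> h q = n.[q] * (q^-1) ^+ k.
  by move=> q0; rewrite -H// -mulrA -exprMn mulfV// expr1n mulr1.
have H' : ptconv (pnear p) (fun q => n.[q] * (q^-1) ^+ k) (h p).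
  rewrite E//; apply: ptconvM; first by apply: ptconv_horner; exact: ptconv_id.
  by apply: ptconvX; apply: ptconvV => //; exact: ptconv_id.
move=> e e0; have [d1 d10 H1] := H' e e0; have [d2 d20 H2] := pnear_neq0 p0.
exists (Num.min d1 d2); first by rewrite lt_min d10.
by move=> q; rewrite lt_min => /andP[/H1 /= + /H2 /= q0]; rewrite -E.
Qed.

(** With denominators cleared, [u = c v] says that [N1 - c N2] vanishes. Near [c = u(p) / v(p)] this
    polynomial is small at [p] and, unless it is identically 0 for that value, not small at a nearby
    point [p']; [poly_harnack] yields a root near [p]. *)
Lemma laurent_open u v p (e : R) : laurent u -> laurent v -> p != 0 -> v p != 0 -> 0 < e ->
  (forall q, q != 0 -> u q * v p = u p * v q) \/
  exists2 d : R, 0 < d & forall c, cabs (c - u p / v p) < d ->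
    exists q, [/\ cabs (q - p) < e, q != 0 & u q = c * v q].
Proof.
move=> [n1 [k1 H1]] [n2 [k2 H2]] p0 vp e0.
have [N1 E1] : exists N1 : {poly C}, forall q, q != 0 -> u q * q ^+ (k1 + k2) = N1.[q].
  by exists (n1 * 'X^k2) => q q0; rewrite hornerM hornerXn -H1// exprD; ring.
have [N2 E2] : exists N2 : {poly C}, forall q, q != 0 -> v q * q ^+ (k1 + k2) = N2.[q].
  by exists (n2 * 'X^k1) => q q0; rewrite hornerM hornerXn -H2// exprD; ring.
have [ka kaE] : exists ka, ka = u p / v p by eexists.
have [P0|P0] := eqVneq (N1 - ka *: N2) 0.
  left=> q q0; have qk : q ^+ (k1 + k2) != 0 by rewrite expf_neq0.
  have := congr1 (fun P => P.[q]) P0.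
  rewrite !(hornerD, hornerN, hornerZ, horner0) -E1// -E2// mulrA -mulrBl => /eqP.
  rewrite mulf_eq0 (negbTE qk) orbF subr_eq0 kaE => /eqP ->.
  by rewrite mulrAC divfK.
right; set P := N1 - _ in P0.
have [e2 e20 iso] := isolate_root p P0.
(* The cap [|p|] keeps the root away from 0. *)
have [e1 e1E] : exists e1, e1 = Num.min e (cabs p) by eexists.
have e10 : 0 < e1 by rewrite e1E lt_min e0 cabs_gt0.
pose p' := p + (e2 / 2)%:C%C.
have pp' : cabs (p' - p) = e2 / 2.
  by rewrite /p' addrAC subrr add0r cabs_real gtr0_norm//; lra.
have Pp' : P.[p'] != 0.
  apply/negP => /iso/(_ ltac:(rewrite pp'; lra)) E.
  by move: pp'; rewrite E subrr cabs0; lra.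
pose D := maxn (size N1) (size N2).
have [B BE] : exists B : R, B = (1 + cabs (p' - p) / e1) ^+ D by eexists.
have b1 : 1 <= 1 + cabs (p' - p) / e1.
  by rewrite lerDl divr_ge0 ?cabs_ge0// ltW.
have B1 : 1 <= B by rewrite BE exprn_ege1.
have m10 := cabs_ge0 N2.[p]; have m20 := cabs_ge0 N2.[p'].
have [m mE] : exists m : R, m = cabs N2.[p] * B + cabs N2.[p'] + 1 by eexists.
have m0 : 0 < m.
  rewrite mE; have : 0 <= cabs N2.[p] * B by apply: mulr_ge0 => //; lra.
  lra.
exists (cabs P.[p'] / m); first by rewrite divr_gt0// cabs_gt0.
move=> c; rewrite -kaE ltr_pdivlMr// => cm; apply: contrapT => noq.
pose Q := N1 - c *: N2.
have QE q : Q.[q] = P.[q] - (c - ka) * N2.[q].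
  by rewrite /Q /P !(hornerD, hornerN, hornerZ); ring.
have Qroot x : root Q x -> e1 <= cabs (x - p).
  move=> Qx; rewrite leNgt; apply/negP => xe; apply: noq; exists x.
  move: xe; rewrite e1E lt_min => /andP[xe xp].
  have x0 : x != 0 by apply: contraTneq xp => ->; rewrite sub0r cabsN ltxx.
  split=> //; have xk : x ^+ (k1 + k2) != 0 by rewrite expf_neq0.
  apply: (mulIf xk); rewrite E1// -mulrA E2//; apply/eqP; rewrite -subr_eq0.
  by move: Qx; rewrite rootE /Q !(hornerD, hornerN, hornerZ).
have := poly_harnack p' e10 Qroot.
have Pp : P.[p] = 0.
  by rewrite /P !(hornerD, hornerN, hornerZ) -E1// -E2// kaE mulrA divfK// subrr.
rewrite !QE Pp sub0r cabsN cabsM.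
have szQ : (1 + cabs (p' - p) / e1) ^+ (size Q).-1 <= B.
  rewrite BE ler_weXn2l//; apply: leq_trans (leq_pred _) _.
  apply: leq_trans (size_polyD _ _) _; rewrite geq_max leq_maxl /= size_polyN.
  by apply: leq_trans (size_scale_leq _ _) _; exact: leq_maxr.
set X := _ ^+ _ in szQ *.
have t0 := cabs_ge0 (c - ka).
have h1 : cabs (c - ka) * cabs N2.[p] * X <= cabs (c - ka) * (cabs N2.[p] * B).
  by rewrite -mulrA ler_wpM2l// ler_wpM2l.
have := cabsB_ge P.[p'] ((c - ka) * N2.[p']); rewrite cabsM => h2 h3.
by move: cm; rewrite mE mulrDr mulr1 mulrDr; lra.
Qed.

Lemma boundary_exists A (B : R) : open A -> A !=set0 -> (forall x, A x -> cabs x <= B) ->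
  exists2 x, closure A x & ~ A x.
Proof.
move=> oA [x0 Ax0] AB; apply: contrapT => no.
have AT : [set: C] `<=` A.
  apply: connected_sub_open => //.
  - by apply: convex_connected.
  - by exists x0.
  - by move=> x _ cx; apply: contrapT => nA; apply: no; exists x.
have := AB _ (AT (`|B| + 1)%:C%C I).
rewrite cabs_real ger0_norm; last by have := normr_ge0 B; lra.
by have := ler_norm B; lra.
Qed.

Section MaxPrinciple.
Variables (A : set C) (B : R).
Hypotheses (oA : open A) (AB : forall x, A x -> cabs x <= B).
Hypothesis neq0 : forall x, closure A x -> x != 0.

Lemma closure_bounded x : closure A x -> cabs x <= B.
Proof.
move=> /closureC_P cx; rewrite leNgt; apply/negP => Bx.
have [y Ay yx] := cx (cabs x - B) ltac:(lra).
by have := AB Ay; have := cabsB_ge x y; rewrite (cabs_sub x); lra.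
Qed.

(** Consider a maximum of [|u / v|] over the closure. At an interior point the quotient is either
    constant, and then compared at a boundary point, or open, so that it takes a slightly larger
    multiple of its value nearby. *)
Lemma laurent_max u v : laurent u -> laurent v -> (forall x, closure A x -> v x != 0) ->
  (forall x, closure A x -> A x \/ cabs (u x) <= cabs (v x)) ->
  forall x, A x -> cabs (u x) <= cabs (v x).
Proof.
move=> lu lv v0 H x Ax.
have cA : compact (closure A).
  by apply: (@bounded_closed_compactC _ _ B); [exact: closed_closure|exact: closure_bounded].
pose phi z := cabs (u z / v z).
have le1 z : closure A z -> (phi z <= 1) = (cabs (u z) <= cabs (v z)).
  by move=> cz; rewrite /phi cabsM cabsV ler_pdivrMr ?mul1r// cabs_gt0 v0.
have [||y cy ymax] := @compact_max R (closure A) phi cA.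
- by exists x; exact: subset_closure.
- move=> y cy e e0; have y0 := neq0 cy.
  have [d d0 dP] := ptconvM (laurent_cont lu y0) (ptconvV (v0 y cy) (laurent_cont lv y0)) e0.
  exists d => // z _ /dP /= h; rewrite /phi.
  by have := cabsB_ge (u z / v z) (u y / v y); lra.
suff : phi y <= 1 by move=> h; rewrite -le1;
  [exact: le_trans (ymax x (subset_closure Ax)) h|exact: subset_closure].
have [Ay|uvy] := H y cy; last by rewrite le1.
have y0 := neq0 cy.
have /openC_P/(_ y Ay)[e e0 eA] := oA.
have [cst|[d d0 dP]] := laurent_open lu lv y0 (v0 y cy) e0.
  have [z cz nz] := boundary_exists oA (ex_intro _ x Ax) AB.
  have := cst z (neq0 cz) => /(congr1 (@cabs R)); rewrite !cabsM => E.
  have vz : 0 < cabs (v z) by rewrite cabs_gt0 v0.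
  rewrite le1// -(ler_pM2r vz) -E mulrC ler_wpM2l ?cabs_ge0//.
  by case: (H z cz).
have [u0|u0] := eqVneq (u y) 0.
  by rewrite /phi u0 mul0r cabs0.
exfalso; pose k := u y / v y.
have k0 : 0 < cabs k by rewrite cabs_gt0 mulf_neq0// invr_eq0 v0.
pose t := d / (2 * cabs k).
have t0 : 0 < t by rewrite divr_gt0// mulr_gt0.
have tk : t * cabs k = d / 2 by rewrite /t invfM mulrA mulfVK//; apply: lt0r_neq0.
have [|z [zy z0 uz]] := dP ((1 + t)%:C%C * k).
  rewrite rmorphD rmorph1 mulrDl mul1r addrAC subrr add0r cabsM cabs_real gtr0_norm// tk; lra.
have cz := subset_closure (eA z zy).
have := ymax z cz; rewrite /phi uz mulfK ?v0// (cabsM (1 + t)%:C%C) cabs_real gtr0_norm; last lra.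
by rewrite -/k; nra.
Qed.

(** With [z = t eta w] and [|eta| <= 1], this is the bound 1 for the Blaschke factor
    [(eta - t) / (1 - t eta)]. *)
Lemma cabs_rouche (t : R) (z w : C) : 0 <= t -> t <= 1 -> cabs z <= t * cabs w ->
  cabs (z - (t ^+ 2)%:C%C * w) <= t * cabs (w - z).
Proof.
move=> t0 t1 zw.
have sq (x : C) : cabs x ^+ 2 = complex.Re x ^+ 2 + complex.Im x ^+ 2.
  by case: x => x y; rewrite /cabs /= sqr_sqrtr// addr_ge0// sqr_ge0.
rewrite -(@ler_pXn2r _ 2) ?nnegrE ?mulr_ge0 ?cabs_ge0//.
have : cabs z ^+ 2 <= (t * cabs w) ^+ 2.
  by rewrite ler_pXn2r ?nnegrE ?mulr_ge0 ?cabs_ge0.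
rewrite !exprMn !sq {zw}; case: z w => [a b] [c d] /=.
rewrite !mul0r subr0 addr0 => H.
rewrite -subr_ge0.
have -> : t ^+ 2 * ((c - a) ^+ 2 + (d - b) ^+ 2) - ((a - t ^+ 2 * c) ^+ 2 + (b - t ^+ 2 * d) ^+ 2) =
  (1 - t ^+ 2) * (t ^+ 2 * (c ^+ 2 + d ^+ 2) - (a ^+ 2 + b ^+ 2)) by ring.
by apply: mulr_ge0; rewrite subr_ge0// exprn_ile1.
Qed.

(** If [u] and [v] never agreed on [A], the maximum principle would apply to
    [(v - s^2 u) / (s (u - v))], of modulus at most 1 on the boundary by [cabs_rouche]; but at a
    zero of [u] its modulus is [1 / s > 1]. *)
Lemma laurent_rouche u v (t : R) : laurent u -> laurent v -> t < 1 ->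
  (forall x, closure A x -> A x \/ (u x != 0 /\ cabs (v x) <= t * cabs (u x))) ->
  (exists2 x, A x & u x = 0) -> exists2 x, A x & u x = v x.
Proof.
move=> lu lv t1 H [x0 Ax0 ux0]; apply: contrapT => no.
(* [t] is raised to at least 1/2 so that [s] can serve as a denominator. *)
have [s sE] : exists s, s = Num.max t (1 / 2) by eexists.
have s0 : 1 / 2 <= s by rewrite sE le_max lexx orbT.
have s1 : s < 1 by rewrite sE gt_max t1; lra.
have ts : t <= s by rewrite sE le_max lexx.
have Hs x : closure A x -> A x \/ (u x != 0 /\ cabs (v x) <= s * cabs (u x)).
  case/H => [Ax|[ux h]]; [by left|right]; split=> //; apply: le_trans h _.
  by rewrite ler_wpM2r// cabs_ge0.
have sC : s%:C%C != 0 :> C.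
  by rewrite -cabs_gt0 cabs_real gtr0_norm; lra.
have := @laurent_max (fun x => v x - (s ^+ 2)%:C%C * u x) (fun x => s%:C%C * (u x - v x)).
move=> /(_ _ _ _ _ x0 Ax0); rewrite ux0 mulr0 subr0 sub0r cabsM cabsN cabs_real gtr0_norm; last lra.
have vx0 : 0 < cabs (v x0).
  rewrite cabs_gt0; apply/negP => /eqP vx0; apply: no; exists x0 => //; by rewrite ux0 vx0.
move=> K; have : cabs (v x0) <= s * cabs (v x0); last by nra.
apply: K.
- apply: laurentB => //; apply: laurentM => //; exact: laurent_cst.
- apply: laurentM; [exact: laurent_cst|exact: laurentB].
- move=> x cx; rewrite mulf_neq0// subr_eq0; apply/eqP => uv.
  have [Ax|[ux]] := Hs x cx; first by apply: no; exists x.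
  rewrite -uv.
  have : 0 < cabs (u x) by rewrite cabs_gt0.
  nra.
- move=> x cx; have [Ax|[ux h]] := Hs x cx; [by left|right].
  rewrite cabsM cabs_real gtr0_norm; last lra.
  by apply: cabs_rouche => //; lra.
Qed.

End MaxPrinciple.

End Laurent.

(** * Contraction near 0 and escape near infinity *)

Section Bounds.
Variable R : realType.
Local Notation C := (Cplx R).
Implicit Types (mu c a b z : C) (K r : R).

Lemma fpoly_contract mu c K r z : cabs c <= K -> r <= 1 -> r * (K + 1) <= (1 - cabs mu) / 2 ->
  cabs z <= r -> cabs (fpoly mu c).[z] <= (1 + cabs mu) / 2 * cabs z.
Proof.
move=> cK r1 rK zr; have z0 := cabs_ge0 z; have c0 := cabs_ge0 c.
have -> : (fpoly mu c).[z] = (mu + c * z + z ^+ 2) * z by rewrite fpolyE; ring.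
rewrite cabsM ler_wpM2r//.
apply: le_trans (cabsD _ _) _; rewrite cabsX.
apply: (@le_trans _ _ (cabs mu + cabs c * cabs z + cabs z ^+ 2)).
  by rewrite lerD2r -cabsM cabsD.
have h1 : cabs c * cabs z <= K * r by apply: ler_pM.
have h2 : cabs z ^+ 2 <= r by rewrite expr2; nra.
lra.
Qed.

Lemma fpoly_escape mu c K z : 0 <= K -> cabs mu <= 1 -> cabs c <= K -> K + 2 < cabs z ->
  K + 2 < cabs (fpoly mu c).[z].
Proof.
move=> K0 mu1 cK zK.
have -> : (fpoly mu c).[z] = (z ^+ 2 - (- (c * z + mu))) * z by rewrite fpolyE; ring.
have z0 : 0 < cabs z by lra.
rewrite cabsM; apply: (lt_trans zK); rewrite -[X in X < _]mul1r ltr_pM2r//.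
apply: lt_le_trans (cabsB_ge _ _); rewrite cabsX cabsN.
have : cabs (c * z + mu) <= cabs c * cabs z + 1.
  by apply: le_trans (cabsD _ _) _; rewrite cabsM lerD2l.
have : cabs c * cabs z <= K * cabs z by rewrite ler_wpM2r// ltW.
rewrite expr2; nra.
Qed.

Lemma escape_not_basin mu c K z : 0 <= K -> cabs mu <= 1 -> cabs c <= K -> K + 2 < cabs z ->
  ~ basin (horner (fpoly mu c)) 0 z.
Proof.
move=> K0 mu1 cK zK /cvgC_P/(_ 1 ltr01)[n _ /(_ n (leqnn n))] /=.
rewrite subr0 => h.
have : K + 2 < cabs (iter n (horner (fpoly mu c)) z).
  by elim: n {h} => [//|n IH] /=; exact: fpoly_escape.
by lra.
Qed.

(** If the coefficient [k] exceeded 10, the larger critical point, say [a], would have modulus at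
    least [65/100 k] and the other at most 1/10; the critical value [a^2 (3 b - a) / 2] would then
    lie beyond the escape radius [k + 2]. *)
Lemma cub_basin_bound a b : cabs (3 * a * b) <= 1 -> basin (horner (cub a b)) 0 a ->
  basin (horner (cub a b)) 0 b -> cabs (3 / 2 * (a + b)) <= 10.
Proof.
wlog ab : a b / cabs b <= cabs a.
  move=> W h ha hb; have [/W|/ltW/W] := leP (cabs b) (cabs a); first exact.
  by rewrite (addrC b) (mulrAC _ b) -(cubC a b); apply.
move=> mu1 ha _; rewrite leNgt; apply/negP => c10.
have [k kE] : exists k : R, k = cabs (3 / 2 * (a + b)) by eexists.
rewrite -kE in c10.
have E3 : cabs (3 : C) = 3 by exact: cabs_nat.
have E2 : cabs (2 : C) = 2 by exact: cabs_nat.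
have a0 := cabs_ge0 a; have b0 := cabs_ge0 b.
have ksum : k <= 3 / 2 * (cabs a + cabs b).
  by rewrite kE !cabsM cabsV E3 E2 ler_wpM2l ?cabsD//; lra.
have ab1 : 3 * (cabs a * cabs b) <= 1 by move: mu1; rewrite !cabsM E3; lra.
have a3 : 10 / 3 <= cabs a by lra.
have b1 : cabs b <= 1 / 10 by nra.
have ak : 65 / 100 * k <= cabs a by lra.
have big : k + 2 < cabs (cub a b).[a].
  have -> : (cub a b).[a] = a ^+ 2 * (3 * b - a) / 2 by rewrite cubE; field.
  rewrite (cabsM _ 2^-1) (cabsM (a ^+ 2)) cabsX cabsV E2.
  have h : cabs a - 3 / 10 <= cabs (3 * b - a).
    by rewrite cabs_sub; have := cabsB_ge a (3 * b); rewrite cabsM E3; lra.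
  have h2 : (65 / 100 * k) ^+ 2 <= cabs a ^+ 2 by rewrite lerXn2r// nnegrE; lra.
  have h3 : (65 / 100 * k) ^+ 2 * 6 <= cabs a ^+ 2 * cabs (3 * b - a).
    by apply: ler_pM => //; [exact: sqr_ge0|lra].
  by rewrite expr2 in h3; nra.
have hf : basin (horner (cub a b)) 0 (cub a b).[a].
  move: ha => /cvgC_P ha; apply/cvgC_P => e /ha[n _ H]; exists n => // m /= nm.
  by have := H m.+1 (leqW nm); rewrite /mkset iterSr.
apply: (escape_not_basin (K := k) _ mu1 _ big hf); first lra.
by rewrite cabsN -kE.
Qed.

End Bounds.

(** * Continuity in the two critical points *)

Section EarlyContinuity.
Variable R : realType.
Local Notation C := (Cplx R).
Variables (I : Type) (F : set_system I).
Context {FF : Filter F}.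
Variables (a b : I -> C) (a0 b0 : C).
Hypotheses (aa : ptconv F a a0) (bb : ptconv F b b0).

Lemma ptconv_cub (y : I -> C) (y0 : C) : ptconv F y y0 ->
  ptconv F (fun i => (cub (a i) (b i)).[y i]) (cub a0 b0).[y0].
Proof.
move=> yy; rewrite cubE.
have -> : (fun i => (cub (a i) (b i)).[y i]) =
  (fun i => 3 * a i * b i * y i - 3 / 2 * (a i + b i) * y i ^+ 2 + y i ^+ 3).
  by apply: funext => i; rewrite cubE.
apply: ptconvD; last exact: ptconvX.
apply: ptconvD.
  do 2 apply: ptconvM => //; apply: ptconvM => //; exact: ptconv_cst.
apply: ptconvN; apply: ptconvM; last exact: ptconvX.
by apply: ptconvM; [exact: ptconv_cst|exact: ptconvD].
Qed.

End EarlyContinuity.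

Section CriticalQuotient.
Variable R : realType.
Local Notation C := (Cplx R).
Variables (I : Type) (F : set_system I).
Context {FF : Filter F}.
Variables (a b : I -> C) (a0 b0 : C).
Hypotheses (aa : ptconv F a a0) (bb : ptconv F b b0).

Lemma luconv_cub : luconv F (fun i => cub (a i) (b i)) (cub a0 b0).
Proof.
apply/luconvP => z; apply: (ptconv_cub (F := jnear F z)).
- exact: ptconv_fst.
- exact: ptconv_fst.
- exact: ptconv_snd.
Qed.

Lemma luconv_pit_cub n : luconv F (fun i => pit (cub (a i) (b i)) n) (pit (cub a0 b0) n).
Proof. exact: luconv_pit luconv_cub. Qed.

Lemma ptconv_crit_quot n z : ptconv (jnear F z)
  (fun iy => crit_quot (a iy.1) (b iy.1) n iy.2) (crit_quot a0 b0 n z).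
Proof.
have a1 : ptconv (jnear F z) (fun iy => a iy.1) a0 by exact: ptconv_fst.
have b1 : ptconv (jnear F z) (fun iy => b iy.1) b0 by exact: ptconv_fst.
have y1 : ptconv (jnear F z) (fun iy => iy.2) z by exact: ptconv_snd.
elim: n => [|n IH].
  apply: ptconvD; last by apply: ptconvN; apply: ptconvM => //; exact: ptconv_cst.
  by apply: ptconvD => //; apply: ptconvM => //; exact: ptconv_cst.
have u1 : ptconv (jnear F z) (fun iy => (pit (cub (a iy.1) (b iy.1)) n.+1).[iy.2])
    (pit (cub a0 b0) n.+1).[z].
  by have /luconvP := luconv_pit_cub n.+1; exact.
have v1 : ptconv (jnear F z) (fun iy => (pit (cub (a iy.1) (b iy.1)) n.+1).[a iy.1])
    (pit (cub a0 b0) n.+1).[a0].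
  by apply: (ptconv_fst (x := fun i => (pit (cub (a i) (b i)) n.+1).[a i]));
    exact: luconv_point (luconv_pit_cub _) aa.
apply: ptconvM => //; rewrite /cub_diff.
apply: ptconvD.
  apply: ptconvD.
    by apply: ptconvM => //; apply: ptconvM => //; exact: ptconv_cst.
  apply: ptconvN; apply: ptconvM; last exact: ptconvD.
  by apply: ptconvM; [exact: ptconv_cst|exact: ptconvD].
apply: ptconvD; last exact: ptconvX.
by apply: ptconvD; [exact: ptconvX|exact: ptconvM].
Qed.

End CriticalQuotient.

(** * Early critical points under perturbation *)

Section EarlyPetals.
Variable R : realType.
Local Notation C := (Cplx R).
Variables (I : Type) (F : set_system I).
Context {FF : Filter F}.
Variables (a b : I -> C) (a0 b0 : C).
Hypotheses (aa : ptconv F a a0) (bb : ptconv F b b0).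
Variables (theta r0 : R) (n : nat).
Hypothesis theta01 : 0 <= theta < 1.
Hypothesis fcontract : forall z, cabs z <= r0 -> cabs (cub a0 b0).[z] <= theta * cabs z.
Local Notation N := n.+1.
Local Notation g0 := (pit (cub a0 b0) N).
Hypothesis ea : early a0 b0 r0 N a0.
Hypothesis ab : a0 != b0.


Lemma crit_quot_cont y0 e : 0 < e -> exists2 d : R, 0 < d &
  forall y, cabs (y - y0) < d -> cabs (crit_quot a0 b0 n y - crit_quot a0 b0 n y0) < e.
Proof.
(* The trivial filter freezes the parameters, so that convergence of the quotients becomes
   continuity in [y] alone. *)
pose F1 : set_system unit := fun A => A tt.
have FF1 : Filter F1 by split=> // P Q PQ; exact: PQ.
move=> e0; have [d d0 H] := @ptconv_crit_quot R unit F1 FF1 (fun=> a0) (fun=> b0) a0 b0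
  (ptconv_cst _) (ptconv_cst _) n y0 e e0.
by exists d.
Qed.

(** As [a] is in level [N + 1], the points [f^i(a)] with [1 <= i <= n] lie in level [N], which
    contains neither critical point. *)
Lemma early_quot_neq0 : crit_quot a0 b0 n a0 != 0.
Proof.
have [/andP[_ /ltW rr] na nb _] := ea.
apply: crit_quot_neq0 => // i /andP[i0 iN] /cub_crit fi.
have ha := early_lit_a theta01 fcontract ea (ltnSn N).
have hi : lit (cub a0 b0) N (cabs g0.[a0]) (pit (cub a0 b0) i).[a0].
  apply: (lit_mono theta01 fcontract rr (leq_subr i.-1 N)).
  apply: lit_image; first exact: fpoly0.
  by rewrite (_ : (N - i.-1 + i)%N = N.+1)//; lia.
by case: fi hi => ->; [exact: na|exact: nb].
Qed.

Lemma early_petal_open : F [set i | closure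
  (lit (cub (a i) (b i)) N (cabs (pit (cub (a i) (b i)) N).[a i])) (a i)].
Proof.
have [/andP[ga0 _] _ _ ca] := ea.
have k0 : 0 < cabs (crit_quot a0 b0 n a0) / 2 by rewrite divr_gt0// cabs_gt0 early_quot_neq0.
have [d d0 H] := @ptconv_crit_quot _ _ _ FF _ _ _ _ aa bb n a0 _ k0.
have lp : luconv F (fun i => pit (cub (a i) (b i)) N) g0 by exact: luconv_pit_cub.
have s1 := size_pit (fpoly1 (3 * a0 * b0) (- (3 / 2 * (a0 + b0)))) N.
have S1 i := size_pit (fpoly1 (3 * a i * b i) (- (3 / 2 * (a i + b i)))) N.
have H' : F [set i | forall y, cabs (y - a0) < d ->
    cabs (crit_quot a0 b0 n a0) / 2 <= cabs (crit_quot (a i) (b i) n y)].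
  apply: filterS H => i /= h y /h.
  have := cabsB_ge (crit_quot a0 b0 n a0) (crit_quot (a i) (b i) n y).
  rewrite (cabs_sub (crit_quot a0 b0 n a0)); lra.
refine (petal_open lp S1 s1 aa ga0 ca d0 k0 H' _).
by move=> i y; exact: crit_quotE.
Qed.

Lemma early_petal_segment : exists2 v : C, v != 0 & F [set i | forall s : R, 0 < s <= 1 ->
  lit (cub (a i) (b i)) N (cabs (pit (cub (a i) (b i)) N).[a i]) (a i + s%:C%C * v)].
Proof.
have [/andP[ga0 _] _ _ ca] := ea.
have lp : luconv F (fun i => pit (cub (a i) (b i)) N) g0 by exact: luconv_pit_cub.
have s1 := size_pit (fpoly1 (3 * a0 * b0) (- (3 / 2 * (a0 + b0)))) N.
have S1 i := size_pit (fpoly1 (3 * a i * b i) (- (3 / 2 * (a i + b i)))) N.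
refine (petal_segment (h := fun i y => crit_quot (a i) (b i) n y)
  (h0 := fun y => crit_quot a0 b0 n y)
  lp s1 aa ga0 ca early_quot_neq0 _ _ _).
- move=> e e0.
  have [d d0 H] := @ptconv_crit_quot _ _ _ FF _ _ _ _ aa bb n a0 _ e0.
  have [d1 d10 H1] := crit_quot_cont a0 e0.
  exists (Num.min d d1); first by rewrite lt_min d0.
  split; last by move=> y; rewrite lt_min => /andP[_ /H1].
  by apply: filterS H => i /= h y; rewrite lt_min => /andP[/h].
- by move=> i y; exact: crit_quotE.
- by move=> y; exact: crit_quotE.
Qed.

End EarlyPetals.

(** * Critical points collide in each component of a slice *)

Section Slice.
Variable R : realType.
Local Notation C := (Cplx R).
Variables (mu : C) (r0 : R) (n : nat).
Hypotheses (mu0 : mu != 0) (mu1 : cabs mu < 1).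
Hypotheses (r00 : 0 < r0) (r01 : r0 <= 1) (r0mu : r0 * 25 <= (1 - cabs mu) / 2).
Local Notation N := n.+1.
Hypothesis muN : cabs mu ^+ N * 26 < r0.

Section Parametrisation.
(* Used with [A p = p], [B p = mu / (3 p)] and with the two exchanged. *)
Variables (A B : C -> C).
Hypotheses (lA : laurent A) (lB : laurent B).
Implicit Types (p q : C).
Hypothesis AB : forall p, p != 0 -> 3 * A p * B p = mu.

Definition slice_coef p := 3 / 2 * (A p + B p).
Local Notation f p := (cub (A p) (B p)).
Local Notation g p := (pit (f p) N).
Local Notation theta := ((1 + cabs mu) / 2).
Local Notation early_at p := (early (A p) (B p) r0 N).
Local Notation rad p := (cabs (g p).[A p]).

Let theta01 : 0 <= theta < 1.
Proof. by have := cabs_ge0 mu; move: mu1 => h1 h2; apply/andP; split; lra. Qed.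

Lemma slice_fpoly p : p != 0 -> f p = fpoly mu (- slice_coef p).
Proof. by move=> p0; rewrite /cub AB. Qed.

(** On the closure of a slice the coefficient is at most 10; the bound 24 leaves room for
    neighbouring parameters. The hypotheses are tuned to it: [25 = 24 + 1] serves [fpoly_contract],
    and [26 = 24 + 2] is the radius in [fpoly_escape]. *)
Lemma slice_contract p z : p != 0 -> cabs (slice_coef p) <= 24 -> cabs z <= r0 ->
  cabs (f p).[z] <= theta * cabs z.
Proof.
move=> p0 c24; rewrite slice_fpoly//; apply: (fpoly_contract (K := 24)) => //.
  by rewrite cabsN.
by rewrite (_ : 24 + 1 = 25)//; ring.
Qed.

(** [lit_has_crit] with escape radius 26 puts a critical point in [lit f N r0], and [early_exists]
    applies. *)
Lemma slice_early p : p != 0 -> cabs (slice_coef p) <= 24 ->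
  early_at p (A p) \/ early_at p (B p).
Proof.
move=> p0 c24; have ct z := slice_contract (z := z) p0 c24.
apply: (early_exists theta01 ct); first by rewrite AB.
have [|||||||x hx /cub_crit xab] := @lit_has_crit _ (f p) (fpoly1 _ _) (fpoly0 _ _) theta r0
   theta01 ct N r0 26.
- by rewrite size_fpoly.
- by [].
- by [].
- by apply: le_trans r01 _; lra.
- move=> z; rewrite (_ : 26 = 24 + 2 :> R); last by ring.
  by rewrite slice_fpoly//; apply: fpoly_escape; rewrite ?cabsN//; exact: ltW.
- by rewrite cub_deriv0 AB.
- by rewrite cub_deriv0 AB.
by case: xab hx => ->; [left|right].
Qed.

Lemma ptA p : p != 0 -> ptconv (pnear p) A (A p). Proof. exact: laurent_cont. Qed.
Lemma ptB p : p != 0 -> ptconv (pnear p) B (B p). Proof. exact: laurent_cont. Qed.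

Lemma laurent_slice_coef : laurent slice_coef.
Proof. by apply: laurentM; [exact: laurent_cst|exact: laurentD]. Qed.

Lemma slice_coef_near p : p != 0 -> cabs (slice_coef p) <= 10 ->
  pnear p [set q | q != 0 /\ cabs (slice_coef q) <= 24].
Proof.
move=> p0 c10; have FFp := pnear_filter p.
have h := ptconv_cabs (laurent_cont laurent_slice_coef p0) (ltr01 : 0 < 1 :> R).
move: (h FFp) => {}h.
 apply: filterS2 h (pnear_neq0 p0) => q /= /andP[_ h] q0; split=> //; lra.
Qed.

Lemma laurent_pit k w : laurent w -> laurent (fun p => (pit (f p) k).[w p]).
Proof.
move=> lw; elim: k => [|k IH].
  by have -> : (fun p => (pit (f p) 0).[w p]) = w by apply: funext => p; rewrite hornerX.
have -> : (fun p => (pit (f p) k.+1).[w p]) = (fun p => 3 * A p * B p * (pit (f p) k).[w p] -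
  3 / 2 * (A p + B p) * (pit (f p) k).[w p] ^+ 2 + (pit (f p) k).[w p] ^+ 3).
  by apply: funext => p; rewrite pitSr cubE.
apply: laurentD; last exact: laurentX.
apply: laurentB; first by do 2 apply: laurentM => //; apply: laurentM => //; exact: laurent_cst.
apply: laurentM; last exact: laurentX.
by apply: laurentM; [exact: laurent_cst|exact: laurentD].
Qed.

Lemma slice_luconv k p : p != 0 -> luconv (pnear p) (fun q => pit (f q) k) (pit (f p) k).
Proof. by move=> p0; apply: luconv_pit_cub; [exact: ptA|exact: ptB]. Qed.

Lemma rad_near p (e : R) : p != 0 -> 0 < e -> pnear p [set q | rad p - e < rad q < rad p + e].
Proof.
move=> p0 e0; apply: ptconv_cabs => //.
by apply: (luconv_point (slice_luconv N p0)); exact: ptA.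
Qed.

Lemma slice_lit_near k p r w : p != 0 -> laurent w -> lit (f p) k r (w p) ->
  exists r', [/\ r' < r, 0 < r' & pnear p [set q | lit (f q) k r' (w q)]].
Proof.
move=> p0 lw hw.
have [r' [r'r r'0 [d d0 H]]] := lemn_open_family (slice_luconv k p0) hw.
exists r'; split=> //; have W := laurent_cont lw p0 d0.
by apply: filterS2 H W => q /= h; exact: h.
Qed.

Lemma slice_lit_lim k p r r' : p != 0 -> r < r' ->
  pnear p [set q | lit (f q) k r `<=` lit (f p) k r'].
Proof.
move=> p0 rr'; apply: (lemn_lim_family (slice_luconv k p0)) => //.
- by move=> i; rewrite pit0// fpoly0.
- by rewrite pit0// fpoly0.
- by apply: size_pit; exact: fpoly1.
Qed.

Lemma closure_lit_lt p k r r' w : closure (lit (f p) k r) w -> r <= r' ->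
  cabs (pit (f p) k).[w] < r' -> lit (f p) k r' w.
Proof.
move=> cw rr' wr'; apply: lemn_closure => //.
by apply: closureS cw; exact: lit_mono_r.
Qed.

(** Suppose that [B] is early at [p], at level [t]. If [rad p > t], then [B] is inside the component
    at level [rad p], also for nearby parameters; if [rad p < t], passage to the limit puts [A] in
    the component at level [t]. Both are excluded, so the levels agree and [petal_closed] puts [A]
    in the closure. *)
Lemma early_closed p : p != 0 -> cabs (slice_coef p) <= 10 ->
  (forall P, pnear p P -> exists q, P q /\ early_at q (A q)) -> early_at p (A p).
Proof.
move=> p0 c10 H.
have c24 : cabs (slice_coef p) <= 24 by lra.
have [//|eB] := slice_early p0 c24.
have [/andP[t0 tr0] nA nB cB] := eB.
have [t tE] : exists t, t = cabs (g p).[B p] by eexists.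
rewrite -tE in t0 tr0 nA nB cB.
have h1 : rad p <= t.
  rewrite leNgt; apply/negP => tr.
  have hB : lit (f p) N (rad p) (B p).
    by apply: closure_lit_lt cB (ltW tr) _; rewrite -tE.
  have [r' [r'r r'0 H1]] := slice_lit_near p0 lB hB.
  have e0 : 0 < rad p - r' by lra.
  have [q [[/= h1 h2] [_ _ nBq _]]] := H _ (filterI H1 (rad_near p0 e0)).
  by apply: nBq; apply: lit_mono_r h1; lra.
have h2 : t <= rad p.
  rewrite leNgt; apply/negP => rt.
  pose s := (rad p + t) / 2; pose s' := (s + t) / 2.
  have sE : s = (rad p + t) / 2 by [].
  have s'E : s' = (s + t) / 2 by [].
  have ss' : s < s' by lra.
  have e0 : 0 < s - rad p by lra.
  have H1 := slice_lit_lim N p0 ss'.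
  have H2 := rad_near p0 e0.
  apply: nA; apply: (@lit_mono_r _ _ _ s'); first lra.
  apply: lemn_closure; last by rewrite /=; lra.
  apply/closureC_P => e e1.
  have H3 := ptA p0 e1.
  have [q [[/= i1 [i2 i3]] [_ _ _ cA]]] := H _ (filterI H1 (filterI H2 H3)).
  exists (A q) => //; apply: i1; apply: closure_lit_lt cA _ _; lra.
have {h1 h2} rE : rad p = t by apply: le_anti; rewrite h1 h2.
split; rewrite rE; [by rewrite t0|exact: nA|exact: nB|].
apply/closureC_P => e e0.
have rp0 : 0 < rad p by rewrite rE.
have Z : (g p).[0] = 0 by rewrite pit0// fpoly0.
have Z' q : (g q).[0] = 0 by rewrite pit0// fpoly0.
have S1 : (1 < size (g p))%N by apply: size_pit; exact: fpoly1.
have S1' q : (1 < size (g q))%N by apply: size_pit; exact: fpoly1.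
have H1 := petal_closed (slice_luconv N p0) Z' Z S1' S1 (ptA p0) rp0 e0.
move: (H1 (pnear_filter p)) => {}H1.
have [q [[/= i1 [q0 q24]] eq]] := H _ (filterI H1 (slice_coef_near p0 c10)).
have [/andP[_ /ltW rq] nAq nBq cAq] := eq.
have ctq z := slice_contract (z := z) q0 q24.
have [y hy yA] := i1 cAq (lit_nocrit theta01 ctq rq nAq nBq).
by exists y => //; rewrite -rE.
Qed.

Section EarlyA.
Variables (U : set C) (M : R).
Hypotheses (oU : open U) (U0 : U !=set0) (UM : forall p, U p -> cabs p <= M).
Hypothesis UH : forall p, U p -> immediate_basin (horner (f p)) 0 (B p).
Hypothesis Umax : forall p, closure U p -> immediate_basin (horner (f p)) 0 (A p) ->
  immediate_basin (horner (f p)) 0 (B p) -> U p.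
Hypothesis Uc : forall p, closure U p -> p != 0 /\ cabs (slice_coef p) <= 10.
Hypothesis eA : forall p, closure U p -> early_at p (A p).
Hypothesis nAB : forall p, U p -> A p != B p.

Let c24 p : closure U p -> cabs (slice_coef p) <= 24.
Proof. by move=> /Uc[_]; lra. Qed.

Let ct p : closure U p -> forall z, cabs z <= r0 -> cabs (f p).[z] <= theta * cabs z.
Proof. by move=> cp z; apply: slice_contract; [case: (Uc cp)|exact: c24]. Qed.

Let rp p : closure U p -> 0 < rad p < r0. Proof. by move=> /eA[]. Qed.

Let Uclosure p : U p -> closure U p. Proof. by move=> Up; exact: subset_closure. Qed.

(* [m] is the least level at which [B] enters the component of [{|f^m| < |f^N A|}] for
   some parameter in [U]. *)
Let entry_level : exists m, [/\ exists2 p, U p & lit (f p) m (rad p) (B p), (N < m)%N &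
  forall k p, (k < m)%N -> U p -> ~ lit (f p) k (rad p) (B p)].
Proof.
have ex : exists m, `[< exists2 p, U p & lit (f p) m (rad p) (B p) >].
  have [p Up] := U0; have cp := Uclosure Up.
  have /andP[h1 /ltW h2] := rp cp.
  have /(immediate_basinE (fpoly0 _ _) theta01 (ct cp) _ h1 h2)[m hm] := UH Up.
  by exists m; apply/asboolP; exists p.
have [m /asboolP hm mmin] := ex_minnP ex.
exists m; split=> //.
  rewrite ltnNge; apply/negP => mN; have [p Up hB] := hm; have cp := Uclosure Up.
  have /andP[h1 /ltW h2] := rp cp; have [_ _ nB _] := eA cp; apply: nB.
  exact: (lit_mono theta01 (ct cp) h2 mN).
move=> k p km Up hB; have : (m <= k)%N by apply: mmin; apply/asboolP; exists p.
by rewrite leqNgt km.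
Qed.

(** Either [m = N + 1] and the critical points collide, or some parameter lets [B] enter at level
    [m - 1], against the minimality of [m]. *)
Lemma early_impossible : False.
Proof.
have [m [[p0 Up0 hp0] Nm mmin]] := entry_level.
have m_gt0 : (0 < m)%N by exact: leq_ltn_trans (leq0n _) Nm.
have m1 : (m.-1 < m)%N by rewrite ltn_predL.
pose W : set C := [set p | U p /\ lit (f p) m (rad p) (B p)].
pose h p := (pit (f p) m).[B p].
pose h1 p := (g p).[A p].
have lh : laurent h by exact: laurent_pit.
have lh1 : laurent h1 by exact: laurent_pit.
have WU p : W p -> U p by case.
have cWU p : closure W p -> closure U p by apply: closureS.
have oW : open W.
  apply/openC_P => p [Up hB]; have cp := Uclosure Up; have [pn0 _] := Uc cp.
  have [r' [r'r r'0 H1]] := slice_lit_near pn0 lB hB.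
  have e0 : 0 < rad p - r' by lra.
  have /openC_P/(_ p Up)[e e1 eU] := oU.
  have [d d0 dP] := filterI H1 (rad_near pn0 e0).
  exists (Num.min e d); first by rewrite lt_min e1.
  move=> q; rewrite lt_min => /andP[/eU Uq /dP[/= i1 i2]].
  by split=> //; apply: lit_mono_r i1; lra.
(* If [|f^m(B)|] were below [rad p] at a limit point of [W], [early_interval] would give entry at
   one fixed radius [r' < rad p] for nearby parameters of [W], and this survives in the limit. *)
have bW p : closure W p -> W p \/ rad p <= cabs (h p).
  move=> cWp; have cp := cWU p cWp; have [pn0 _] := Uc cp.
  have [hr|rh] := leP (rad p) (cabs (h p)); [by right|left].
  have /andP[rp0 rpr0] := rp cp.
  have tr : theta * rad p < rad p by have /andP[_ t1] := theta01; nra.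
  have [s sE] : exists s, s = Num.max (theta * rad p) (cabs (h p)) by eexists.
  have s1 : s < rad p by rewrite sE gt_max tr.
  have s2 : theta * rad p <= s by rewrite sE le_max lexx.
  have s3 : cabs (h p) <= s by rewrite sE le_max lexx orbT.
  pose r' := (s + rad p) / 2.
  have r'E : r' = (s + rad p) / 2 by [].
  have r'r : r' < rad p by lra.
  pose r'' := (r' + rad p) / 2.
  have r''E : r'' = (r' + rad p) / 2 by [].
  have e0 : 0 < r' - s by lra.
  have H1 := rad_near pn0 e0.
  have H2 := ptconv_cabs (laurent_cont lh pn0) e0.
  move: (H2 (pnear_filter p)) => {}H2.
  have H3 := slice_lit_lim m pn0 (ltac:(lra) : r' < r'').
  have hBp : lit (f p) m (rad p) (B p).
    apply: (@lit_mono_r _ _ _ r''); first lra.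
    apply: lemn_closure; last by rewrite -/(h p); lra.
    apply/closureC_P => e e1.
    have [d d0 dP] := filterI H1 (filterI H2 (filterI H3 (ptB pn0 e1))).
    have /closureC_P/(_ d d0)[q Wq qd] := cWp.
    have [/= i1 [i2 [i3 i4]]] := dP q qd.
    have [Uq hq] := Wq; have cq := Uclosure Uq.
    have nq : ~ lit (f q) m.-1 (rad q) (B q) by exact: (mmin _ _ m1 Uq).
    exists (B q) => //; apply: i3.
    apply: (early_interval theta01 (ct cq) (eA cq) Nm hq nq); last by rewrite -/(h q); lra.
    by have /andP[t0 t1] := theta01; nra.
  have hA := early_lit_a theta01 (ct cp) (eA cp) (ltnSn N).
  split=> //; apply: Umax => //.
    by apply/(immediate_basinE (fpoly0 _ _) theta01 (ct cp) _ rp0 (ltW rpr0)); exists N.+1.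
  by apply/(immediate_basinE (fpoly0 _ _) theta01 (ct cp) _ rp0 (ltW rpr0)); exists m.
have WM p : W p -> cabs p <= M by move=> /WU; exact: UM.
have Wn0 p : closure W p -> p != 0 by move=> /cWU /Uc[].
have hr p : W p -> cabs (h p) < rad p by case=> _ /lit_lt.
(* Otherwise the maximum principle for [h1 / h], of modulus at most 1 on the boundary by [bW],
   contradicts [|h| < rad] inside [W]. *)
have hzero : exists2 p, W p & h p = 0.
  apply: contrapT => nz.
  have : cabs (h1 p0) <= cabs (h p0).
    apply: (laurent_max oW WM Wn0 lh1 lh) => //.
    move=> p cp; have [Wp|rh] := bW p cp.
      by apply/eqP => hp; apply: nz; exists p.
    by rewrite -cabs_gt0; have /andP[rp0 _] := rp (cWU p cp); apply: lt_le_trans rh.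
  by have := hr p0 (conj Up0 hp0); rewrite leNgt => ->.
pose v p := (pit (f p) N.+1).[A p].
have lv : laurent v by exact: laurent_pit.
have vr p : closure U p -> cabs (v p) <= theta * rad p.
  move=> cp; rewrite /v pitSr; apply: (ct cp).
  by have /andP[_ /ltW] := rp cp.
have t1 : theta < 1 by case/andP: theta01.
have [p2 [Up2 hp2] E2] : exists2 p, W p & h p = v p.
  apply: (laurent_rouche oW WM Wn0 lh lv t1) => //.
  move=> p cWp; have [Wp|rh] := bW p cWp; [by left|right].
  have cp := cWU p cWp; have /andP[rp0 _] := rp cp.
  split; first by rewrite -cabs_gt0; apply: lt_le_trans rh.
  apply: le_trans (vr p cp) _; apply: ler_wpM2l => //; by case/andP: theta01.
have cp2 := Uclosure Up2; have [pn2 _] := Uc cp2.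
have /eqP nAB2 := nAB Up2.
(* At the first possible entry level, equal values of [f^(N+1)] already force equal critical values,
   hence a collision. *)
have [mE|mN] := eqVneq m N.+1.
  apply: nAB2; apply: (early_eq theta01 (ct cp2) (eA cp2)).
    by rewrite -mE.
  by have := E2; rewrite /h mE.
have [j jE] : exists j, m = (N.+1 + j.+1)%N.
  by exists (m - N.+2)%N; rewrite addnS -addSn subnKC// ltn_neqAle eq_sym mN.
have hy : lit (f p2) N.+1 (rad p2) (pit (f p2) j.+1).[B p2].
  by apply: lit_image; [exact: fpoly0|rewrite -jE].
have yA : (pit (f p2) j.+1).[B p2] = A p2.
  apply: (early_double_unique theta01 (ct cp2) (eA cp2) _ hy).
    by apply: (mmin _ _ _ Up2); rewrite jE addnS ltnS leq_addr.
  by rewrite -pitD -jE.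
have [w w0 [d1 d10 seg]] := early_petal_segment (ptA pn2) (ptB pn2) theta01 (ct cp2) (eA cp2)
  (introN eqP nAB2).
have /openC_P/(_ p2 (conj Up2 hp2))[d2 d20 dW] := oW.
have m0 : 0 < Num.min d1 d2 by rewrite lt_min d10.
(* [q] vanishes at [p2] and is open there, so a nearby parameter places [f^(j+1)(B)] at [A + s w],
   on a segment that lies in level [N] for all parameters near [p2]; [early_entry] then lowers the
   entry level. *)
pose q p := (pit (f p) j.+1).[B p] - A p.
have lq : laurent q by apply: laurentB => //; exact: laurent_pit.
have q2 : q p2 = 0 by rewrite /q yA subrr.
have [cst|[d d0 dP]] := laurent_open lq (laurent_cst (1 : C)) pn2 (oner_neq0 _) m0.
  (* A constant [q] would vanish at a boundary point of [W] as well; there [|h| >= rad], while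
     [h = v] has modulus at most [theta rad]. *)
  have [x cx nx] := boundary_exists oW (ex_intro _ p2 (conj Up2 hp2)) WM.
  have cxU := cWU x cx.
  have := cst x (Wn0 x cx); rewrite mulr1 q2 mul0r => /eqP; rewrite subr_eq0 => /eqP yx.
  have [//|rh] := bW x cx.
  have : h x = v x by rewrite /h /v jE pitD yx.
  have := vr x cxU; have /andP[rx0 _] := rp cxU; have /andP[_ t1'] := theta01.
  by move=> + hv; rewrite -hv; nra.
have w00 : 0 < cabs w by rewrite cabs_gt0.
have [s sE] : exists s, s = Num.min 1 (d / (2 * cabs w)) by eexists.
have s0 : 0 < s by rewrite sE lt_min ltr01 divr_gt0// mulr_gt0.
have s1 : s <= 1 by rewrite sE ge_min lexx.
have sw : s * cabs w < d.
  have : s <= d / (2 * cabs w) by rewrite sE ge_min lexx orbT.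
  by rewrite ler_pdivlMr ?mulr_gt0//; lra.
have [|p3 [pd p3n0 qp3]] := dP (s%:C%C * w).
  by rewrite q2 mul0r subr0 cabsM cabs_real gtr0_norm.
move: pd; rewrite lt_min => /andP[/seg /= hs /dW [Up3 hp3]].
have cp3 := Uclosure Up3.
have s01 : 0 < s <= 1 by rewrite s0.
have := hs s s01; rewrite -[_ * w]mulr1 -qp3 /q addrC subrK => hN.
have NjE : (N + j.+1)%N = m.-1 by rewrite jE.
apply: (mmin _ _ m1 Up3).
apply: (early_entry theta01 (ct cp3) (eA cp3) NjE _ hN).
by rewrite prednK.
Qed.

End EarlyA.

End Parametrisation.
End Slice.

(** * Excluding that both critical points are early *)

Section CriticalCollision.
Variable R : realType.
Local Notation C := (Cplx R).

Lemma early_sym (a b w : C) (r0 : R) N : early a b r0 N w -> early b a r0 N w.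
Proof. by rewrite /early (cubC b a); case. Qed.

(** If the levels differed, the critical point with the lower level would lie inside the component
    belonging to the higher one. *)
Lemma early_radius (a b : C) (r0 : R) N : early a b r0 N a -> early a b r0 N b ->
  cabs (pit (cub a b) N).[a] = cabs (pit (cub a b) N).[b].
Proof.
have half (x y : C) : early a b r0 N x -> ~ lit (cub a b) N (cabs (pit (cub a b) N).[y]) x ->
    cabs (pit (cub a b) N).[y] <= cabs (pit (cub a b) N).[x].
  move=> [_ _ _ cx] nx; rewrite leNgt; apply/negP => xy; apply: nx.
  exact: closure_lit_lt cx (ltW xy) xy.
move=> ea eb; have [_ naa nab _] := ea; have [_ nba nbb _] := eb.
by apply: le_anti; rewrite (half b a)//= (half a b).
Qed.

(** Rotation by [(1 + i e)^2 / (1 + e^2)] changes the real part by [- 2 e (x e + y) / (1 + e^2)];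
    [e] is a small negative multiple of [y], or a small positive number when [w = -1]. *)
Lemma unit_circle_step (w : C) (d : R) : cabs w = 1 -> w != 1 -> 0 < d ->
  exists v : C, [/\ cabs v = 1, cabs (v - w) < d & complex.Re w < complex.Re v].
Proof.
case: w => x y w1 wn1 d0.
have sq (u v : R) : cabs (u +i* v)%C ^+ 2 = u ^+ 2 + v ^+ 2.
  by rewrite /cabs /= sqr_sqrtr// addr_ge0// sqr_ge0.
have xy1 : x ^+ 2 + y ^+ 2 = 1 by rewrite -sq w1 expr1n.
have [t tE] : exists t : R, t = Num.min (1 / 2) (d / 4) by eexists.
have t0 : 0 < t by rewrite tE lt_min; apply/andP; split; lra.
have t1 : t <= 1 / 2 by rewrite tE ge_min lexx.
have td : t <= d / 4 by rewrite tE ge_min lexx orbT.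
have x1 : x <= 1 by have := sqr_ge0 y; nra.
have y2 : y ^+ 2 <= 1 by have := sqr_ge0 x; nra.
have [e [ee e0]] : exists e : R, e ^+ 2 <= t ^+ 2 /\ 0 < - (e * (x * e + y)).
  have [y0|y0] := eqVneq y 0.
    exists t; split=> //; rewrite y0 addr0.
    have xm : x != 1 by apply: contraNneq wn1 => ->; rewrite y0.
    have {}xm : x = -1.
      move: xy1; rewrite y0 expr0n addr0 => /eqP; rewrite sqrf_eq1 (negbTE xm) /=.
      by move=> /eqP.
    by rewrite xm; nra.
  exists (- (t * y)); split; first by rewrite sqrrN exprMn ler_piMr// sqr_ge0.
  have -> : - (- (t * y) * (x * - (t * y) + y)) = t * y ^+ 2 * (1 - x * t) by ring.
  rewrite mulr_gt0//; last by nra.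
  by rewrite mulr_gt0// lt_def sqrf_eq0 y0 sqr_ge0.
have p0 : 0 < 1 + e ^+ 2 by have := sqr_ge0 e; lra.
have pn0 : 1 + e ^+ 2 != 0 by exact: lt0r_neq0.
pose x' := (x * (1 - e ^+ 2) - 2 * y * e) / (1 + e ^+ 2).
pose y' := (y * (1 - e ^+ 2) + 2 * x * e) / (1 + e ^+ 2).
have sq_inj (u v : R) : 0 <= u -> 0 <= v -> u ^+ 2 = v ^+ 2 -> u = v.
  by move=> u0 v0 /eqP; rewrite eqrXn2// => /eqP.
exists (x' +i* y')%C; split.
- apply: sq_inj; rewrite ?cabs_ge0//.
  rewrite sq expr1n -xy1 /x' /y'; field; exact: pn0.
- have h : cabs ((x' +i* y')%C - (x +i* y)%C) ^+ 2 < d ^+ 2.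
    have -> : cabs ((x' +i* y')%C - (x +i* y)%C) ^+ 2 = (x' - x) ^+ 2 + (y' - y) ^+ 2.
      by rewrite /cabs /= sqr_sqrtr// addr_ge0// sqr_ge0.
    have -> : (x' - x) ^+ 2 + (y' - y) ^+ 2 = 4 * e ^+ 2 * (x ^+ 2 + y ^+ 2) / (1 + e ^+ 2).
      by rewrite /x' /y'; field; exact: pn0.
    rewrite xy1 mulr1 ltr_pdivrMr//.
    have : t ^+ 2 <= d ^+ 2 / 16 by nra.
    have : 0 < d ^+ 2 by rewrite exprn_gt0.
    have := sqr_ge0 e; nra.
  rewrite ltNge; apply/negP => dle; move: h; rewrite ltNge => /negP; apply.
  by rewrite lerXn2r// nnegrE ?cabs_ge0// ltW.
- rewrite /= /x' ltr_pdivlMr//; nra.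
Qed.

Variables (mu : C) (r0 : R) (n : nat).
Hypotheses (mu0 : mu != 0) (mu1 : cabs mu < 1).
Hypotheses (r00 : 0 < r0) (r01 : r0 <= 1) (r0mu : r0 * 25 <= (1 - cabs mu) / 2).
Local Notation N := n.+1.
Hypothesis muN : cabs mu ^+ N * 26 < r0.
Variables (A B : C -> C).
Hypotheses (lA : laurent A) (lB : laurent B).
Implicit Types (p q : C).
Hypothesis AB : forall p, p != 0 -> 3 * A p * B p = mu.
Local Notation f p := (cub (A p) (B p)).
Local Notation g p := (pit (f p) N).
Local Notation theta := ((1 + cabs mu) / 2).
Local Notation early_at p := (early (A p) (B p) r0 N).

Let theta01 : 0 <= theta < 1.
Proof. by have := cabs_ge0 mu; move: mu1 => h1 h2; apply/andP; split; lra. Qed.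

Let BA p : p != 0 -> 3 * B p * A p = mu.
Proof. by move=> /AB; rewrite mulrAC. Qed.

Let coefC p : slice_coef B A p = slice_coef A B p.
Proof. by rewrite /slice_coef addrC. Qed.

Variables (U : set C) (M : R).
Hypotheses (oU : open U) (cU : connected U) (U0 : U !=set0).
Hypothesis UM : forall p, U p -> cabs p <= M.
Hypothesis UH : forall p, U p -> immediate_basin (horner (f p)) 0 (A p) /\
  immediate_basin (horner (f p)) 0 (B p).
Hypothesis Umax : forall p, closure U p -> immediate_basin (horner (f p)) 0 (A p) ->
  immediate_basin (horner (f p)) 0 (B p) -> U p.
Hypothesis Uc : forall p, closure U p -> p != 0 /\ cabs (slice_coef A B p) <= 10.

Let c24 p : closure U p -> cabs (slice_coef A B p) <= 24.
Proof. by move=> /Uc[_]; lra. Qed.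

Let ct p : closure U p -> forall z, cabs z <= r0 -> cabs (f p).[z] <= theta * cabs z.
Proof. by move=> cp z; apply: slice_contract; rewrite ?(proj1 (Uc cp))//; exact: c24. Qed.

Let T : set C := [set p | closure U p /\ (early_at p (A p) /\ early_at p (B p))].

Let TU p : T p -> U p.
Proof.
move=> [cp [ea eb]]; have [/andP[h1 /ltW h2] _ _ _] := ea.
have [/andP[h1' /ltW h2'] _ _ _] := eb.
have hA := early_lit_a theta01 (ct cp) ea (ltnSn N).
apply: Umax => //.
  by apply/(immediate_basinE (fpoly0 _ _) theta01 (ct cp) _ h1 h2); exists N.+1.
have ct' z : cabs z <= r0 -> cabs (cub (B p) (A p)).[z] <= theta * cabs z.
  by rewrite cubC; exact: ct.
have hB := early_lit_a theta01 ct' (early_sym eb) (ltnSn N); rewrite cubC in hB.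
by apply/(immediate_basinE (fpoly0 _ _) theta01 (ct cp) _ h1' h2'); exists N.+1.
Qed.

Let early_closedA p : closure U p ->
  (forall P, pnear p P -> exists q, P q /\ early_at q (A q)) -> early_at p (A p).
Proof.
move=> cp; have [p0 c10] := Uc cp.
exact: (early_closed mu0 mu1 r00 r01 r0mu muN lA lB AB p0 c10).
Qed.

Let early_closedB p : closure U p ->
  (forall P, pnear p P -> exists q, P q /\ early_at q (B q)) -> early_at p (B p).
Proof.
move=> cp H; have [p0 c10] := Uc cp; apply: early_sym.
apply: (early_closed mu0 mu1 r00 r01 r0mu muN lB lA BA p0); first by rewrite coefC.
move=> P /H[q [Pq eq]]; exists q; split; [exact: Pq|exact: early_sym].
Qed.

Let early_or p : closure U p -> early_at p (A p) \/ early_at p (B p).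
Proof.
move=> cp; have [p0 c10] := Uc cp.
exact: (slice_early mu0 mu1 r00 r01 r0mu muN AB p0 (c24 cp)).
Qed.

Hypothesis nAB : forall p, U p -> A p != B p.

Let h1 p := (g p).[A p].
Let h2 p := (g p).[B p].

Let lh1 : laurent h1. Proof. exact: laurent_pit. Qed.
Let lh2 : laurent h2. Proof. exact: laurent_pit. Qed.

Let Tradius p : T p -> [/\ 0 < cabs (h1 p) < r0, 0 < cabs (h2 p) & cabs (h1 p) = cabs (h2 p)].
Proof.
move=> [cp [ea eb]]; have := early_radius ea eb.
by have [h _ _ _] := ea; have [/andP[h' _] _ _ _] := eb.
Qed.

(** By [early_petal_open] each critical point stays in the closure of the component at its own
    level; equality of the two levels then makes both early. *)
Let Topen p : T p -> exists2 d : R, 0 < d & forall q, cabs (q - p) < d ->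
  cabs (h1 q) = cabs (h2 q) -> T q.
Proof.
move=> Tp; have Up := TU Tp; have [cp [ea eb]] := Tp; have [p0 _] := Uc cp.
have [/andP[r1 rr0] r2 r12] := Tradius Tp.
have m0 : 0 < Num.min (cabs (h1 p)) (r0 - cabs (h1 p)) by rewrite lt_min r1; lra.
have H1 := rad_near n lA lB p0 m0.
have ct' z : cabs z <= r0 -> cabs (cub (B p) (A p)).[z] <= theta * cabs z.
  by rewrite cubC; exact: ct.
have nba : B p != A p by rewrite eq_sym nAB.
have H2 := early_petal_open (ptA lA p0) (ptB lB p0) theta01 (ct cp) ea (nAB Up).
move: (H2 (pnear_filter p)) => {}H2.
have H3 := early_petal_open (ptB lB p0) (ptA lA p0) theta01 ct' (early_sym eb) nba.
move: (H3 (pnear_filter p)) => {}H3.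
have /openC_P/(_ p Up)[e e0 eU] := oU.
have [d d0 dP] := filterI H1 (filterI H2 H3).
exists (Num.min d e); first by rewrite lt_min d0.
move=> q; rewrite lt_min => /andP[/dP[i1 [i2 i3]] /eU Uq] E.
have {}i1 : 0 < cabs (h1 q) < r0.
  move: i1; rewrite /mkset -/(h1 p) -/(h1 q) => /andP[j1 j2].
  have : Num.min (cabs (h1 p)) (r0 - cabs (h1 p)) <= cabs (h1 p) by rewrite ge_min lexx.
  have : Num.min (cabs (h1 p)) (r0 - cabs (h1 p)) <= r0 - cabs (h1 p) by rewrite ge_min lexx orbT.
  by move=> j3 j4; apply/andP; split; lra.
have n1 : ~ lit (f q) N (cabs (h1 q)) (A q) by move=> /lit_lt; rewrite ltxx.
have n2 : ~ lit (f q) N (cabs (h1 q)) (B q) by move=> /lit_lt; rewrite -/(h2 q) E ltxx.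
split; first exact: subset_closure.
split; split.
- exact: i1.
- exact: n1.
- exact: n2.
- exact: i2.
- by rewrite -/(h2 q) -E.
- by rewrite -/(h2 q) -E.
- by rewrite -/(h2 q) -E.
- by move: i3; rewrite /mkset (cubC (B q) (A q)).
Qed.

Let closureU_bounded p : closure U p -> cabs p <= M.
Proof. exact: closure_bounded. Qed.

Let closedT : closed T.
Proof.
move=> p cTp; have cp : closure U p.
  rewrite ((closure_id _).1 (@closed_closure _ U)).
  by apply: closureS cTp => q [h _]; exact: h.
have near P : pnear p P -> exists2 q, P q & T q.
  by move=> [d d0 dP]; have /closureC_P/(_ d d0)[q Tq /dP Pq] := cTp; exists q.
split; [exact: cp|split].
  by apply: (early_closedA cp) => P /near[q Pq [_ [eq _]]]; exists q.
by apply: (early_closedB cp) => P /near[q Pq [_ [_ eq]]]; exists q.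
Qed.

(** Take a point of the compact set [T] where the unimodular quotient [h1 / h2] has the largest real
    part. By [early_same] the quotient is not 1, so, being open, it can be moved along the unit
    circle to a larger real part, staying in [T] by [Topen]. *)
Let no_T p : ~ T p.
Proof.
move=> Tp.
have cT : compact T.
  apply: (@bounded_closed_compactC _ _ M); first exact: closedT.
  by move=> q [cq _]; exact: closureU_bounded cq.
pose phi q := complex.Re (h1 q / h2 q).
have h20 q : T q -> h2 q != 0 by move=> /Tradius[_ + _]; rewrite cabs_gt0.
have Tn0 q : T q -> q != 0 by case=> /Uc[].
have [||y Ty ymax] := @compact_max R T phi cT.
- by exists p.
- move=> y Ty e e0; have y0 := Tn0 y Ty.
  have [d d0 dP] := ptconvM (laurent_cont lh1 y0) (ptconvV (h20 y Ty) (laurent_cont lh2 y0)) e0.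
  exists d => // z _ /dP /= h; rewrite /phi.
  have := absRe_le (h1 z / h2 z - h1 y / h2 y); rewrite raddfB /=.
  by have := ler_norm (complex.Re (h1 z / h2 z) - complex.Re (h1 y / h2 y)); lra.
have [cy [ea eb]] := Ty.
have [/andP[r1 _] r2 r12] := Tradius Ty.
have [d d0 dT] := Topen Ty.
have [cst|[e e0 eP]] := laurent_open lh1 lh2 (Tn0 y Ty) (h20 y Ty) d0.
  (* A constant quotient keeps [|h1| = |h2|] everywhere, so [T] would be open, closed, bounded and
     nonempty. *)
  have eqr q : q != 0 -> cabs (h1 q) = cabs (h2 q).
    move=> /cst /(congr1 (@cabs R)); rewrite !cabsM r12 mulrC => /mulfI; apply.
    exact: lt0r_neq0.
  have oT : open T.
    apply/openC_P => q Tq; have [d1 d10 d1T] := Topen Tq.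
    have [d2 d20 d2P] := pnear_neq0 (Tn0 q Tq).
    exists (Num.min d1 d2); first by rewrite lt_min d10.
    by move=> z; rewrite lt_min => /andP[/d1T + /d2P /eqr]; apply.
  have [x cx nx] := boundary_exists oT (ex_intro _ p Tp) (fun q Tq => closureU_bounded (proj1 Tq)).
  by apply: nx; rewrite ((closure_id _).1 closedT); exact: cx.
have rho1 : cabs (h1 y / h2 y) = 1 by rewrite cabsM cabsV r12 mulfV// lt0r_neq0.
have rhon1 : h1 y / h2 y != 1.
  apply/eqP => E; have h12 : h1 y = h2 y by rewrite -[h1 y](divfK (h20 y Ty)) E mul1r.
  have := nAB (TU Ty); rewrite (early_same theta01 (ct cy) ea eb h12) eqxx.
  by [].
have [k [k1 ke kRe]] := unit_circle_step rho1 rhon1 e0.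
have [q [qd q0 E]] := eP k ke.
have Tq : T q by apply: dT => //; rewrite E cabsM k1 mul1r.
have := ymax q Tq; rewrite /phi E mulfK ?h20// leNgt => /negP; apply; exact: kRe.
Qed.

(** As both are never early at once, being early is clopen for [A] on the connected closure of [U];
    so one and the same critical point is early throughout, and [early_impossible] applies to it. *)
Lemma slice_no_collision_false : False.
Proof.
have excl p : closure U p -> early_at p (A p) -> early_at p (B p) -> False.
  by move=> cp ea eb; exact: (@no_T p (conj cp (conj ea eb))).
have far p (Q : C -> Prop) : ~ (forall P, pnear p P -> exists q, P q /\ Q q) ->
    exists2 d : R, 0 < d & forall q, cabs (q - p) < d -> ~ Q q.
  move=> /existsNP[P /not_implyP[[d d0 dP] nP]]; exists d => // q /dP Pq Qq.
  by apply: nP; exists q.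
have [p0 Up0] := U0; have cp0 : closure U p0 := subset_closure Up0.
have lc x : closure U x -> exists2 e : R, 0 < e & forall y, closure U y -> cabs (y - x) < e ->
    (early_at x (A x) <-> early_at y (A y)).
  move=> cx; have [eAx|nAx] := pselect (early_at x (A x)).
    have nBx : ~ early_at x (B x) by exact: excl.
    have [|d d0 dP] := far x (fun q => early_at q (B q)).
      by move=> H; apply: nBx; exact: early_closedB.
    exists d; first exact: d0.
    move=> y cy yd; have nBy := dP y yd; split=> _; last exact: eAx.
    case: (early_or cy) => [h|h]; [exact: h|case: (nBy h)].
  have [|d d0 dP] := far x (fun q => early_at q (A q)).
    by move=> H; apply: nAx; exact: early_closedA.
  exists d; first exact: d0.
  move=> y cy yd; have nAy := dP y yd; split=> h; [case: (nAx h)|case: (nAy h)].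
have [eA0|nA0] := pselect (early_at p0 (A p0)).
  apply: (early_impossible mu1 r01 r0mu lA lB AB oU U0 UM _ Umax Uc _ nAB).
    by move=> p /UH[].
  move=> p cp; exact: (connected_locally_constant (connected_closure cU) lc cp0 cp eA0).
have eB p : closure U p -> early_at p (B p).
  move=> cp; have [eAp|h] := early_or cp; last exact: h.
  case: nA0; exact: (connected_locally_constant (connected_closure cU) lc cp cp0 eAp).
apply: (early_impossible mu1 r01 r0mu lB lA BA oU U0 UM).
- by move=> p /UH[h _]; rewrite cubC.
- by move=> p cp; rewrite cubC => hB hA; exact: Umax.
- by move=> p /Uc; rewrite coefC.
- by move=> p /eB; exact: early_sym.
- by move=> p /nAB; rewrite eq_sym.
Qed.

End CriticalCollision.

(** * The hyperbolic component and its closure *)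

Section Hyperbolic.
Variable R : realType.
Local Notation C := (Cplx R).
Implicit Types (mu c a b z w p q : C).
Local Notation F mu c := (horner (fpoly mu c)).

Definition hyp mu c := forall z, root (fpoly mu c)^`() z -> immediate_basin (F mu c) 0 z.

Lemma fpoly_cub mu c : exists a b, [/\ fpoly mu c = cub a b, 3 * a * b = mu &
  c = - (3 / 2 * (a + b))].
Proof.
have s1 : (1 < size (fpoly mu c)^`())%N.
  have d2 : (fpoly mu c)^`()`_2 != 0.
    rewrite coef_deriv /fpoly !(coefD, coefZ, coefX, coefXn) /= !mulr0 !add0r.
    by rewrite pnatr_eq0.
  by rewrite ltnNge; apply: contra d2 => h; rewrite nth_default// (leq_trans h).
have [a fa] := poly_has_root 0 s1.
pose b := - (2 / 3 * c) - a.
have ab : 3 * a * b = mu.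
  rewrite deriv_fpolyE in fa.
  have -> : 3 * a * b = mu - (mu + 2 * c * a + 3 * a ^+ 2) by rewrite /b; field.
  by rewrite fa subr0.
have cE : c = - (3 / 2 * (a + b)) by rewrite /b; field.
by exists a, b; rewrite /cub ab -cE.
Qed.

Lemma basin_cvg_unique (f : C -> C) p q z : basin f p z -> basin f q z -> p = q.
Proof.
move=> /cvgC_P hp /cvgC_P hq; apply/eqP; rewrite -subr_eq0 -cabs_eq0 eq_le cabs_ge0 andbT.
apply/ler_addgt0Pr => e e0; rewrite add0r; have e20 : 0 < e / 2 by lra.
have [n1 _ H1] := hp _ e20; have [n2 _ H2] := hq _ e20.
have /= := H1 (maxn n1 n2) (leq_maxl _ _); have /= := H2 (maxn n1 n2) (leq_maxr _ _).
have := cabs_triangle (iter (maxn n1 n2) f z) p q; rewrite (cabs_sub p (iter _ _ _)); lra.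
Qed.

Lemma immediate_basin_sub (f : C -> C) p z : immediate_basin f p z -> basin f p z.
Proof. exact: connected_component_sub. Qed.

Lemma contraction_data mu c : cabs mu < 1 -> exists r0 : R, [/\ 0 < r0, r0 <= 1 &
  r0 * (cabs c + 1) <= (1 - cabs mu) / 2].
Proof.
move=> mu1; have c0 := cabs_ge0 c.
exists (Num.min 1 ((1 - cabs mu) / 2 / (cabs c + 1))); split.
- by rewrite lt_min ltr01 !divr_gt0//; lra.
- by rewrite ge_min lexx.
- by rewrite -ler_pdivlMr; [rewrite ge_min lexx orbT|lra].
Qed.

Lemma theta_bounds mu : cabs mu < 1 -> 0 <= (1 + cabs mu) / 2 < 1.
Proof. by have := cabs_ge0 mu => h1 h2; apply/andP; split; lra. Qed.

(** For [mu = 0] the fixed point is itself critical; otherwise [lit_has_crit] applies with escape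
    radius [|c| + 2]. *)
Lemma immediate_basin_crit mu c : cabs mu < 1 ->
  exists2 x, root (fpoly mu c)^`() x & immediate_basin (F mu c) 0 x.
Proof.
move=> mu1; have [r0 [r00 r01 r0c]] := contraction_data c mu1.
have t01 := theta_bounds mu1.
have ct z : cabs z <= r0 -> cabs (fpoly mu c).[z] <= (1 + cabs mu) / 2 * cabs z.
  exact: fpoly_contract.
have bE x := immediate_basinE (fpoly0 mu c) t01 ct x r00 (lexx r0).
have d0 : (fpoly mu c)^`().[0] = mu by rewrite deriv_fpolyE; ring.
have [mu0|mu0] := eqVneq mu 0.
  exists 0; first by rewrite rootE d0 mu0.
  by apply/bE; exists 0%N; apply: lit0; [exact: fpoly0|].
have c0 := cabs_ge0 c; have m01 : 0 <= cabs mu < 1 by rewrite cabs_ge0.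
have [N NP] := geometric_small (cabs c + 2) m01 r00.
have [|||||||x hx fx] := @lit_has_crit _ (fpoly mu c) (fpoly1 _ _) (fpoly0 _ _)
    ((1 + cabs mu) / 2) r0 t01 ct N r0 (cabs c + 2).
- by rewrite size_fpoly.
- by [].
- by [].
- lra.
- by move=> z; apply: fpoly_escape => //; exact: ltW.
- by rewrite d0.
- by rewrite d0; exact: NP.
by exists x => //; apply/bE; exists N.
Qed.

Lemma aff_conjE a t (g : {poly C}) w : (aff_conj a t g).[w] = a * g.[(w - t) / a] + t.
Proof.
rewrite /aff_conj hornerD hornerC hornerZ horner_comp hornerZ !(hornerD, hornerN, hornerX, hornerC).
by rewrite [a^-1 * _]mulrC.
Qed.

Lemma aff_conj_deriv a t (g : {poly C}) w : a != 0 ->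
  (aff_conj a t g)^`().[w] = g^`().[(w - t) / a].
Proof.
move=> a0; rewrite /aff_conj derivD derivC addr0 derivZ deriv_comp derivZ derivB.
rewrite derivX derivC subr0.
rewrite hornerZ hornerM horner_comp !hornerZ !(hornerD, hornerN, hornerX, hornerC).
by rewrite mulr1 (mulrC a^-1 (w - t)) mulrCA mulfV ?mulr1.
Qed.

Lemma aff_conj_basin a t (g : {poly C}) p w : a != 0 ->
  immediate_basin (horner (aff_conj a t g)) p w ->
  immediate_basin (horner g) ((p - t) / a) ((w - t) / a).
Proof.
move=> a0 hw; pose l : {poly C} := a^-1 *: ('X - t%:P).
have lE z : l.[z] = (z - t) / a.
  by rewrite hornerZ !(hornerD, hornerN, hornerX, hornerC) mulrC.
pose D := immediate_basin (horner (aff_conj a t g)) p.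
have itE n z : iter n (horner g) l.[z] = l.[iter n (horner (aff_conj a t g)) z].
  elim: n => [//|n IH]; rewrite !iterS IH !lE aff_conjE addrK [a * _]mulrC mulfK//.
rewrite -!lE.
apply: (@connected_component_max _ _ [set l.[z] | z in D]).
- exists p => //; apply: (@connected_component_refl).
  exact: connected_component_sub (connected_component_sym hw).
- move=> _ [z /connected_component_sub hz <-].
  move: hz => /cvgC_P hz; apply/cvgC_P => e e0.
  have ea : 0 < e * cabs a by rewrite mulr_gt0// cabs_gt0.
  have [n _ H] := hz _ ea; exists n => // k /= nk.
  rewrite itE !lE -mulrBl opprB addrA subrK cabsM cabsV ltr_pdivrMr ?cabs_gt0//.
  exact: H.
- by apply: poly_connected_image; exact: component_connected.
- by exists w.
Qed.

(** Undoing the conjugacy gives a point [q] whose immediate basin contains all critical points; that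
    of 0 contains one of them, and an orbit has only one limit, so [q = 0]. *)
Lemma in_PHD3P mu c : cabs mu < 1 -> in_PHD3 (fpoly mu c) <-> hyp mu c.
Proof.
move=> mu1; split=> [[_ [a [t [a0 [p [hp _ crit]]]]]]|H].
  pose q := (p - t) / a.
  have key z : root (fpoly mu c)^`() z -> immediate_basin (F mu c) q z.
    move=> fz; have E : (a * z + t - t) / a = z by rewrite addrK mulrC mulKf.
    rewrite -[z]E; apply: aff_conj_basin => //; apply: crit.
    by rewrite rootE aff_conj_deriv// E.
  have [x fx hx] := immediate_basin_crit c mu1.
  have q0 : q = 0.
    exact: basin_cvg_unique (immediate_basin_sub (key x fx)) (immediate_basin_sub hx).
  by move=> z /key; rewrite q0.
split; first exact: size_fpoly.
exists 1, 0; split; first exact: oner_neq0.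
have -> : aff_conj 1 0 (fpoly mu c) = fpoly mu c.
  by rewrite /aff_conj invr1 !scale1r subr0 addr0 comp_polyXr.
exists 0; split; first exact: fpoly0.
- rewrite deriv_fpolyE cabsE -(rmorph1 (real_complex R)) lt_realC.
  by rewrite mulr0 addr0 expr0n mulr0 addr0.
- exact: H.
Qed.

Lemma fpolyN mu c z : (fpoly mu (- c)).[- z] = - (fpoly mu c).[z].
Proof. by rewrite !fpolyE; ring. Qed.

Lemma immediate_basinN mu c z : immediate_basin (F mu c) 0 z ->
  immediate_basin (F mu (- c)) 0 (- z).
Proof.
move=> hz; have nE w : (- 'X : {poly C}).[w] = - w by rewrite hornerN hornerX.
have itE n w : iter n (F mu (- c)) (- w) = - iter n (F mu c) w.
  by elim: n => [//|n IH]; rewrite !iterS IH fpolyN.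
apply: (@connected_component_max _ _ [set (- 'X : {poly C}).[w] | w in immediate_basin (F mu c) 0]).
- exists 0; last by rewrite nE oppr0.
  apply: (@connected_component_refl).
  exact: connected_component_sub (connected_component_sym hz).
- move=> _ [w /connected_component_sub /cvgC_P hw <-]; apply/cvgC_P => e /hw.
  by apply: filterS => k /=; rewrite nE itE !subr0 cabsN.
- by apply: poly_connected_image; exact: component_connected.
- by exists z; rewrite ?nE.
Qed.

Lemma hypN mu c : hyp mu c -> hyp mu (- c).
Proof.
move=> H z; rewrite rootE deriv_fpolyE => fz; rewrite -[z]opprK.
apply: immediate_basinN; apply: H; rewrite rootE deriv_fpolyE.
by move: fz; congr (_ == _); ring.
Qed.

(** The map is odd and its critical points are opposite, so one in the immediate basin brings the
    other. *)
Lemma hyp0 mu : cabs mu < 1 -> hyp mu 0.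
Proof.
move=> mu1 z fz; have [x fx hx] := immediate_basin_crit 0 mu1.
have : (z - x) * (z + x) * 3 = 0.
  move: fz fx; rewrite !rootE !deriv_fpolyE => /eqP fz /eqP fx.
  have -> : (z - x) * (z + x) * 3 = (mu + 2 * 0 * z + 3 * z ^+ 2) - (mu + 2 * 0 * x + 3 * x ^+ 2).
    by ring.
  by rewrite fz fx subrr.
move=> /eqP; rewrite !mulf_eq0 pnatr_eq0 orbF => /orP[|].
  by rewrite subr_eq0 => /eqP ->.
rewrite addr_eq0 => /eqP ->; have := immediate_basinN hx; by rewrite oppr0.
Qed.

Lemma hyp_bound mu c : cabs mu < 1 -> hyp mu c -> cabs c <= 10.
Proof.
move=> mu1 H; have [a [b [E abmu cE]]] := fpoly_cub mu c.
rewrite cE cabsN; apply: cub_basin_bound; first by rewrite abmu ltW.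
- by rewrite -E; apply: immediate_basin_sub; apply: H; rewrite E; apply/cub_crit; left.
- by rewrite -E; apply: immediate_basin_sub; apply: H; rewrite E; apply/cub_crit; right.
Qed.

Definition near2 mu c : set_system (C * C) := [set P | exists2 d : R, 0 < d &
  forall m k, cabs (m - mu) < d -> cabs (k - c) < d -> P (m, k)].

Global Instance near2_filter mu c : Filter (near2 mu c).
Proof.
split=> [|P Q [d d0 HP] [e e0 HQ]|P Q PQ [d d0 HP]].
- by exists 1.
- exists (Num.min d e); first by rewrite lt_min d0.
  move=> m k; rewrite !lt_min => /andP[md me] /andP[kd ke].
  by split; [exact: HP|exact: HQ].
- by exists d => // m k md kd; apply: PQ; exact: HP.
Qed.

Lemma luconv_fpoly mu c : luconv (near2 mu c) (fun mk => fpoly mk.1 mk.2) (fpoly mu c).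
Proof.
apply/luconvP => z.
have FF := @jnear_filter R _ (near2 mu c) (near2_filter mu c) z.
have m1 : ptconv (jnear (near2 mu c) z) (fun iy => iy.1.1) mu.
  by move=> e e0; exists 1 => //; exists e => // m k h _ y _.
have c1 : ptconv (jnear (near2 mu c) z) (fun iy => iy.1.2) c.
  by move=> e e0; exists 1 => //; exists e => // m k _ h y _.
have z1 : ptconv (jnear (near2 mu c) z) (fun iy => iy.2) z by exact: ptconv_snd.
rewrite fpolyE.
have -> : (fun iy : (C * C) * C => (fpoly iy.1.1 iy.1.2).[iy.2]) =
  (fun iy => iy.1.1 * iy.2 + iy.1.2 * iy.2 ^+ 2 + iy.2 ^+ 3).
  by apply: funext => iy; rewrite fpolyE.
apply: ptconvD; last exact: ptconvX.
by apply: ptconvD; apply: ptconvM => //; exact: ptconvX.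
Qed.

Lemma crit_bound mu c z : cabs mu <= 1 -> root (fpoly mu c)^`() z -> cabs z <= cabs c + 1.
Proof.
rewrite rootE deriv_fpolyE => mu1 /eqP E; rewrite leNgt; apply/negP => zc.
have E3 : cabs (3 : C) = 3 by exact: cabs_nat.
have E2 : cabs (2 : C) = 2 by exact: cabs_nat.
have : 3 * z ^+ 2 = - (mu + 2 * c * z).
  by apply/eqP; rewrite -addr_eq0 addrC E.
move=> /(congr1 (@cabs R)); rewrite cabsN cabsM cabsX E3 => H.
have := cabsD mu (2 * c * z); rewrite -H !cabsM E2.
have := cabs_ge0 c; have := cabs_ge0 z; nra.
Qed.

(** A critical point [z] of a nearby cubic satisfies [3 (z - a) (z - b) = (mu - mu') + 2 (c - c')
    z], so it is close to [a] or [b], whose neighbourhoods stay in some [lit k r0] under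
    perturbation. *)
Lemma hyp_open mu c : cabs mu < 1 -> hyp mu c ->
  near2 mu c [set mk | cabs mk.1 < 1 /\ hyp mk.1 mk.2].
Proof.
move=> mu1 H; have [a [b [E abmu cE]]] := fpoly_cub mu c.
have c0 := cabs_ge0 c; have m0 := cabs_ge0 mu.
(* [m] bounds the multipliers nearby, [K] the coefficients, and [t] is a contraction factor common
   to all of them. *)
have [m mE] : exists m, m = (1 + cabs mu) / 2 by eexists.
have [K KE] : exists K, K = cabs c + 1 by eexists.
have [t tE] : exists t, t = (1 + m) / 2 by eexists.
have t01 : 0 <= t < 1 by apply/andP; split; lra.
have [r0 r0E] : exists r0, r0 = Num.min 1 ((1 - m) / 2 / (K + 1)) by eexists.
have r00 : 0 < r0 by rewrite r0E lt_min ltr01 !divr_gt0//; lra.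
have r01 : r0 <= 1 by rewrite r0E ge_min lexx.
have r0K : r0 * (K + 1) <= (1 - m) / 2.
  by rewrite -ler_pdivlMr; [rewrite r0E ge_min lexx orbT|lra].
have ct mu' c' : cabs mu' <= m -> cabs c' <= K ->
    forall z, cabs z <= r0 -> cabs (fpoly mu' c').[z] <= t * cabs z.
  move=> mm ck z zr; apply: (@le_trans _ _ ((1 + cabs mu') / 2 * cabs z)).
    have h3 : r0 * (K + 1) <= (1 - cabs mu') / 2 by lra.
    exact: (fpoly_contract ck r01 h3 zr).
  by rewrite ler_wpM2r ?cabs_ge0// tE; lra.
have bE mu' c' (h1 : cabs mu' <= m) (h2 : cabs c' <= K) x :=
  immediate_basinE (fpoly0 mu' c') t01 (ct mu' c' h1 h2) x r00 (lexx r0).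
have mm : cabs mu <= m by lra.
have cK : cabs c <= K by lra.
have crit_near z : z = a \/ z = b -> exists k, exists2 d : R, 0 < d & near2 mu c
    [set mk | forall y, cabs (y - z) < d -> lit (fpoly mk.1 mk.2) k r0 y].
  move=> zab; have fz : root (fpoly mu c)^`() z by rewrite E; apply/cub_crit.
  have /(bE _ _ mm cK)[k hk] := H z fz.
  have lk : luconv (near2 mu c) (fun mk => pit (fpoly mk.1 mk.2) k) (pit (fpoly mu c) k).
    by apply: luconv_pit; exact: luconv_fpoly.
  have [r' [r'r r'0 [d d0 P]]] := lemn_open_family lk hk.
  exists k; exists d => //; apply: filterS P => i /= h y /h; exact: lit_mono_r (ltW r'r) _.
have [ka [da da0 Ha]] := crit_near a (or_introl erefl).
have [kb [db db0 Hb]] := crit_near b (or_intror erefl).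
have [d dE] : exists d, d = Num.min da db by eexists.
have d0 : 0 < d by rewrite dE lt_min da0.
have dda : d <= da by rewrite dE ge_min lexx.
have ddb : d <= db by rewrite dE ge_min lexx orbT.
have [e eE] : exists e, e = Num.min ((1 - cabs mu) / 2)
  (Num.min 1 (d ^+ 2 / (1 + 2 * (K + 1)))) by eexists.
have e0 : 0 < e.
  by rewrite eE !lt_min ltr01 /= !divr_gt0 ?exprn_gt0//; lra.
have e1 : e <= (1 - cabs mu) / 2 by rewrite eE ge_min lexx.
have e2 : e <= 1 by rewrite eE !ge_min lexx ?orbT.
have e3 : e * (1 + 2 * (K + 1)) <= d ^+ 2.
  by rewrite -ler_pdivlMr; [rewrite eE !ge_min lexx ?orbT|lra].
have He : near2 mu c [set mk | cabs (mk.1 - mu) < e /\ cabs (mk.2 - c) < e] by exists e.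
apply: filterS2 (filterI Ha Hb) He => -[mu' c'] [/= ha hb] [mue ce].
have m'1 : cabs mu' <= m by have := cabsB_ge mu' mu; lra.
have c'K : cabs c' <= K by have := cabsB_ge c' c; lra.
split; first lra.
move=> z fz; apply/(bE _ _ m'1 c'K).
have zK : cabs z <= K + 1 by have := crit_bound (ltac:(lra) : cabs mu' <= 1) fz; lra.
have E3 : cabs (3 : C) = 3 by exact: cabs_nat.
have E2 : cabs (2 : C) = 2 by exact: cabs_nat.
have z0 := cabs_ge0 z.
have prod : 3 * (cabs (z - a) * cabs (z - b)) <= e * (1 + 2 * (K + 1)).
  have -> : 3 * (cabs (z - a) * cabs (z - b)) = cabs ((mu - mu') + 2 * (c - c') * z).
    have fz' := fz; rewrite rootE deriv_fpolyE in fz'.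
    have -> : (mu - mu') + 2 * (c - c') * z = 3 * ((z - a) * (z - b)).
      have -> : (mu - mu') + 2 * (c - c') * z =
        (mu + 2 * c * z + 3 * z ^+ 2) - (mu' + 2 * c' * z + 3 * z ^+ 2) by ring.
      by rewrite (eqP fz') subr0 -abmu cE; field.
    by rewrite cabsM E3 cabsM.
  apply: le_trans (cabsD _ _) _; rewrite (cabs_sub mu) !cabsM E2 (cabs_sub c).
  have := cabs_ge0 (c' - c); have := cabs_ge0 (mu' - mu); nra.
have [za|za] := ltP (cabs (z - a)) d; first by exists ka; apply: ha; lra.
have [zb|zb] := ltP (cabs (z - b)) d; first by exists kb; apply: hb; lra.
have : d ^+ 2 <= cabs (z - a) * cabs (z - b) by rewrite expr2; apply: ler_pM => //; exact: ltW.
have : 0 < d ^+ 2 by rewrite exprn_gt0.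
lra.
Qed.

Lemma hyp_open_slice mu c : cabs mu < 1 -> hyp mu c ->
  exists2 d : R, 0 < d & forall k, cabs (k - c) < d -> hyp mu k.
Proof.
move=> mu1 H; have [d d0 P] := hyp_open mu1 H; exists d => // k kd.
by have [] := P mu k _ kd; rewrite // subrr cabs0.
Qed.

End Hyperbolic.

(** * Connectedness of a hyperbolic slice *)

Section HyperbolicSlice.
Variable R : realType.
Local Notation C := (Cplx R).
Variable mu : C.
Hypotheses (mu0 : mu != 0) (mu1 : cabs mu < 1).
Implicit Types (c p q : C).

Let H : set C := [set c | hyp mu c].
Let B p : C := mu / 3 / p.
Let coef p : C := slice_coef id B p.

Let AB p : p != 0 -> 3 * p * B p = mu.
Proof. by move=> p0; rewrite /B; field. Qed.

Let cubE p : p != 0 -> cub p (B p) = fpoly mu (- coef p).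
Proof. exact: (slice_fpoly AB). Qed.

Let lB : laurent B. Proof. exact: laurent_inv. Qed.
Let lcoef : laurent coef. Proof. by apply: laurent_slice_coef; [exact: laurent_id|exact: lB]. Qed.

Let V : set C := [set p | p != 0 /\ hyp mu (- coef p)].

Let oV : open V.
Proof.
apply/openC_P => p [p0 hp]; have [d d0 dP] := hyp_open_slice mu1 hp.
have [e e0 eP] := laurent_cont lcoef p0 d0.
have [e' e'0 e'P] := pnear_neq0 p0.
exists (Num.min e e'); first by rewrite lt_min e0.
move=> q; rewrite lt_min => /andP[/eP /= qe /e'P /= q0]; split=> //.
by apply: dP; rewrite -opprD cabsN.
Qed.

Let E3 : cabs (3 : C) = 3. Proof. exact: cabs_nat. Qed.

Let E2 : cabs (2 : C) = 2. Proof. exact: cabs_nat. Qed.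

Let coef_ge p : p != 0 -> 3 / 2 * (cabs p - cabs (B p)) <= cabs (coef p) /\
  3 / 2 * (cabs (B p) - cabs p) <= cabs (coef p).
Proof.
move=> p0; have -> : cabs (coef p) = 3 / 2 * cabs (p + B p).
  by rewrite /coef /slice_coef cabsM (cabsM 3) cabsV E3 E2.
have h1 := cabsB_ge p (- B p); have h2 := cabsB_ge (B p) (- p).
rewrite !opprK !cabsN in h1 h2; rewrite (addrC (B p)) in h2.
by split; apply: ler_wpM2l => //; lra.
Qed.

Let cabsB p : cabs (B p) = cabs mu / 3 / cabs p.
Proof. by rewrite /B !cabsM !cabsV E3. Qed.

Let mu_gt0 : 0 < cabs mu. Proof. by rewrite cabs_gt0. Qed.

(** A small [p] makes [B p] large and a large [p] makes [B p] small, and either way the coefficient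
    is large. This keeps the components of [V] bounded, with closure away from 0. *)
Let coef_bounds p : p != 0 -> cabs (coef p) <= 10 -> cabs mu / 30 <= cabs p <= 10.
Proof.
move=> p0 c10; have [h1 h2] := coef_ge p0; have m0 := mu_gt0; have m1 := mu1.
have pp : 0 < cabs p by rewrite cabs_gt0.
have Bp : cabs (B p) * cabs p = cabs mu / 3 by rewrite cabsB divfK// lt0r_neq0.
have b0 := cabs_ge0 (B p).
apply/andP; split; rewrite leNgt; apply/negP => h.
  have : cabs (B p) <= 10 by lra.
  nra.
have : 10 / 3 <= cabs (B p) by lra.
by nra.
Qed.

(** By [slice_no_collision_false] the component of [a] in the [p]-plane contains some [p = B p];
    then [3 p^2 = mu], and [k = - 3 p] has square [3 mu]. The map [p -> - coef p] carries that
    component into the component of [c]. *)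
Lemma hyp_slice_collision c : H c -> exists2 k : C, k ^+ 2 = 3 * mu & connected_component H c k.
Proof.
move=> Hc; have [a [b [fE abmu cE]]] := fpoly_cub mu c.
have a0 : a != 0 by apply: contraNneq mu0 => a0; rewrite -abmu a0 mulr0 mul0r.
have bE : b = B a by rewrite /B -abmu; field.
have ca : - coef a = c by rewrite cE bE.
have Va : V a by split=> //; rewrite ca.
pose U := connected_component V a.
have UV p : U p -> V p by exact: connected_component_sub.
have oU : open U by apply: open_connected_component.
have cU : connected U by exact: component_connected.
have Ua : U a by exact: connected_component_refl.
have V10 p : V p -> cabs (coef p) <= 10.
  by move=> [p0 /(hyp_bound mu1)]; rewrite cabsN.
have UM p : U p -> cabs p <= 10.
  by move=> /UV Vp; have /andP[] := coef_bounds (proj1 Vp) (V10 p Vp).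
have Uc p : closure U p -> p != 0 /\ cabs (coef p) <= 10.
  move=> /closureC_P cp.
  have p0 : p != 0.
    rewrite -cabs_gt0; have m0 := mu_gt0; have m30 : 0 < cabs mu / 60 by lra.
    have [q Uq qp] := cp _ m30; have Vq := UV q Uq.
    have /andP[h _] := coef_bounds (proj1 Vq) (V10 q Vq).
    by have := cabsB_ge q p; lra.
  split=> //; rewrite leNgt; apply/negP => c10.
  have e0 : 0 < cabs (coef p) - 10 by lra.
  have [d d0 dP] := laurent_cont lcoef p0 e0.
  have [q Uq qp] := cp d d0; have h := V10 q (UV q Uq).
  have := dP q qp; rewrite /= (cabs_sub (coef q)).
  by have := cabsB_ge (coef p) (coef q); lra.
have hypE p : p != 0 -> hyp mu (- coef p) <-> immediate_basin (horner (cub p (B p))) 0 p /\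
    immediate_basin (horner (cub p (B p))) 0 (B p).
  move=> p0; rewrite cubE//; split=> [h|[h1 h2] z fz].
    by split; apply: h; rewrite -cubE//; apply/cub_crit; [left|right].
  have : z = p \/ z = B p by apply/cub_crit; rewrite cubE.
  by case=> ->; [exact: h1|exact: h2].
have [r0 r0E] : exists r0, r0 = Num.min 1 ((1 - cabs mu) / 50) by eexists.
have m1 := mu1.
have r00 : 0 < r0 by rewrite r0E lt_min ltr01 divr_gt0//; lra.
have r01 : r0 <= 1 by rewrite r0E ge_min lexx.
have r0mu : r0 * 25 <= (1 - cabs mu) / 2.
  have : r0 <= (1 - cabs mu) / 50 by rewrite r0E ge_min lexx orbT.
  lra.
have m01 : 0 <= cabs mu < 1 by rewrite cabs_ge0.
have [n NP] := geometric_small 26 m01 r00.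
have [p Up pB] : exists2 p, U p & p = B p.
  apply: contrapT => no.
  apply: (slice_no_collision_false mu0 mu1 r00 r01 r0mu (NP n.+1 (leqnSn n))
    (@laurent_id R) lB AB oU cU _ UM _ _ Uc).
  - by exists a.
  - by move=> p /UV[p0 /(hypE p p0)].
  - move=> p cp h1 h2; apply: (connected_component_clopen oV _ cp); split; first by case: (Uc p cp).
    by apply/hypE => //; case: (Uc p cp).
  - by move=> p Up; apply/eqP => pB; apply: no; exists p.
have [p0 Hp] := UV p Up.
exists (- coef p).
  rewrite /coef /slice_coef -pB sqrrN.
  have -> : (3 / 2 * (p + p)) ^+ 2 = 3 * (3 * p * p) by field.
  by rewrite {2}pB AB.
rewrite -ca.
have lc x : U x -> exists2 e : R, 0 < e & forall y, U y -> cabs (y - x) < e ->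
    (connected_component H (- coef a) (- coef x) <-> connected_component H (- coef a) (- coef y)).
  move=> Ux; have [x0 Hx] := UV x Ux.
  have [d d0 dP] := hyp_open_slice mu1 Hx.
  have [e e0 eP] := laurent_cont lcoef x0 d0.
  exists e => // y Uy /eP /= yx.
  have xy : connected_component H (- coef x) (- coef y).
    apply: segment_component => t tt; apply: dP; apply: cdisk_convex => //.
      by rewrite subrr cabs0.
    by rewrite -opprD cabsN.
  split=> h; first exact: connected_component_trans h xy.
  by apply: connected_component_trans h _; exact: connected_component_sym.
apply: (connected_locally_constant cU lc Ua Up).
by apply: connected_component_refl; rewrite ca.
Qed.

(** The component of 0 contains one root of [k^2 = 3 mu] and is invariant under [c -> -c], so it
    contains both, and thus meets the component of [c]. *)
Lemma hyp_slice_component c : H c -> connected_component H 0 c.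
Proof.
move=> Hc; have H0 : H 0 by exact: hyp0.
have [k k2 ck] := hyp_slice_collision Hc.
have [k' k'2 zk'] := hyp_slice_collision H0.
have zkN : connected_component H 0 (- k').
  apply: (@connected_component_max _ _ [set (- 'X : {poly C}).[w] | w in connected_component H 0]).
  - by exists 0; [exact: connected_component_refl|rewrite hornerN hornerX oppr0].
  - by move=> _ [w /connected_component_sub hw <-]; rewrite hornerN hornerX; exact: hypN.
  - by apply: poly_connected_image; exact: component_connected.
  - by exists k'; rewrite // hornerN hornerX.
have : (k - k') * (k + k') = 0 by rewrite -subr_sqr k2 k'2 subrr.
have tr x : connected_component H 0 x -> k = x -> connected_component H 0 c.
  move=> h E; rewrite -E in h; apply: connected_component_trans h _.
  exact: connected_component_sym.
move=> /eqP; rewrite mulf_eq0 => /orP[|].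
  by rewrite subr_eq0 => /eqP; exact: tr.
by rewrite addr_eq0 => /eqP; exact: tr.
Qed.

End HyperbolicSlice.

(** * The limit slices *)

Section Closures.
Variable R : realType.
Local Notation C := (Cplx R).
Implicit Types (lam mu b c : C).

Let S : set (C * C) := [set mc | `|mc.1| < 1 /\ in_PHD3 (fpoly mc.1 mc.2)].

Lemma norm_lt1 (z : C) : (`|z| < 1) = (cabs z < 1).
Proof. by rewrite cabsE -(rmorph1 (real_complex R)) lt_realC. Qed.

Lemma norm_le1 (z : C) : (`|z| <= 1) = (cabs z <= 1).
Proof. by rewrite cabsE -(rmorph1 (real_complex R)) lecR. Qed.

Lemma PHD3_hyp mu c : S (mu, c) <-> cabs mu < 1 /\ hyp mu c.
Proof.
rewrite /S /= norm_lt1; split=> -[h1 h2]; split=> //; exact/(in_PHD3P c h1).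
Qed.

Lemma PsetP lam b : Pset lam b <-> cabs lam <= 1 /\
  forall e : R, 0 < e -> exists mu c, [/\ cabs mu < 1, hyp mu c,
    cabs (mu - lam) < e & cabs (c - b) < e].
Proof.
rewrite /Pset /= norm_le1; split=> -[h1 h2]; split=> //.
  move=> e e0; have : nbhs (lam, b) [set mc : C * C | cabs (mc.1 - lam) < e /\ cabs (mc.2 - b) < e].
    exists ([set m : C | cabs (m - lam) < e], [set c : C | cabs (c - b) < e]).
      by split; apply/nbhs_cabs; exists e.
    by move=> [m c] [].
  by move=> /h2[[m c] [/PHD3_hyp[m1 hm] [mm cc]]]; exists m, c.
move=> W [[W1 W2] [/nbhs_cabs[e1 e10 eO1] /nbhs_cabs[e2 e20 eO2]] OO].
have m0 : 0 < Num.min e1 e2 by rewrite lt_min e10.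
have [m [c [m1 hm]]] := h2 _ m0; rewrite !lt_min => /andP[mm _] /andP[_ cc].
exists (m, c); split; first exact/PHD3_hyp.
by apply: OO; split=> /=; [exact: eO1|exact: eO2].
Qed.

Lemma Pset_hyp mu c : cabs mu < 1 -> hyp mu c -> Pset mu c.
Proof.
move=> mu1 H; apply/PsetP; split; first exact: ltW.
by move=> e e0; exists mu, c; rewrite !subrr cabs0.
Qed.

(** The multiplier is pulled radially into the open disk, where [hyp0] applies. *)
Lemma Pset0 lam : cabs lam <= 1 -> Pset lam 0.
Proof.
move=> lam1; apply/PsetP; split=> // e e0.
have [t tE] : exists t, t = Num.min (1 / 2) (e / 2) by eexists.
have t0 : 0 < t by rewrite tE lt_min; apply/andP; split; lra.
have t1 : t <= 1 / 2 by rewrite tE ge_min lexx.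
have te : t <= e / 2 by rewrite tE ge_min lexx orbT.
have m1 : cabs ((1 - t)%:C%C * lam) < 1.
  by rewrite cabs_scale; [have := cabs_ge0 lam; nra|lra].
exists ((1 - t)%:C%C * lam), 0; split=> //.
- exact: hyp0.
- rewrite cabs_scale_sub gtr0_norm//; have := cabs_ge0 lam; nra.
- by rewrite subrr cabs0.
Qed.

Lemma Pset_interior lam : cabs lam < 1 -> (Pset lam)^° 0.
Proof.
move=> lam1; have [d d0 dP] := hyp_open_slice lam1 (hyp0 lam1).
by apply/nbhs_cabs; exists d => // c /dP; exact: Pset_hyp.
Qed.

Lemma Pset_bound lam b : Pset lam b -> cabs b <= 10.
Proof.
move=> /PsetP[_ H]; rewrite leNgt; apply/negP => b10.
have e0 : 0 < cabs b - 10 by lra.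
have [m [c [m1 /(hyp_bound m1) c10 _ cb]]] := H _ e0.
by have := cabsB_ge b c; rewrite (cabs_sub b); lra.
Qed.

Lemma closed_Pset lam : closed (Pset lam).
Proof.
move=> b /closureC_P cb; apply/PsetP.
have [b' /PsetP[lam1 _] _] := cb 1 ltr01; split=> // e e0.
have e20 : 0 < e / 2 by lra.
have [b1 /PsetP[_ H] b1b] := cb _ e20.
have [m [c [m1 hm mm cc]]] := H _ e20.
by exists m, c; split=> //; [lra|have := cabs_triangle b1 c b; lra].
Qed.

Lemma compact_Pset lam : compact (Pset lam).
Proof. exact: bounded_closed_compactC (@closed_Pset lam) (@Pset_bound lam). Qed.

(* A clopen part of the limit set that contains 0 has disjoint neighbourhoods with its
   complement, and the nearby hyperbolic slices, which are connected and contain 0, stay in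
   the neighbourhood of the first part. *)
Lemma Pset_clopen lam (O D : set C) : open O -> closed D -> Pset lam `&` O = Pset lam `&` D ->
  O 0 -> cabs lam <= 1 -> Pset lam `<=` O.
Proof.
move=> /openC_P oO cD OD O0 lam1 x Px; apply: contrapT => nOx.
pose K1 := Pset lam `&` O; pose K2 := Pset lam `&` ~` O.
have cK1 : compact K1.
  rewrite /K1 OD; apply: (@subclosed_compact _ _ (Pset lam)); last by move=> y [].
    by apply: closedI; [exact: closed_Pset|exact: cD].
  exact: compact_Pset.
have [d d0 dP] : exists2 d : R, 0 < d & forall y, K1 y -> forall z, K2 z -> d <= cabs (y - z).
  apply: (@compact_pos_lower _ K1 (fun d y => forall z, K2 z -> d <= cabs (y - z))) => //.
    by move=> t t' y h tt z /h; exact: le_trans.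
  move=> y [_ Oy]; have [e e0 eO] := oO y Oy; exists (e / 2); first lra.
  move=> y' y'y z [_ nOz]; rewrite leNgt; apply/negP => h; apply: nOz; apply: eO.
  by have := cabs_triangle y' z y; rewrite (cabs_sub z y'); lra.
pose O1 : set C := [set c | exists2 y, K1 y & cabs (c - y) < d / 3].
pose O2 : set C := [set c | exists2 y, K2 y & cabs (c - y) < d / 3].
have O12 c : O1 c -> O2 c -> False.
  move=> [y Ky cy] [z Kz cz]; have := dP y Ky z Kz.
  by have := cabs_triangle c y z; rewrite (cabs_sub y c); lra.
have oP (K : set C) : open [set c | exists2 y, K y & cabs (c - y) < d / 3].
  apply/openC_P => c /= [y Ky cy]; exists (d / 3 - cabs (c - y)); first lra.
  by move=> c' c'c; exists y => //; have := cabs_triangle c c' y; lra.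
pose L : set C := [set c | cabs c <= 10] `&` ~` (O1 `|` O2).
have cL : compact L.
  apply: (@bounded_closed_compactC _ _ 10); last by move=> c [].
  apply: closedI; last by apply: open_closedC; apply: openU; exact: oP.
  have -> : [set c : C | cabs c <= 10] = ~` [set c | 10 < cabs (c - 0)].
    by apply/seteqP; split=> c /=; rewrite subr0 leNgt => /negP.
  by apply: open_closedC; exact: open_far.
(* Outside [O1] and [O2] no point is a limit of hyperbolic parameters; compactness of [L] gives one
   distance [e] for all of them. *)
have [e e0 eP] : exists2 e : R, 0 < e & forall c, L c ->
    forall m k, cabs m < 1 -> hyp m k -> cabs (m - lam) < e -> cabs (k - c) < e -> False.
  apply: (@compact_pos_lower _ L (fun e c => forall m k, cabs m < 1 -> hyp m k ->
    cabs (m - lam) < e -> cabs (k - c) < e -> False)) => //.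
    by move=> t t' c h tt m k m1 hm mm kc; apply: (h m k) => //; lra.
  move=> c [_ nO]; have [Pc|nPc] := pselect (Pset lam c).
    exfalso; apply: nO; have [inO|nOc] := pselect (O c).
      by left; exists c; rewrite ?subrr ?cabs0//; lra.
    by right; exists c; rewrite ?subrr ?cabs0//; lra.
  have [e [e0 H]] : exists e : R, 0 < e /\ ~ (exists mu k, [/\ cabs mu < 1, hyp mu k,
      cabs (mu - lam) < e & cabs (k - c) < e]).
    apply: contrapT => H; apply: nPc; apply/PsetP; split=> // e e0.
    by apply: contrapT => h; apply: H; exists e.
  exists (e / 2); first lra.
  move=> c' c'c m k m1 hm mm kc; apply: H; exists m, k; split; [exact: m1|exact: hm|lra|].
  by have := cabs_triangle c' k c; lra.
have m0 : 0 < Num.min e (d / 3) by rewrite lt_min e0; lra.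
have /PsetP[_ /(_ _ m0)[m [c [m1 hm]]]] := Px.
rewrite !lt_min => /andP[me _] /andP[_ cx].
(* Slices are known to be connected for nonzero multipliers, so a vanishing [m] is moved slightly
   within the open set of hyperbolic parameters. *)
have [m' [m'0 m'1 hm' m'e]] : exists m', [/\ m' != 0, cabs m' < 1, hyp m' c & cabs (m' - lam) < e].
  have [mz|mn0] := eqVneq m 0; last by exists m.
  have [d1 d10 H] := hyp_open m1 hm.
  have e1 : 0 < e - cabs (m - lam) by lra.
  have [t tE] : exists t, t = Num.min (d1 / 2) ((e - cabs (m - lam)) / 2) by eexists.
  have t0 : 0 < t by rewrite tE lt_min; apply/andP; split; lra.
  have t1 : t <= d1 / 2 by rewrite tE ge_min lexx.
  have t2 : t <= (e - cabs (m - lam)) / 2 by rewrite tE ge_min lexx orbT.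
  have tm : cabs (t%:C%C - m) = t by rewrite mz subr0 cabs_real gtr0_norm.
  have [|/= h1 h2] := H t%:C%C c _ (ltac:(rewrite subrr cabs0; lra)); first by rewrite tm; lra.
  exists t%:C%C; split=> //; first by rewrite -cabs_gt0 cabs_real gtr0_norm.
  by have := cabs_triangle m t%:C%C lam; rewrite tm; lra.
have slice k : hyp m' k -> O1 k \/ O2 k.
  move=> hk; apply: contrapT => nO; apply: (eP k _ m' k m'1 hk m'e); last by rewrite subrr cabs0.
  by split; [exact: hyp_bound hk|].
have P0 := Pset0 lam1.
have : O1 c.
  apply: (@connected_sub_open _ (connected_component [set k | hyp m' k] 0) O1).
  - exact: component_connected.
  - exact: oP.
  - exists 0; split; first by apply: connected_component_refl; exact: hyp0.
    by exists 0; [split|rewrite subrr cabs0; lra].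
  - move=> k /connected_component_sub /slice[//|O2k] /closureC_P cO1; exfalso.
    have /openC_P/(_ k O2k)[s s0 sO2] := oP K2.
    have [u O1u /sO2 O2u] := cO1 s s0; exact: O12 O1u O2u.
  - exact: hyp_slice_component.
by move=> O1c; apply: (O12 c O1c); exists x.
Qed.

(** A clopen part that contains 0 is everything by [Pset_clopen]; if 0 is missing, the same for the
    complement leaves the part empty. *)
Lemma connected_Pset lam : cabs lam <= 1 -> connected (Pset lam).
Proof.
move=> lam1 K [y Ky] [W oO KO] [D cD KD].
have sub (W' D' : set C) : open W' -> closed D' -> Pset lam `&` W' = Pset lam `&` D' ->
    W' 0 -> Pset lam `<=` W' by move=> oO' cD' E h; exact: Pset_clopen E h lam1.
have P0 := Pset0 lam1.
have [W0|nW0] := pselect (W 0).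
  rewrite KO; apply/seteqP; split=> [x []//|x Px]; split=> //.
  by apply: (sub W D) => //; rewrite -KO.
exfalso.
have E : Pset lam `&` ~` D = Pset lam `&` ~` W.
  have KOD : Pset lam `&` W = Pset lam `&` D by rewrite -KO.
  apply/seteqP; split=> x [Px nx]; split=> // h; apply: nx.
    by have : (Pset lam `&` W) x by []; rewrite KOD => -[].
  by have : (Pset lam `&` D) x by []; rewrite -KOD => -[].
have nD0 : (~` D) 0.
  by have [] : (Pset lam `&` ~` D) 0 by rewrite E.
have /(_ y) := sub (~` D) (~` W) (closed_openC cD) (open_closedC oO) E nD0.
by have := Ky; rewrite KD => -[Py Dy] /(_ Py).
Qed.

End Closures.

Theorem theorem3p7 (R : realType) :
  (forall lam : Cplx R, `|lam| < 1 -> (Pset lam)^° 0) /\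
  (forall lam : Cplx R, `|lam| <= 1 -> Pset lam 0 /\ continuum (Pset lam)).
Proof.
split=> lam; first by rewrite norm_lt1; exact: Pset_interior.
rewrite norm_le1 => lam1; have P0 := Pset0 lam1.
split=> //; split; first by exists 0.
by split; [exact: compact_Pset|exact: connected_Pset].
Qed.
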